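(* Let $\{X_i\}_{i\in\mathbb{Z}}$ be a stationary Gaussian time series with mean $\mu$ and autocovariance function $\gamma_X$, satisfying $\sum_{h=-\infty}^{+\infty}\gamma_X(h)>0$ and $\sum_{h=-\infty}^{+\infty}h^2|\gamma_X(h)|<\infty$. Let $K\ge2$ be a fixed integer and suppose that $|\mathcal{M}_1|=|\mathcal{M}_2|=\cdots=|\mathcal{M}_K|$. Suppose the null hypothesis $H_0:\mu=\mu_0$ holds, and let the bandwidth $l=l_T$ satisfy $1/l+l^3/T\to0$ as $T\to\infty$. Then $$\sup_{x\in[0,+\infty)}\bigl|P(|T_K|\le x)-P^*(|T_K^*|\le x)\bigr|=o_p(1/T).$$
   Context: Given observations $X_1,\dots,X_T$, the $j$th group of indices is $\mathcal{M}_j=\{s\in\mathbb{Z}:(j-1)T/K<s\le jT/K\}$, $j=1,\dots,K$. The group means are $\hat\mu_k=\frac{1}{|\mathcal{M}_k|}\sum_{i\in\mathcal{M}_k}X_i$; put $\bar\mu_n=\frac1K\sum_{i=1}^K\hat\mu_i$ and $S_n^2=\frac{1}{K-1}\sum_{i=1}^K(\hat\mu_i-\bar\mu_n)^2$. The subsampling-based $t$-statistic is $T_K=\sqrt K(\bar\mu_n-\mu_0)/S_n$. It is a function of $(X_1-\mu_0,\dots,X_T-\mu_0)$. Gaussian dependent bootstrap: let $\bar X_T=\frac1T\sum_{i=1}^TX_i$, $\hat\gamma_X(h)=\frac1T\sum_{i=1}^{T-h}(X_i-\bar X_T)(X_{i+h}-\bar X_T)$ for $h=0,1,\dots,T-1$,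 and let $\omega(x)=(1-|x|)\mathbf{I}\{|x|<1\}$ be the Bartlett kernel. Let $\hat\Xi(\omega;l)$ be the $T\times T$ (semi-positive definite) matrix with $(i,j)$th entry $\omega((i-j)/l)\,\hat\gamma_X(|i-j|)$. Conditionally on the data, the bootstrap sample $(X_1^*,\dots,X_T^* )$ is drawn from $N(0,\hat\Xi(\omega;l))$. $P^*$ denotes the bootstrap probability conditional on the data. $T_K^*$ is the statistic obtained from $T_K$ by replacing $(X_1-\mu_0,\dots,X_T-\mu_0)$ with $(X_1^*,\dots,X_T^* )$. The symbol $o_p$ refers to the probability law of the data. *)

(* Defs.v *)
From HB Require Import structures.
From mathcomp Require Export all_boot all_order all_algebra.
From mathcomp Require Export all_classical all_reals all_analysis.
Export numFieldNormedType.Exports.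
Import Order.TTheory GRing.Theory Num.Theory.

Set Implicit Arguments.
Unset Strict Implicit.
Unset Printing Implicit Defensive.

Local Open Scope classical_set_scope.
Local Open Scope ring_scope.

(* N(m, v), v being the variance, with the degenerate law at m when v = 0;
   normal_prob takes the standard deviation and is not a Dirac mass at 0. *)
Definition normal_law (R : realType) (m v : R) (A : set R) : \bar R :=
  if v == 0 then \d_m A else normal_prob m (Num.sqrt v) A.

Definition is_normal d (T : measurableType d) (R : realType)
    (P : probability T R) (Y : T -> R) (m v : R) : Prop :=
  0 <= v /\
  forall A : set R, measurable A -> P (Y @^-1` A) = normal_law m v A.

(* Y ~ N(m, Sigma), Sigma possibly singular: every linear combination a . Y is
   N(a . m, a Sigma a^T). *)
Definition is_mvnormal d (T : measurableType d) (R : realType)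
    (P : probability T R) (n : nat) (Y : 'I_n -> {mfun T >-> R})
    (m : 'rV[R]_n) (Sigma : 'M[R]_n) : Prop :=
  forall a : 'rV[R]_n,
    is_normal P (fun w => \sum_i a 0 i * Y i w)
      (\sum_i a 0 i * m 0 i) ((a *m Sigma *m a^T) 0 0).

Definition gaussian_series d (T : measurableType d) (R : realType)
    (P : probability T R) (X : int -> {mfun T >-> R}) : Prop :=
  forall (n : nat) (t : 'I_n -> int),
    exists (m : 'rV[R]_n) (Sigma : 'M[R]_n),
      is_mvnormal P (fun i => X (t i)) m Sigma.

Definition stationary_with d (T : measurableType d) (R : realType)
    (P : probability T R) (X : int -> {mfun T >-> R})
    (mu : R) (gamma : int -> R) : Prop :=
  (forall i : int, 'E_P[X i]%E = mu%:E) /\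
  (forall i h : int, covariance P (X (i + h)) (X i) = (gamma h)%:E).

(* Two-sided series, as the limit of the sums over -n <= h <= n; it is used
   only for absolutely summable families. *)
Definition zseries (R : realType) (f : int -> R) : R :=
  limn (fun n : nat => \sum_(i < n.*2.+1) f (i%:Z - n%:Z)).

Section Statistics.
Context {R : realType}.
Implicit Types K T : nat.

(* A sample (x_1, ..., x_T) is a map x : 'I_T -> R with x_s stored at the
   ordinal s - 1; groups are likewise numbered from 0, so that
   group K T j is M_{j+1}. *)

Definition group K T (j : 'I_K) : {set 'I_T} :=
  [set s : 'I_T | (j%:R * T%:R / K%:R < s.+1%:R :> rat) &&
                  (s.+1%:R <= j.+1%:R * T%:R / K%:R :> rat)]%SET.

Definition equal_groups K T : Prop :=
  forall i j : 'I_K, #|group T i| = #|group T j|.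

Definition group_mean K T (z : 'I_T -> R) (j : 'I_K) : R :=
  (#|group T j|%:R)^-1 * \sum_(s in group T j) z s.

Definition mean_of_groups K T (z : 'I_T -> R) : R :=
  K%:R^-1 * \sum_(j < K) group_mean z j.

Definition sd_of_groups K T (z : 'I_T -> R) : R :=
  Num.sqrt ((K%:R - 1)^-1 *
    \sum_(j < K) (group_mean z j - mean_of_groups K z) ^+ 2).

(* As a function of the centred sample z_i = x_i - mu_0. *)
Definition tstat K T (z : 'I_T -> R) : R :=
  Num.sqrt K%:R * mean_of_groups K z / sd_of_groups K z.

Definition sample_mean T (x : 'I_T -> R) : R := T%:R^-1 * \sum_(i < T) x i.

Definition sample_acov T (x : 'I_T -> R) (h : nat) : R :=
  T%:R^-1 * \sum_(i < T) \sum_(j < T | nat_of_ord j == (i + h)%N)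
    (x i - sample_mean x) * (x j - sample_mean x).

Definition bartlett (x : R) : R := if `|x| < 1 then 1 - `|x| else 0.

(* `|i%:Z - j%:Z|%N is the lag |i - j| as a natural number. *)
Definition boot_cov T (x : 'I_T -> R) (l : R) : 'M[R]_T :=
  \matrix_(i < T, j < T)
    (bartlett ((i%:R - j%:R) / l) * sample_acov x `|i%:Z - j%:Z|%N).

End Statistics.

(* sup_{x >= 0} |P(|Y| <= x) - Q(|Z| <= x)| *)
Definition abs_cdf_dist d d' (S : measurableType d) (S' : measurableType d')
    (R : realType) (P : probability S R) (Y : S -> R)
    (Q : probability S' R) (Z : S' -> R) : R :=
  sup [set `|fine (P [set w | `|Y w| <= x]) - fine (Q [set w | `|Z w| <= x])|
      | x in `[0, +oo[].

(* D_T = o_p(a_T) as T tends to infinity along the filter F.  P^* is the outer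
   measure of P, which agrees with P on measurable sets: D T is not required
   to be measurable. *)
Definition little_op d (S : measurableType d) (R : realType)
    (P : probability S R) (F : set_system nat) (D : nat -> S -> R)
    (a : nat -> R) : Prop :=
  forall eps : R, 0 < eps ->
    ((P^*)%mu [set w | eps <= `|D T w / a T|]) @[T --> F] --> 0%E.

(* Main.v *)
(* T_K is a scale-invariant function of the vector of the K group sums, which is
   centred Gaussian both under P and under the bootstrap law. If the covariance
   function is r and the groups have size m, the covariance matrix of the group
   sums is  m s I + b A + (lags beyond m),  where s and b are the sums of r(h) and
   of |h| r(h), and A is a fixed tridiagonal matrix. Divided by m s it becomes
   I + (b / s) A / m, with an error O(1/m^2) for gamma_X and without error for the
   bootstrap covariances, which vanish beyond the lag l <= m. Hence the two
   normalised matrices differ by O(|b^/s^ - b/s| / m + 1/m^2), and the probability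
   of any event is a Lipschitz function of the covariance matrix near I. This is
   o_p(1/T) as soon as the estimates s^ and b^ are consistent. They are quadratic
   forms in the data, their bias being O(1/l + l^2/T) and, by Wick's formula, their
   variance O(l^3/T). *)

From mathcomp Require Import measurable_realfun.
From mathcomp Require Import ring lra zify.
Require Import Defs.
Import Order.TTheory GRing.Theory Num.Theory.
Set Implicit Arguments.
Unset Strict Implicit.
Unset Printing Implicit Defensive.
Local Open Scope classical_set_scope.
Local Open Scope ring_scope.
Import HBNNSimple.

(** * Normal laws *)

(** Normality is given only through the laws of linear forms, and the full covariance matrix of the
    bootstrap sample may be singular, so no joint density is at hand. The comparison of two Gaussian
    laws therefore peels off one coordinate at a time: its regression residual has a one-dimensional
    density, and integrating it out leaves the same problem one dimension lower, for a function with
    values in [0, 1] instead of an event. Independence of residual and regressors is an equality of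
    two laws having the same linear forms, hence the Cramer-Wold theorem. The second moment of
    [gamma] pays twice: for the O(1/m^2) error of the normalised matrix, since 1 <= h^2 / m^2 beyond
    lag m, and for the bias of the weighted lag sum, where |h| meets the relative loss |h| / l of
    the kernel. Randomness enters only through two scalar estimates; once both are within [e], the
    bound on the distance is deterministic. A large distance thus implies one of two measurable
    deviation events, which is all that the outer measure requires. *)

Lemma ge0_integral_density d (T : measurableType d) (R : realType)
    (m n : {measure set T -> \bar R}) (p : T -> R) (f : T -> \bar R) :
  measurable_fun setT p -> (forall x, 0 <= p x) ->
  (forall A, measurable A -> n A = \int[m]_(x in A) (p x)%:E)%E ->
  measurable_fun setT f -> (forall x, 0 <= f x)%E ->
  (\int[n]_x f x = \int[m]_x (f x * (p x)%:E))%E.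
Proof.
move=> mp p0 np mf f0.
pose h := nnsfun_approx measurableT mf.
have ndh x : {homo h^~ x : a b / (a <= b)%N >-> a <= b}.
  by move=> a b ab; exact/lefP/nd_nnsfun_approx.
have mh k : measurable_fun setT (EFin \o h k) by exact/measurable_EFinP.
have mpE : measurable_fun setT (EFin \o p) by exact/measurable_EFinP.
have -> : (\int[n]_x f x = limn (fun k => \int[n]_x (h k x)%:E))%E.
  rewrite -monotone_convergence//=.
  - apply: eq_integral => x _; apply/esym/cvg_lim => //.
    exact: cvg_nnsfun_approx.
  - by move=> k x _; rewrite lee_fin.
  - by move=> x _ a b ab; rewrite lee_fin ndh.
have -> : (\int[m]_x (f x * (p x)%:E) =
    limn (fun k => \int[m]_x ((h k x)%:E * (p x)%:E)))%E.
  rewrite -monotone_convergence//=.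
  - apply: eq_integral => x _; apply/esym/cvg_lim => //.
    by apply: cvgeZr => //; exact: cvg_nnsfun_approx.
  - by move=> k; apply: emeasurable_funM => //; exact: mh.
  - by move=> k x _; rewrite mule_ge0// lee_fin.
  - by move=> x _ a b ab; rewrite lee_wpmul2r ?lee_fin// ndh.
congr (limn _); apply/funext => k.
rewrite integralT_nnsfun sintegralE.
transitivity (\int[m]_x (\sum_(y \in range (h k))
    ((y * \1_(h k @^-1` [set y]) x)%:E * (p x)%:E)))%E; last first.
  apply: eq_integral => x _; rewrite (fimfunE (h k)) -fsumEFin//.
  by rewrite ge0_mule_fsuml// => y; exact: nnfun_muleindic_ge0.
rewrite ge0_integral_fsum//=.
- apply: eq_fsbigr => y yh.
  under eq_integral do rewrite EFinM -muleA.
  have mhy : measurable (h k @^-1` [set y]) by [].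
  have y0 : 0 <= y by move: yh => /set_mem[x _ <-].
  rewrite ge0_integralZl//=.
  + congr (_ * _)%E; rewrite np// integral_mkcond.
    apply: eq_integral => x _; rewrite patchE indicE.
    by case: ifPn => _; rewrite ?mul1e ?mul0e.
  + by apply: emeasurable_funM => //; exact/measurable_EFinP.
  + by move=> x _; rewrite mule_ge0// lee_fin.
- move=> y; apply: emeasurable_funM => //; apply/measurable_EFinP.
  exact: measurable_funM.
- by move=> y x _; apply: mule_ge0; [exact: nnfun_muleindic_ge0|rewrite lee_fin].
Qed.

Lemma lebesgue_measureD (R : realType) (c : R) (A : set R) : measurable A ->
  pushforward lebesgue_measure ((fun x : R => c + x) : _ -> measurableTypeR R) A =
  lebesgue_measure A.
Proof.
move=> mA; apply/esym/lebesgue_measure_unique => //=.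
  exact: measurable_funD.
move=> mc _ [[a b]] _ <-; rewrite /pushforward/=.
rewrite (_ : _ @^-1` _ = `]a - c, b - c]%classic).
  rewrite !lebesgue_measure_itv/= !lte_fin ltrD2r; case: ifP => // _.
  by rewrite -!EFinD; congr EFin; rewrite opprB addrA subrK.
by apply/seteqP; split => x /=; rewrite !in_itv/= lerBrDl ltrBlDl.
Qed.

Lemma ge0_integral_translate (R : realType) (c : R) (f : R -> \bar R) :
  measurable_fun setT f -> (forall x, 0 <= f x)%E ->
  (\int[lebesgue_measure]_x f (c + x)%R = \int[lebesgue_measure]_x f x)%E.
Proof.
move=> mf f0; pose c' : measurableTypeR R -> measurableTypeR R := fun x => c + x.
have mc : measurable_fun setT c' by exact: measurable_funD.
have := @ge0_integral_pushforward _ _ _ _ R c' mc lebesgue_measure setT f measurableT.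
move=> /(_ mf (fun x _ => f0 x)); rewrite preimage_setT /comp => <-.
by apply: eq_measure_integral => A mA _; exact: lebesgue_measureD.
Qed.

Local Notation leb := lebesgue_measure.

Definition gauss_pdf (R : realType) (m v : R) : R -> R :=
  normal_pdf m (Num.sqrt v).

Section gauss_pdf.
Context {R : realType}.
Implicit Types m v x : R.

Lemma gauss_pdfE m v x : 0 < v ->
  gauss_pdf m v x = (Num.sqrt (v * pi *+ 2))^-1 * expR (- (x - m) ^+ 2 / (v *+ 2)).
Proof.
move=> v0; rewrite /gauss_pdf normal_pdfE ?gt_eqF ?sqrtr_gt0//.
by rewrite /normal_peak /normal_fun sqr_sqrtr// ltW.
Qed.

Lemma gauss_pdf_ge0 m v x : 0 <= gauss_pdf m v x.
Proof. exact: normal_pdf_ge0. Qed.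

Lemma measurable_gauss_pdf m v : measurable_fun setT (gauss_pdf m v).
Proof. exact: measurable_normal_pdf. Qed.

Lemma integral_gauss_pdf m v : (\int[leb]_x (gauss_pdf m v x)%:E = 1)%E.
Proof. exact: integral_normal_pdf. Qed.

Lemma gauss_pdf_shift m v x c : 0 < v -> gauss_pdf (m + c) v x = gauss_pdf m v (x - c).
Proof. by move=> v0; rewrite !gauss_pdfE// opprD [- m - c]addrC addrA. Qed.

(* completing the square *)
Lemma gauss_pdf_mul v s x y : 0 < v -> 0 < s ->
  gauss_pdf 0 s (y - x) * gauss_pdf 0 v x =
  gauss_pdf 0 (v + s) y * gauss_pdf (y * v / (v + s)) (v * s / (v + s)) x.
Proof.
move=> v0 s0; have vs0 : 0 < v + s by rewrite addr_gt0.
have r0 : 0 < v * s / (v + s) by rewrite divr_gt0// mulr_gt0.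
rewrite !gauss_pdfE// mulrACA -expRD [RHS]mulrACA -expRD; congr (_ * expR _).
  rewrite -!invfM; congr (_^-1); rewrite -!sqrtrM ?mulrn_wge0 ?mulr_ge0 ?pi_ge0 ?ltW//.
  by congr Num.sqrt; field; rewrite gt_eqF.
by field; rewrite !gt_eqF.
Qed.

End gauss_pdf.

Lemma is_normal_ge0_integral d (T : measurableType d) (R : realType)
    (P : probability T R) (Y : T -> R) (m v : R) (f : R -> \bar R) :
  measurable_fun setT Y -> is_normal P Y m v -> 0 < v ->
  measurable_fun setT f -> (forall x, 0 <= f x)%E ->
  (\int[P]_w f (Y w) = \int[leb]_x (f x * (gauss_pdf m v x)%:E))%E.
Proof.
move=> mY [v0 nY] vgt0 mf f0.
pose Y' : T -> measurableTypeR R := Y.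
have mY' : measurable_fun setT Y' by exact: mY.
have := @ge0_integral_pushforward _ _ _ _ R Y' mY' P setT f measurableT.
move=> /(_ mf (fun x _ => f0 x)); rewrite preimage_setT /comp => <-.
apply: ge0_integral_density => //.
- exact: measurable_gauss_pdf.
- exact: gauss_pdf_ge0.
- by move=> A mA; apply: etrans (nY _ mA) _; rewrite /normal_law gt_eqF.
Qed.

Lemma is_normal0_integral d (T : measurableType d) (R : realType)
    (P : probability T R) (Y : T -> R) (m : R) (f : R -> \bar R) :
  measurable_fun setT Y -> is_normal P Y m 0 ->
  measurable_fun setT f -> (forall x, 0 <= f x)%E ->
  (\int[P]_w f (Y w) = f m)%E.
Proof.
move=> mY [v0 nY] mf f0.
have := @ge0_integral_pushforward _ _ _ _ R Y mY P setT f measurableT.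
move=> /(_ mf (fun x _ => f0 x)); rewrite preimage_setT /comp => <-.
rewrite (eq_measure_integral (\d_ m)).
  by rewrite integral_dirac// diracT mul1e.
by move=> A mA _; apply: etrans (nY _ mA) _; rewrite /normal_law eqxx.
Qed.

(** Independence is expressed by the product measure: sections over the first factor give the
    convolution of the two laws. The degenerate variances are treated apart because [normal_law] has
    no density there. *)
Lemma is_normalD d d' (T : measurableType d) (T' : measurableType d')
    (R : realType) (P : probability T R) (Q : probability T' R)
    (V : T -> R) (W : T' -> R) (v s : R) :
  measurable_fun setT V -> measurable_fun setT W ->
  is_normal P V 0 v -> is_normal Q W 0 s ->
  is_normal (P \x Q)%E (fun z => V z.1 + W z.2) 0 (v + s).
Proof.
move=> mV mW nV nW; have [v0 lV] := nV; have [s0 lW] := nW.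
split; first exact: addr_ge0.
move=> A mA.
pose g x := Q (W @^-1` [set t | A (x + t)]).
have mAx x : measurable [set t | A (x + t)].
  have mx : measurable_fun setT (fun t : R => x + t) by exact: measurable_funD.
  by have := mx measurableT _ mA; rewrite setTI.
have mg : measurable_fun setT g.
  have mh : measurable_fun setT (fun z : R * T' => z.1 + W z.2).
    by apply: measurable_funD => //; exact: measurableT_comp.
  have mB : measurable [set z : R * T' | A (z.1 + W z.2)].
    by have := mh measurableT _ mA; rewrite setTI.
  rewrite (_ : g = Q \o xsection [set z : R * T' | A (z.1 + W z.2)]).
    exact: measurable_fun_xsection.
  apply/funext => x; rewrite /g /=; congr (Q _).
  by apply/seteqP; split => t /=; rewrite /xsection/= inE.
transitivity (\int[P]_w g (V w))%E.
  apply: eq_integral => w _; rewrite /= /g; congr (Q _).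
  by apply/seteqP; split => t /=; rewrite /xsection/= inE.
have gE x : g x = normal_law 0 s [set t | A (x + t)] by rewrite /g lW.
have [v0'|v_neq0] := eqVneq v 0.
  rewrite v0' in nV *; rewrite add0r (is_normal0_integral mV nV mg)// gE.
  by congr (normal_law _ _ _); apply/seteqP; split => t /=; rewrite add0r.
have vgt0 : 0 < v by rewrite lt_neqAle eq_sym v_neq0.
have [s0'|s_neq0] := eqVneq s 0.
  rewrite s0' addr0 -lV//.
  have mVA : measurable (V @^-1` A) by rewrite -[X in measurable X]setTI; exact: mV.
  rewrite -[V @^-1` A]setIT -integral_indic//.
  apply: eq_integral => w _; rewrite gE s0' /normal_law eqxx diracE indicE.
  congr ((nat_of_bool _)%:R%:E); apply/idP/idP; rewrite !inE/= addr0 //.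
have sgt0 : 0 < s by rewrite lt_neqAle eq_sym s_neq0.
have mpdf := @measurable_gauss_pdf R.
have pdf0 := @gauss_pdf_ge0 R.
have mAE : measurable_fun setT (fun y : R => (\1_A y : R)%:E) by exact/measurable_EFinP.
transitivity (\int[leb]_x \int[leb]_y
    ((\1_A y : R)%:E * (gauss_pdf 0 s (y - x) * gauss_pdf 0 v x)%:E))%E.
  rewrite (is_normal_ge0_integral mV nV vgt0 mg)//.
  apply: eq_integral => x _.
  rewrite gE /normal_law (negbTE s_neq0) /normal_prob integral_mkcond.
  have mp : measurable_fun setT (fun y : R => (gauss_pdf 0 s (y - x))%:E).
    apply/measurable_EFinP; apply: measurableT_comp => //.
    by apply: measurable_funB.
  rewrite -[X in (X * _)%E = _](_ : \int[leb]_y ((\1_A y : R)%:E * (gauss_pdf 0 s (y - x))%:E) = _)%E.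
    under [RHS]eq_integral do rewrite EFinM muleA.
    rewrite ge0_integralZr// ?lee_fin//.
    - exact: emeasurable_funM.
    - by move=> y _; rewrite mule_ge0 ?lee_fin.
  rewrite -(ge0_integral_translate x).
  - apply: eq_integral => y _; rewrite /= patchE addrAC subrr add0r indicE.
    have -> : (x + y \in A) = (y \in [set t | A (x + t)]).
      by apply/idP/idP; rewrite !inE.
    by case: ifPn => _; rewrite ?mul1e ?mul0e.
  - exact: emeasurable_funM.
  - by move=> y; rewrite mule_ge0 ?lee_fin.
(* Tonelli puts the integral in x inside, where completing the square leaves a normal density in x,
   of total mass 1. *)
transitivity (\int[leb]_y \int[leb]_x
    ((\1_A y : R)%:E * (gauss_pdf 0 s (y - x) * gauss_pdf 0 v x)%:E))%E.
  apply: (@fubini_tonelli _ _ (measurableTypeR R) (measurableTypeR R) R leb leb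
    (fun z => (\1_A z.2 : R)%:E * (gauss_pdf 0 s (z.2 - z.1) * gauss_pdf 0 v z.1)%:E)%E).
  - apply: emeasurable_funM.
      by apply/measurable_EFinP; apply: measurableT_comp => //; exact: measurable_snd.
    apply/measurable_EFinP; apply: measurable_funM; last first.
      by apply: (measurableT_comp (mpdf 0 v)); exact: measurable_fst.
    apply: (measurableT_comp (mpdf 0 s)).
    by apply: measurable_funB; [exact: measurable_snd|exact: measurable_fst].
  - by move=> z; apply: mule_ge0; rewrite ?lee_fin ?mulr_ge0.
rewrite /normal_law gt_eqF ?addr_gt0// /normal_prob [RHS]integral_mkcond.
apply: eq_integral => y _.
under eq_integral do rewrite gauss_pdf_mul// EFinM muleA.
rewrite ge0_integralZl//.
- rewrite integral_gauss_pdf mule1 patchE indicE.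
  by case: ifPn => _; rewrite ?mul1e ?mul0e.
- by apply/measurable_EFinP; exact: mpdf.
- by move=> x _; rewrite lee_fin.
- by rewrite mule_ge0 ?lee_fin.
Qed.

Lemma cvgr0_le (R : realType) (u w : nat -> R) :
  (forall n, `|u n| <= w n) -> w n @[n --> \oo] --> 0 -> u n @[n --> \oo] --> 0.
Proof.
move=> uw w0; apply/norm_cvg0P.
apply: (squeeze_cvgr _ (cvg_cst _) w0).
by apply: nearW => n; rewrite normr_ge0 uw.
Qed.

(** The fundamental theorem of calculus on [-(n+1), n+1] leaves boundary values of size M / (n+1),
    while dominated convergence gives the integral over the line. This replaces integration by parts
    in the moment identities. *)
Lemma integral_derive_eq0 (R : realType) (F f : R -> R) (M : R) :
  (forall x : R, is_derive x 1 F (f x)) -> continuous f ->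
  leb.-integrable setT (EFin \o f) ->
  (forall a : R, 1 <= `|a| -> `|F a| <= M / `|a|) ->
  (\int[leb]_x (f x)%:E = 0)%E.
Proof.
move=> iF cf intf bM; pose a (n : nat) : R := n.+1%:R.
have dF x : derivable F x 1 by have [] := iF x.
have cF : continuous F.
  by move=> x; exact/differentiable_continuous/derivable1_diffP/dF.
have FTC n : (\int[leb]_(x in `[(- a n)%R, (a n)%R]) (f x)%:E =
    (F (a n) - F (- a n))%:E)%E.
  rewrite EFinB; apply: continuous_FTC2.
  - by have : 0 < a n by [rewrite ltr0Sn]; lra.
  - exact/continuous_subspaceT.
  - split=> [x _|//|]; first exact: dF.
    by apply: cvg_at_right_filter; exact: cF.
    by apply: cvg_at_left_filter; exact: cF.
  - move=> x _; rewrite derive1E; have dS := iF x.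
    by rewrite derive_val.
have cv1 : (\int[leb]_(x in `[(- a n)%R, (a n)%R]) (f x)%:E)%E @[n --> \oo] -->
    (\int[leb]_x (f x)%:E)%E.
  under eq_fun do rewrite integral_mkcond.
  apply: (@dominated_cvg _ (measurableTypeR R) R leb setT measurableT _ _
    (fun x => `|(f x)%:E|%E)) => //.
  - move=> n; apply/(measurable_restrictT _ _).1 => //.
    apply: measurable_funTS; apply/measurable_EFinP.
    exact: continuous_measurable_fun cf.
  - move=> x _; apply: cvg_near_cst; near=> n.
    rewrite /= patchE mem_set//= in_itv/= -ler_norml.
    rewrite (@le_trans _ _ n%:R)//; last by rewrite ler_nat.
    by near: n; exact: nbhs_infty_ger.
  - exact/integrable_abse.
  - move=> n x _; rewrite patchE; case: ifPn => // _.
    by rewrite abse0.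
have cv0 : (\int[leb]_(x in `[(- a n)%R, (a n)%R]) (f x)%:E)%E @[n --> \oo] --> 0%E.
  under eq_fun do rewrite FTC.
  apply: cvg_EFin; first exact: nearW.
  rewrite -[X in _ --> X](subr0 (0 : R)).
  have cM : M / a n @[n --> \oo] --> (0 : R).
    by rewrite -(mulr0 M); apply: cvgM; [exact: cvg_cst|exact: cvg_harmonic].
  have na n : `|a n| = a n by rewrite ger0_norm ?ler0n.
  by apply: cvgB; apply: cvgr0_le cM => n; rewrite (le_trans (bM _ _))// ?normrN na// ler1n.
exact: (cvg_unique _ cv1 cv0).
Unshelve. all: by end_near. Qed.

(** * Moments of the normal density up to order four *)

Section gauss_moments.
Context {R : realType}.
Variable v : R.
Hypothesis v0 : 0 < v.

Lemma is_derive_gauss_pdf (x : R) :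
  is_derive x 1 (gauss_pdf 0 v) (- x / v * gauss_pdf 0 v x).
Proof.
rewrite (_ : gauss_pdf 0 v = fun x => (Num.sqrt (v * pi *+ 2))^-1 *
    expR (- (2 * v)^-1 * x ^+ 2)); last first.
  apply/funext => y; rewrite gauss_pdfE// subr0; congr (_ * expR _).
  by field; rewrite gt_eqF.
apply: is_derive_eq.
rewrite /GRing.scale/=; set c := (Num.sqrt _)^-1.
by field; rewrite gt_eqF.
Qed.

(** With y = x^2 / (4 v), x^4 = 16 v^2 y^2 and y^2 <= 4 exp(y): half of the Gaussian decay absorbs
    the power, the other half is the decay for variance 2 v, and the square root of 2 is the ratio
    of the peaks. This one bound supplies integrability up to order 4 and decay at the boundary. *)
Lemma expr4_gauss_pdf (x : R) : 
  x ^+ 4 * gauss_pdf 0 v x <= 64 * v ^+ 2 * Num.sqrt 2 * gauss_pdf 0 (2 * v) x.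
Proof.
rewrite !gauss_pdfE ?mulr_gt0// !subr0.
pose y : R := x ^+ 2 / (4 * v).
have y0 : 0 <= y by rewrite divr_ge0 ?sqr_ge0// mulr_ge0// ltW.
have ey : y ^+ 2 <= 4 * expR y.
  have : 1 + y / 2 <= expR (y / 2) by exact: expR_ge1Dx.
  have -> : expR y = expR (y / 2) ^+ 2 by rewrite -expRM_natl; congr expR; field.
  by nra.
rewrite (_ : x ^+ 4 = 16 * v ^+ 2 * y ^+ 2); last by rewrite /y; field; rewrite gt_eqF.
rewrite (_ : - x ^+ 2 / (v *+ 2) = - y - y); last by rewrite /y; field; rewrite gt_eqF.
rewrite (_ : - x ^+ 2 / (2 * v *+ 2) = - y); last by rewrite /y; field; rewrite gt_eqF.
rewrite expRD (_ : 2 * v * pi *+ 2 = 2 * (v * pi *+ 2)); last by ring.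
rewrite sqrtrM// invfM.
set s := Num.sqrt (_ *+ 2); set t := Num.sqrt 2.
have t0 : t != 0 by rewrite gt_eqF// sqrtr_gt0.
have s0 : 0 <= s^-1 by rewrite invr_ge0 sqrtr_ge0.
have -> : 64 * v ^+ 2 * t * (t^-1 / s * expR (- y)) = 64 * v ^+ 2 * s^-1 * expR (-y).
  by field; rewrite t0 /=; rewrite /s gt_eqF// sqrtr_gt0 mulrn_wgt0// mulr_gt0// pi_gt0.
have -> : 16 * v ^+ 2 * y ^+ 2 * (s^-1 * (expR (- y) * expR (- y))) =
  16 * v ^+ 2 * s^-1 * expR (- y) * (y ^+ 2 * expR (- y)) by ring.
have -> : 64 * v ^+ 2 / s * expR (- y) = 16 * v ^+ 2 * s^-1 * expR (- y) * 4 by ring.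
have v_ge0 := ltW v0; rewrite ler_wpM2l ?mulr_ge0 ?expR_ge0 ?sqr_ge0//.
by rewrite expRN ler_pdivrMr ?expR_gt0.
Qed.

Lemma integrable_gauss_pdf m w : leb.-integrable setT (EFin \o @gauss_pdf R m w).
Proof. exact: integrable_normal_pdf. Qed.

Lemma integrable_expr_gauss_pdf (k : nat) : (k <= 4)%N ->
  leb.-integrable setT (fun x : R => (x ^+ k * gauss_pdf 0 v x)%:E).
Proof.
move=> k4; pose C : R := 64 * v ^+ 2 * Num.sqrt 2.
have C0 : 0 <= C by rewrite !mulr_ge0 ?(ltW v0) ?sqr_ge0 ?sqrtr_ge0 ?ler0n.
apply: (@le_integrable _ (measurableTypeR R) R leb _ measurableT _
   (fun x : R => (gauss_pdf 0 v x + C * gauss_pdf 0 (2 * v) x)%:E)).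
- apply/measurable_EFinP; apply: measurable_funM; last exact: measurable_gauss_pdf.
  exact: measurable_funX.
- move=> x _; rewrite lee_fin; set p := gauss_pdf 0 v x.
  have p0 : 0 <= p by exact: gauss_pdf_ge0.
  rewrite [leRHS]ger0_norm ?addr_ge0 ?(mulr_ge0 C0) ?gauss_pdf_ge0//.
  apply: le_trans (lerD (lexx _) (expr4_gauss_pdf x)); rewrite -/p.
  rewrite -[X in X + _]mul1r -mulrDl normrM (ger0_norm p0) ler_wpM2r// normrX.
  have [x1|x1] := leP `|x| 1.
    by rewrite (le_trans (exprn_ile1 _ (normr_ge0 _) x1))// lerDl exprn_even_ge0.
  rewrite (le_trans (ler_weXn2l (ltW x1) k4))// -normrX ger0_norm ?exprn_even_ge0//.
  by rewrite lerDr.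
- rewrite [X in integrable _ _ X](_ : _ =
      ((EFin \o @gauss_pdf R 0 v) \+ (fun x => C%:E * (EFin \o @gauss_pdf R 0 (2 * v)) x))%E)//.
  apply: integrableD => //; first exact: integrable_gauss_pdf.
  by apply: integrableZl => //; exact: integrable_gauss_pdf.
Qed.

(* derivative of [x^(k+1) phi(x)], so that its integral vanishes and relates the
   moments of order [k] and [k + 2] *)
Let stein_fun (k : nat) (x : R) :=
  (k.+1%:R * x ^+ k - x ^+ k.+2 / v) * gauss_pdf 0 v x.

Lemma is_derive_stein (k : nat) (x : R) :
  is_derive x 1 (fun x => x ^+ k.+1 * gauss_pdf 0 v x) (stein_fun k x).
Proof.
have dp := is_derive_gauss_pdf x.
have dX := @is_deriveX _ _ (@id R) k.+1 x 1 1 (is_derive_id x 1).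
rewrite (_ : (fun x => _) = (@id R) ^+ k.+1 * gauss_pdf 0 v); last first.
  by apply/funext => y; rewrite !fctE.
apply: (is_derive_eq (is_deriveM dX dp)).
rewrite /stein_fun /GRing.scale/= mulr1 exprfctE.
by rewrite !exprS -mulr_natl; field; rewrite gt_eqF.
Qed.

Lemma continuous_stein (k : nat) : continuous (stein_fun k).
Proof.
move=> x; apply: cvgM.
  apply: cvgB; first by apply: cvgM; [exact: cvg_cst|exact: exprn_continuous].
  by apply: cvgM; [exact: exprn_continuous|exact: cvg_cst].
by apply: continuous_normal_pdf; rewrite gt_eqF// sqrtr_gt0.
Qed.

Lemma integrable_stein (k : nat) : (k <= 2)%N ->
  leb.-integrable setT (EFin \o stein_fun k).
Proof.
move=> k2.
rewrite [X in integrable _ _ X](_ : _ =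
  (fun x : R => k.+1%:R%:E * (x ^+ k * gauss_pdf 0 v x)%:E) \-
  (fun x : R => (v^-1)%:E * (x ^+ k.+2 * gauss_pdf 0 v x)%:E))%E; last first.
  apply/funext => x /=; rewrite -!EFinM -EFinB; congr EFin.
  by rewrite /stein_fun; ring.
apply: integrableB => //; apply: integrableZl => //.
- by apply: integrable_expr_gauss_pdf; rewrite (leq_trans k2).
- by apply: integrable_expr_gauss_pdf; rewrite !ltnS.
Qed.

Lemma stein_boundary (k : nat) : (k <= 2)%N ->
  exists M : R, forall a : R, 1 <= `|a| -> `|a ^+ k.+1 * gauss_pdf 0 v a| <= M / `|a|.
Proof.
move=> k2; exists (64 * v ^+ 2 * Num.sqrt 2 * normal_peak (Num.sqrt (2 * v))).
move=> a a1; have a0 : 0 < `|a| by rewrite (lt_le_trans _ a1).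
rewrite ler_pdivlMr// normrM (ger0_norm (gauss_pdf_ge0 _ _ _)) mulrAC normrX -exprSr.
apply: (@le_trans _ _ (a ^+ 4 * gauss_pdf 0 v a)).
  rewrite ler_wpM2r ?gauss_pdf_ge0//.
  by rewrite (le_trans (ler_weXn2l a1 (k2 : (k.+2 <= 4)%N)))// -normrX ger0_norm ?exprn_even_ge0.
apply: le_trans (expr4_gauss_pdf a) _.
rewrite ler_wpM2l//; first by rewrite !mulr_ge0 ?(ltW v0) ?sqr_ge0 ?sqrtr_ge0 ?ler0n.
by apply: normal_pdf_ub; rewrite gt_eqF// sqrtr_gt0 mulr_gt0.
Qed.

Lemma integral_stein (k : nat) : (k <= 2)%N ->
  (\int[leb]_x (stein_fun k x)%:E = 0)%E.
Proof.
move=> k2; have [M bM] := stein_boundary k2.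
exact: (integral_derive_eq0 (is_derive_stein k) (@continuous_stein k)
  (integrable_stein k2) bM).
Qed.

(** [stein_fun] begins with the derivative of x phi(x), so the first moment comes from phi itself,
    whose derivative is - x phi(x) / v. The boundary bound for x phi(x) also covers phi, since it
    concerns |x| >= 1. *)
Lemma integral_gauss_pdf_mean : (\int[leb]_x (x * gauss_pdf 0 v x)%:E = 0)%E.
Proof.
have i1 := integrable_expr_gauss_pdf (isT : 1 <= 4)%N.
have e : (\int[leb]_x (- x / v * gauss_pdf 0 v x)%:E = 0)%E.
  have [M bM] := stein_boundary (isT : 0 <= 2)%N.
  apply: (@integral_derive_eq0 _ (gauss_pdf 0 v) _ M is_derive_gauss_pdf).
  - move=> x; apply: cvgM; first by apply: cvgM; [exact: cvgN|exact: cvg_cst].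
    by apply: continuous_normal_pdf; rewrite gt_eqF// sqrtr_gt0.
  - rewrite [X in integrable _ _ X](_ : _ =
      (fun x : R => (- v^-1)%:E * (x ^+ 1 * gauss_pdf 0 v x)%:E))%E; last first.
      by apply/funext => x /=; rewrite -EFinM; congr EFin; ring.
    exact: integrableZl.
  - move=> a a1; apply: le_trans (bM a a1).
    by rewrite expr1 normrM ler_peMl.
have : (\int[leb]_x ((- v^-1)%:E * (x ^+ 1 * gauss_pdf 0 v x)%:E) = 0)%E.
  by rewrite -[RHS]e; apply: eq_integral => x _; rewrite -EFinM; congr EFin; ring.
rewrite integralZl// -(fineK (integrable_fin_num measurableT i1)) -EFinM => -[] /eqP.
rewrite mulf_eq0 oppr_eq0 invr_eq0 gt_eqF//= => /eqP e0.
by rewrite e0.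
Qed.

Lemma integral_gauss_pdf_expr (k : nat) : (k <= 2)%N ->
  (\int[leb]_x (x ^+ k.+2 * gauss_pdf 0 v x)%:E =
   (v * k.+1%:R)%:E * \int[leb]_x (x ^+ k * gauss_pdf 0 v x)%:E)%E.
Proof.
move=> k2.
have i1 := integrable_expr_gauss_pdf (leq_trans k2 (isT : 2 <= 4)%N).
have i2 := integrable_expr_gauss_pdf (k2 : (k.+2 <= 4)%N).
have : (\int[leb]_x (k.+1%:R%:E * (x ^+ k * gauss_pdf 0 v x)%:E -
    (v^-1)%:E * (x ^+ k.+2 * gauss_pdf 0 v x)%:E) = 0)%E.
  rewrite -(integral_stein k2); apply: eq_integral => x _ /=.
  by rewrite -!EFinM -EFinB; congr EFin; rewrite /stein_fun; ring.
rewrite integralB//; [|exact: integrableZl|exact: integrableZl].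
rewrite !integralZl//.
rewrite -(fineK (integrable_fin_num measurableT i1)).
rewrite -(fineK (integrable_fin_num measurableT i2)).
rewrite -!EFinM -EFinB => -[] /eqP; rewrite subr_eq0 => /eqP e.
by congr EFin; rewrite -mulrA e mulrA divff ?mul1r// gt_eqF.
Qed.

End gauss_moments.

Section is_normal_moments.
Context d (T : measurableType d) (R : realType) (P : probability T R).
Variables (Y : T -> R) (v : R).
Hypotheses (mY : measurable_fun setT Y) (nY : is_normal P Y 0 v).

Lemma is_normal_integrable (k : nat) : (k <= 4)%N ->
  P.-integrable setT (fun w => (Y w ^+ k)%:E).
Proof.
move=> k4; apply/integrableP; split.
  by apply/measurable_EFinP; exact: measurable_funX.
have mf : measurable_fun setT (fun x : R => `|(x ^+ k)%:E|%E).
  apply: measurableT_comp => //; apply/measurable_EFinP.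
  exact: measurable_funX.
have [v0 _] := nY.
have [v0'|v_neq0] := eqVneq v 0.
  have nY0 : is_normal P Y 0 0 by have := nY; rewrite v0'.
  rewrite (is_normal0_integral (f := fun x => `|(x ^+ k)%:E|%E) mY nY0)//.
  exact: ltry.
have vgt0 : 0 < v by rewrite lt_neqAle eq_sym v_neq0.
rewrite (is_normal_ge0_integral (f := fun x => `|(x ^+ k)%:E|%E) mY nY)//.
have /integrableP[_] := integrable_expr_gauss_pdf vgt0 k4.
apply: le_lt_trans; rewrite le_eqVlt; apply/orP; left; apply/eqP.
apply: eq_integral => x _; rewrite EFinM abseM; congr (_ * _)%E.
by rewrite /= ger0_norm// gauss_pdf_ge0.
Qed.

Let moment (k : nat) : 0 < v -> ~~ odd k ->
  (\int[P]_w (Y w ^+ k)%:E = \int[leb]_x (x ^+ k * gauss_pdf 0 v x)%:E)%E.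
Proof.
move=> v0 k2; rewrite (is_normal_ge0_integral (f := fun x => (x ^+ k)%:E) mY nY)//.
- by apply/measurable_EFinP; exact: measurable_funX.
- by move=> x; rewrite lee_fin exprn_even_ge0.
Qed.

Let moment0 (k : nat) : v = 0 -> ~~ odd k -> (0 < k)%N -> (\int[P]_w (Y w ^+ k)%:E = 0)%E.
Proof.
move=> v0 k2 k0; have nY0 : is_normal P Y 0 0 by have := nY; rewrite v0.
rewrite (is_normal0_integral (f := fun x => (x ^+ k)%:E) mY nY0)//.
- by rewrite expr0n eqn0Ngt k0.
- by apply/measurable_EFinP; exact: measurable_funX.
- by move=> x; rewrite lee_fin exprn_even_ge0.
Qed.

Lemma is_normal_mean : \int[P]_w Y w = 0.
Proof.
have [v0 _] := nY; rewrite /Rintegral integralE.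
have mpos : measurable_fun setT ((fun x : R => x%:E)^\+)%E.
  by apply: measurable_funepos; exact/measurable_EFinP.
have mneg : measurable_fun setT ((fun x : R => x%:E)^\-)%E.
  by apply: measurable_funeneg; exact/measurable_EFinP.
(* The transfer to the density holds for nonnegative functions, hence the split into positive and
   negative parts. *)
rewrite (funepos_comp (fun x : R => x%:E) Y) (funeneg_comp (fun x : R => x%:E) Y).
have [v0'|v_neq0] := eqVneq v 0.
  have nY0 : is_normal P Y 0 0 by have := nY; rewrite v0'.
  rewrite (is_normal0_integral mY nY0 mpos)// (is_normal0_integral mY nY0 mneg)//.
  by rewrite funeposE funenegE oppe0 maxxx subee.
have vgt0 : 0 < v by rewrite lt_neqAle eq_sym v_neq0.
rewrite (is_normal_ge0_integral mY nY vgt0 mpos)// (is_normal_ge0_integral mY nY vgt0 mneg)//.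
rewrite -[RHS]/(fine 0%E) -(integral_gauss_pdf_mean vgt0) [in RHS]integralE; congr (fine (_ - _)%E).
- apply: eq_integral => x _; rewrite !funeposE.
  have p0 := gauss_pdf_ge0 0 v x; rewrite -!EFin_max -EFinM; congr EFin.
  by rewrite maxr_pMl// mul0r.
- apply: eq_integral => x _; rewrite !funenegE -!EFinN.
  have p0 := gauss_pdf_ge0 0 v x; rewrite -!EFin_max -EFinM; congr EFin.
  by rewrite maxr_pMl// mul0r mulNr.
Qed.

Lemma is_normal_moment2 : \int[P]_w (Y w ^+ 2) = v.
Proof.
have [v0 _] := nY; rewrite /Rintegral.
have [v0'|v_neq0] := eqVneq v 0; first by rewrite moment0.
have vgt0 : 0 < v by rewrite lt_neqAle eq_sym v_neq0.
rewrite moment// (integral_gauss_pdf_expr vgt0 (isT : 0 <= 2)%N).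
under eq_integral do rewrite expr0 mul1r.
by rewrite integral_gauss_pdf mule1 /= mulr1.
Qed.

Lemma is_normal_moment4 : \int[P]_w (Y w ^+ 4) = 3 * v ^+ 2.
Proof.
have [v0 _] := nY; rewrite /Rintegral.
have [v0'|v_neq0] := eqVneq v 0; first by rewrite moment0// v0' expr0n mulr0.
have vgt0 : 0 < v by rewrite lt_neqAle eq_sym v_neq0.
rewrite moment// (integral_gauss_pdf_expr vgt0 (isT : 2 <= 2)%N).
rewrite (integral_gauss_pdf_expr vgt0 (isT : 0 <= 2)%N).
under eq_integral do rewrite expr0 mul1r.
by rewrite integral_gauss_pdf mule1 /=; ring.
Qed.

End is_normal_moments.

(** * Total variation distance of normal laws *)

Section gauss_pdf_lipschitz.
Context {R : realType}.
Implicit Types (m v x : R).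

(** The sum of the two exponentials, rather than their maximum, lets each error term be integrated
    against its own normal density. *)
Lemma expRN_lipschitz (a b : R) :
  `|expR (- a) - expR (- b)| <= `|a - b| * (expR (- a) + expR (- b)).
Proof.
wlog ab : a b / a <= b.
  move=> H; have [/H//|/ltW/H] := leP a b.
  by rewrite distrC [`|b - a|]distrC [X in _ * X]addrC.
rewrite ger0_norm ?subr_ge0 ?ler_expR ?lerN2// ler0_norm ?subr_le0// opprB.
rewrite mulrDr; apply: (@le_trans _ _ ((b - a) * expR (- a))); last first.
  by rewrite lerDl mulr_ge0 ?expR_ge0 ?subr_ge0.
have -> : expR (- b) = expR (- a) * expR (a - b) by rewrite -expRD; congr expR; ring.
have := expR_ge1Dx (a - b); have := expR_gt0 (- a); nra.
Qed.

Lemma ln_lipschitz (v1 v2 : R) : 2^-1 <= v1 -> 2^-1 <= v2 ->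
  `|ln v1 - ln v2| <= 2 * `|v1 - v2|.
Proof.
wlog v12 : v1 v2 / v1 <= v2.
  move=> H; have [/H//|/ltW/H] := leP v1 v2.
  by rewrite distrC [`|v2 - v1|]distrC; auto.
move=> h1 h2; have [p1 p2] : 0 < v1 /\ 0 < v2 by split; lra.
rewrite ler0_norm ?subr_le0 ?ler_ln ?posrE// ler0_norm ?subr_le0// !opprB.
rewrite -ln_div ?posrE// (_ : v2 / v1 = 1 + (v2 - v1) / v1); last first.
  by field; rewrite gt_eqF.
rewrite (le_trans (le_ln1Dx _))//.
  by rewrite (@lt_le_trans _ _ 0)// ?ltrN10// divr_ge0 ?subr_ge0// ltW.
rewrite mulrC ler_wpM2r ?subr_ge0//.
by rewrite -[leRHS]invrK lef_pV2 ?posrE// invr_gt0.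
Qed.

(** Moving the variance part of the normalising factor into the exponent reduces the dependence on
    mean and variance to a Lipschitz bound for a single exponent. *)
Lemma gauss_pdf_expR m v x : 0 < v -> gauss_pdf m v x =
  (Num.sqrt (pi *+ 2))^-1 * expR (- ((x - m) ^+ 2 / (2 * v) + ln v / 2)).
Proof.
move=> v0; rewrite gauss_pdfE// opprD expRD.
rewrite (_ : v * pi *+ 2 = v * (pi *+ 2)); last by ring.
have hs : Num.sqrt v = expR (ln v / 2).
  have e2 : expR (ln v / 2) ^+ 2 = v.
    by rewrite -expRM_natl (_ : 2%:R * _ = ln v) ?lnK ?posrE//; field.
  by rewrite -[in LHS]e2 sqrtr_sqr ger0_norm ?expR_ge0.
rewrite sqrtrM ?ltW// hs invfM -expRN.
rewrite (_ : - (x - m) ^+ 2 / (v *+ 2) = - ((x - m) ^+ 2 / (2 * v))); first by ring.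
by field; rewrite gt_eqF.
Qed.

Lemma gauss_exponent_lipschitz m1 m2 v1 v2 x :
  2^-1 <= v1 <= 2 -> 2^-1 <= v2 <= 2 ->
  `|((x - m1) ^+ 2 / (2 * v1) + ln v1 / 2) - ((x - m2) ^+ 2 / (2 * v2) + ln v2 / 2)|
  <= (`|v1 - v2| + `|m1 - m2|) * (2 + `|m1 - m2| + 3 * (x - m1) ^+ 2).
Proof.
move=> /andP[v1l v1u] /andP[v2l v2u].
have [p1 p2] : 0 < v1 /\ 0 < v2 by split; lra.
have -> : ((x - m1) ^+ 2 / (2 * v1) + ln v1 / 2) - ((x - m2) ^+ 2 / (2 * v2) + ln v2 / 2) =
  - (v1 - v2) * ((x - m1) ^+ 2 / (2 * v1 * v2)) +
  (2 * v2)^-1 * ((m1 - m2) * (- (2 * (x - m1)) - (m1 - m2))) + (ln v1 - ln v2) / 2.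
  by field; rewrite !gt_eqF.
have l12 := ln_lipschitz v1l v2l.
set t := x - m1; set D := m1 - m2; set V := v1 - v2 in l12 *.
set L := ln v1 - ln v2 in l12 *.
have i1 : 0 <= (2 * v1 * v2)^-1 <= 2.
  rewrite invr_ge0 !mulr_ge0 ?ler0n ?(ltW p1) ?(ltW p2)//=.
  by rewrite -[leRHS]invrK lef_pV2 ?posrE ?invr_gt0 ?mulr_gt0//; nra.
have i2 : 0 <= (2 * v2)^-1 <= 1.
  rewrite invr_ge0 !mulr_ge0 ?ler0n ?(ltW p1) ?(ltW p2)//=.
  by rewrite -[leRHS]invrK lef_pV2 ?posrE ?invr_gt0 ?mulr_gt0// invr1; nra.
rewrite (le_trans (ler_normD _ _))// (le_trans (lerD (ler_normD _ _) (lexx _)))//.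
rewrite !normrM normrN [`|_^-1|]ger0_norm; last by case/andP: i1.
have -> : t ^+ 2 = `|t| * `|t| by rewrite -expr2 real_normK ?num_real.
have E : `|- (2 * t) - D| <= 2 * `|t| + `|D|.
  by rewrite (le_trans (ler_normB _ _))// normrN normrM ger0_norm.
have -> : `|(2 * v2)^-1| = (2 * v2)^-1 by rewrite ger0_norm//; case/andP: i2.
have -> : `|2^-1 : R| = 2^-1 by rewrite ger0_norm// invr_ge0.
have gen (a b c l e q1 q2 : R) : 0 <= a -> 0 <= b -> 0 <= c -> 0 <= e ->
    0 <= q1 <= 2 -> 0 <= q2 <= 1 -> l <= 2 * a -> e <= 2 * c + b ->
    a * (c * c * q1) + q2 * (b * e) + l / 2 <= (a + b) * (2 + b + 3 * (c * c)).
  move=> a0 b0 c0 e0 /andP[q10 q11] /andP[q20 q21] la ele.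
  have h1 : a * (c * c * q1) <= a * (c * c * 2) by rewrite !ler_wpM2l ?mulr_ge0.
  have h2 : q2 * (b * e) <= b * (2 * c + b).
    by rewrite -[leRHS]mul1r ler_pM ?mulr_ge0 ?ler_wpM2l.
  have h3 : b * (2 * c) <= b * (1 + c * c).
    by rewrite ler_wpM2l//; have := sqr_ge0 (c - 1); rewrite expr2; lra.
  have h4 : 0 <= a * b by rewrite mulr_ge0.
  have h5 : 0 <= a * (c * c) by rewrite !mulr_ge0.
  have h6 : 0 <= b * (c * c) by rewrite !mulr_ge0.
  by lra.
exact: gen.
Qed.

Lemma gauss_pdf_lipschitz m1 m2 v1 v2 x :
  2^-1 <= v1 <= 2 -> 2^-1 <= v2 <= 2 ->
  `|gauss_pdf m1 v1 x - gauss_pdf m2 v2 x| <=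
  (`|v1 - v2| + `|m1 - m2|) * ((2 + `|m1 - m2| + 3 * (x - m1) ^+ 2) * gauss_pdf m1 v1 x
    + (2 + `|m1 - m2| + 3 * (x - m2) ^+ 2) * gauss_pdf m2 v2 x).
Proof.
move=> h1 h2; have [/andP[l1 _] /andP[l2 _]] := (h1, h2).
have [p1 p2] : 0 < v1 /\ 0 < v2 by split; lra.
have e1 := gauss_exponent_lipschitz m1 m2 x h1 h2.
have e2 := gauss_exponent_lipschitz m2 m1 x h2 h1.
rewrite distrC [`|m2 - m1|]distrC [`|v2 - v1|]distrC in e2.
rewrite !gauss_pdf_expR// -mulrBr normrM.
set c := (Num.sqrt _)^-1; have c0 : 0 <= c by rewrite invr_ge0 sqrtr_ge0.
rewrite (ger0_norm c0).
apply: le_trans (ler_wpM2l c0 (expRN_lipschitz _ _)) _.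
move: e1 e2; set A := (X in `|X - _|); set B := (X in `|_ - X|).
have := expR_gt0 (- A); have := expR_gt0 (- B).
move: (expR (- A)) (expR (- B)) => a b b0 a0 e1 e2.
have gen (p q r : R) : p <= q * r -> 0 <= b -> c * (p * b) <= q * (r * (c * b)).
  move=> pq ?; rewrite (_ : q * _ = c * (q * r * b)); last by ring.
  by rewrite ler_wpM2l// ler_wpM2r.
have gen' (p q r : R) : p <= q * r -> 0 <= a -> c * (p * a) <= q * (r * (c * a)).
  move=> pq ?; rewrite (_ : q * _ = c * (q * r * a)); last by ring.
  by rewrite ler_wpM2l// ler_wpM2r.
by rewrite mulrDr [c * (_ + _)]mulrDr [leRHS]mulrDr; apply: lerD; [apply: gen' => //; exact: ltW|apply: gen => //; exact: ltW].
Qed.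

Lemma integrable_sqr_gauss_pdf m v : 0 < v ->
  leb.-integrable setT (fun x : R => ((x - m) ^+ 2 * gauss_pdf m v x)%:E) /\
  (\int[leb]_x ((x - m) ^+ 2 * gauss_pdf m v x)%:E = v%:E)%E.
Proof.
move=> v0.
have mf : measurable_fun setT (fun x : R => ((x - m) ^+ 2 * gauss_pdf m v x)%:E).
  apply/measurable_EFinP; apply: measurable_funM; last exact: measurable_gauss_pdf.
  by apply: measurable_funX; exact: measurable_funB.
have f0 x : (0 <= ((x - m) ^+ 2 * gauss_pdf m v x)%:E)%E.
  by rewrite lee_fin mulr_ge0 ?sqr_ge0 ?gauss_pdf_ge0.
have e : (\int[leb]_x ((x - m) ^+ 2 * gauss_pdf m v x)%:E = v%:E)%E.
  rewrite -(ge0_integral_translate m mf f0).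
  transitivity (\int[leb]_x (x ^+ 2 * gauss_pdf (0 : R) v x)%:E)%E.
    apply: eq_integral => x _; rewrite [m + x]addrC addrK -[X in gauss_pdf X](add0r m).
    by rewrite gauss_pdf_shift// addrK.
  rewrite (integral_gauss_pdf_expr v0 (isT : 0 <= 2)%N).
  under eq_integral do rewrite expr0 mul1r.
  by rewrite integral_gauss_pdf mule1 mulr1.
split=> //; apply/integrableP; split => //.
by under eq_integral do rewrite gee0_abs//; rewrite e ltry.
Qed.

Lemma integrable_bounded_gauss_pdf (g : R -> R) m v :
  measurable_fun setT g -> (forall x, 0 <= g x <= 1) ->
  leb.-integrable setT (fun x : R => (g x * gauss_pdf m v x)%:E).
Proof.
move=> mg g01.
apply: (@le_integrable _ (measurableTypeR R) R leb _ measurableT _ (EFin \o @gauss_pdf R m v)).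
- by apply/measurable_EFinP/measurable_funM; [exact: mg|exact: measurable_gauss_pdf].
- move=> x _; have /andP[g0 g1] := g01 x.
  rewrite /= lee_fin normrM !ger0_norm ?gauss_pdf_ge0//.
  by rewrite ler_piMl ?gauss_pdf_ge0.
- exact: integrable_gauss_pdf.
Qed.

(** The constant integrates the pointwise bound: each density contributes 2 + |m1 - m2| + 3 v with v
    <= 2, and two of these add up to at most 16 + 2 |m1 - m2|. *)
Lemma integral_gauss_pdf_lipschitz (g : R -> R) m1 m2 v1 v2 :
  measurable_fun setT g -> (forall x, 0 <= g x <= 1) ->
  2^-1 <= v1 <= 2 -> 2^-1 <= v2 <= 2 ->
  `|\int[leb]_x (g x * gauss_pdf m1 v1 x) - \int[leb]_x (g x * gauss_pdf m2 v2 x)| <=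
  (`|v1 - v2| + `|m1 - m2|) * (16 + 2 * `|m1 - m2|).
Proof.
move=> mg g01 h1 h2; have [/andP[l1 u1] /andP[l2 u2]] := (h1, h2).
have [p1 p2] : 0 < v1 /\ 0 < v2 by split; lra.
set D := `|v1 - v2| + _; set B := 2 + `|m1 - m2|.
have D0 : 0 <= D by rewrite /D addr_ge0.
have B0 : 0 <= B by rewrite /B addr_ge0.
have ig1 := integrable_bounded_gauss_pdf m1 v1 mg g01.
have ig2 := integrable_bounded_gauss_pdf m2 v2 mg g01.
pose H m v x : R := B * gauss_pdf m v x + 3 * ((x - m) ^+ 2 * gauss_pdf m v x).
have iH m v : 0 < v -> leb.-integrable setT (EFin \o H m v).
  move=> v0; rewrite [X in integrable _ _ X](_ : _ =
      (fun x => B%:E * (EFin \o @gauss_pdf R m v) x) \+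
      (fun x => 3%:E * (((x - m) ^+ 2 * gauss_pdf m v x)%:E)))%E//.
  apply: integrableD => //; apply: integrableZl => //; first exact: integrable_gauss_pdf.
  by have [] := integrable_sqr_gauss_pdf m v0.
have eH m v : 0 < v -> \int[leb]_x (H m v x) = B + 3 * v.
  move=> v0; have [i e] := integrable_sqr_gauss_pdf m v0.
  have i' := @integrable_gauss_pdf R m v.
  rewrite RintegralD//; [|exact: (integrableZl measurableT B i')|
    exact: (integrableZl measurableT 3 i)].
  rewrite RintegralZl// RintegralZl//.
  by rewrite /Rintegral integral_gauss_pdf e/= mulr1.
rewrite -RintegralB//.
have iB : leb.-integrable setT
    (EFin \o (fun x => g x * gauss_pdf m1 v1 x - g x * gauss_pdf m2 v2 x)).
  exact: (integrableB measurableT ig1 ig2).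
apply: le_trans (le_normr_Rintegral _ _) _ => //.
apply: (@le_trans _ _ (\int[leb]_x (D * (H m1 v1 x + H m2 v2 x)))).
  apply: le_Rintegral => //.
  - exact: (integrable_norm iB).
  - rewrite [X in integrable _ _ X](_ : _ =
      (fun x => D%:E * ((EFin \o H m1 v1) \+ (EFin \o H m2 v2)) x))%E//.
    by apply: integrableZl => //; apply: integrableD => //; exact: iH.
  - move=> x _; have /andP[g0 g1] := g01 x.
    rewrite -mulrBr normrM (ger0_norm g0).
    apply: (@le_trans _ _ `|gauss_pdf m1 v1 x - gauss_pdf m2 v2 x|).
      by rewrite ler_piMl.
    apply: le_trans (gauss_pdf_lipschitz _ _ _ h1 h2) _.
    by rewrite ler_wpM2l// /H -/D -/B !mulrDl !mulrA.
rewrite RintegralZl//; last first.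
  rewrite [X in integrable _ _ X](_ : _ = ((EFin \o H m1 v1) \+ (EFin \o H m2 v2)))%E//.
  by apply: integrableD => //; exact: iH.
rewrite RintegralD ?eH//; [|exact: iH|exact: iH].
rewrite ler_wpM2l// /B; lra.
Qed.

End gauss_pdf_lipschitz.

(** * The Cramer-Wold theorem *)

Section power_step.
Context {R : realType}.
Implicit Types (q t u : R) (n N : nat).

Lemma bernoulli_ineq t N : -1 <= t -> 1 + N%:R * t <= (1 + t) ^+ N.
Proof.
move=> t1; elim: N => [|N IH]; first by rewrite mul0r addr0 expr0.
rewrite exprSr; apply: le_trans (ler_wpM2r _ IH); last by lra.
rewrite -natr1; have : 0 <= N%:R * (t * t) by rewrite mulr_ge0 ?ler0n// -expr2 sqr_ge0.
lra.
Qed.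

Lemma cvg_natmul_expr q : 0 <= q < 1 -> n%:R * q ^+ n @[n --> \oo] --> (0 : R).
Proof.
move=> /andP[q0 q1]; have [->|qn0] := eqVneq q 0.
  apply: cvgr0_le (_ : cst 0 @ \oo --> 0); last exact: cvg_cst.
  by case=> [|n]; rewrite ?mul0r ?expr0n ?mulr0 normr0.
have qp : 0 < q by rewrite lt_neqAle eq_sym qn0.
pose r := Num.sqrt q; have rp : 0 < r by rewrite sqrtr_gt0.
have r1 : r < 1 by rewrite -sqrtr1 ltr_sqrt.
pose h := r^-1 - 1; have hp : 0 < h by rewrite subr_gt0 invf_gt1.
apply: (@cvgr0_le _ _ (fun n => h^-1 * r ^+ n)).
  move=> n; rewrite ger0_norm ?mulr_ge0 ?exprn_ge0//.
  have -> : q = r ^+ 2 by rewrite sqr_sqrtr// ltW.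
  rewrite exprAC expr2 mulrA ler_wpM2r ?exprn_ge0 ?(ltW rp)//.
  rewrite -[h^-1]mul1r ler_pdivlMr//.
  have : 1 + n%:R * h <= (1 + h) ^+ n by apply: bernoulli_ineq; lra.
  rewrite {2}/h subrKC exprVn => B.
  rewrite mulrAC -ler_pdivlMr ?exprn_gt0// mul1r.
  by apply: le_trans B; rewrite lerDr.
rewrite -(mulr0 h^-1); apply: cvgM; first exact: cvg_cst.
have := @cvg_geometric R 1 r; rewrite ger0_norm ?ltW// => /(_ r1).
by apply: cvg_trans; apply: near_eq_cvg; apply: nearW => n; rewrite /= mul1r.
Qed.

(** With N = n 2^n one has N u^n = n (2 u)^n. For u < 1/2 this tends to 0 and Bernoulli's inequality
    keeps the power near 1. For u >= 1/2 it is at least n, and (1 - u^n)^N (1 + u^n)^N <= 1 bounds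
    the power by 1 / (n + 1); the extra factor n settles the case u = 1/2. *)
Lemma cvg_power_step u : 0 <= u <= 1 ->
  (1 - u ^+ n) ^+ (n * 2 ^ n)%N @[n --> \oo] --> ((u < 2^-1)%R%:R : R).
Proof.
move=> /andP[u0 u1].
have un n : 0 <= u ^+ n <= 1 by rewrite exprn_ge0//= exprn_ile1.
have eN n : (n * 2 ^ n)%N%:R * u ^+ n = n%:R * (2 * u) ^+ n :> R.
  by rewrite natrM natrX exprMn mulrA.
case: ltP => u2 /=.
  rewrite -[X in _ --> X]subr0.
  have q : 0 <= 2 * u < 1 by lra.
  apply: (@squeeze_cvgr _ _ _ _ (fun n => 1 - n%:R * (2 * u) ^+ n) (cst 1)).
  - apply: nearW => n; have /andP[a b] := un n.
    rewrite -eN; apply/andP; split; last by rewrite exprn_ile1//; lra.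
    by have := @bernoulli_ineq (- u ^+ n) (n * 2 ^ n)%N; rewrite mulrN; apply; lra.
  - by apply: cvgB; [exact: cvg_cst|exact: cvg_natmul_expr].
  - by rewrite subr0; exact: cvg_cst.
apply: cvgr0_le (@cvg_harmonic R) => n; have /andP[a b] := un n.
rewrite ger0_norm ?exprn_ge0 ?subr_ge0// /harmonic /= -[leRHS]mul1r ler_pdivlMr//.
apply: (@le_trans _ _ ((1 - u ^+ n) ^+ (n * 2 ^ n) * (1 + u ^+ n) ^+ (n * 2 ^ n))).
  rewrite ler_wpM2l ?exprn_ge0 ?subr_ge0//.
  apply: le_trans (bernoulli_ineq _ _); last by lra.
  rewrite -natr1 addrC lerD2l eN ler_peMr ?ler0n// exprn_ege1//; lra.
rewrite -exprMn; apply: exprn_ile1; first by nra.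
by nra.
Qed.

(** The sequence is eventually constant: once |y| / (n + 1) < pi, the sine has the sign of y. *)
Lemma cvg_sin_step (y : R) : ((sin (y / n.+1%:R) < 0)%R%:R : R) @[n --> \oo] --> ((y < 0)%R%:R : R).
Proof.
apply: cvg_near_cst.
have pi0 := pi_gt0 R.
near=> n; have n0 : (0 : R) < n.+1%:R by [].
have yn : `|y| < pi * n.+1%:R.
  rewrite mulrC -ltr_pdivrMr// (@lt_trans _ _ n%:R)//; last by rewrite ltr_nat.
  by near: n; exact: nbhs_infty_gtr.
have [y0|y0] := ltP y 0.
  rewrite -[y]opprK mulNr sinN oppr_lt0 sin_gt0_pi//.
  by rewrite divr_gt0 ?oppr_gt0//= ltr_pdivrMr// -ltr0_norm.
rewrite ltNge sin_ge0_pi// divr_ge0//= ler_pdivrMr//.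
by rewrite -(ger0_norm y0) ltW.
Unshelve. all: by end_near. Qed.

End power_step.

Section cramer_wold.
Context {R : realType} {n : nat} (m1 m2 : probability (n.-tuple R) R).

Let lin (a : 'I_n -> R) (x : n.-tuple R) : R := \sum_i a i * tnth x i.

Hypothesis m12 : forall (a : 'I_n -> R) (A : set R), measurable A ->
  m1 (lin a @^-1` A) = m2 (lin a @^-1` A).

Let mlin a : measurable_fun setT (lin a).
Proof.
apply: measurable_sum => i; apply: measurable_funM => //.
exact: measurable_tnth.
Qed.

Lemma bounded_integrable d (T : measurableType d) (P : probability T R)
    (f : T -> R) (M : R) :
  measurable_fun setT f -> (forall x, `|f x| <= M) -> P.-integrable setT (EFin \o f).
Proof.
move=> mf fM; apply: measurable_bounded_integrable => //.
  by rewrite (le_lt_trans (probability_le1 P measurableT))// ltry.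
exists M; split; first exact: num_real.
by move=> y My x _; apply: le_trans (fM x) (ltW My).
Qed.

(* The functions [f] with [E f cos(a.x + b)] determined by the laws of the linear
   forms are stable under multiplication by [u = (1 + sin (al x_k + be)) / 2] and
   under bounded limits. As [(1 - u^N)^(N 2^N)] tends to [1{u < 1/2}], they are
   stable under multiplication by [1{sin (al x_k + be) < 0}], hence (slow sines)
   by [1{x_k < c}]. *)
Let char (f : n.-tuple R -> R) := measurable_fun setT f /\
  (exists M : R, forall x, `|f x| <= M) /\
  forall a b, \int[m1]_x (f x * cos (lin a x + b)) = \int[m2]_x (f x * cos (lin a x + b)).

Let mcos a b : measurable_fun setT (fun x => cos (lin a x + b)).
Proof.
apply: (measurableT_comp (f := @cos R)).
  exact: continuous_measurable_fun (@continuous_cos R).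
exact: measurable_funD.
Qed.

Let ibcos (P : probability (n.-tuple R) R) (f : n.-tuple R -> R) (M : R) a b :
  measurable_fun setT f -> (forall x, `|f x| <= M) ->
  P.-integrable setT (EFin \o (fun x => f x * cos (lin a x + b))).
Proof.
move=> mf fM; apply: (@bounded_integrable _ _ _ _ M).
  by apply: measurable_funM => //; exact: mcos.
move=> x; rewrite normrM -[leRHS]mulr1 ler_pM//.
by rewrite ler_norml cos_geN1 cos_le1.
Qed.

Let icos (P : probability (n.-tuple R) R) f a b : char f ->
  P.-integrable setT (EFin \o (fun x => f x * cos (lin a x + b))).
Proof. by move=> [mf [[M fM] _]]; exact: ibcos fM. Qed.

Let char1 : char (cst 1).
Proof.
split; first exact: measurable_cst.
split; first by exists 1 => x; rewrite normr1.
move=> a b; under eq_Rintegral do rewrite mul1r.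
under [RHS]eq_Rintegral do rewrite mul1r.
have mc : measurable_fun setT (fun y : R => cos (y + b)).
  apply: (measurableT_comp (f := @cos R)); last exact: measurable_funD.
  exact: continuous_measurable_fun (@continuous_cos R).
have ic (P : probability (n.-tuple R) R) :
    P.-integrable setT ((fun y => (cos (y + b))%:E) \o lin a).
  apply: (@bounded_integrable _ _ _ (fun x => cos (lin a x + b)) 1).
    exact: mcos.
  by move=> x; rewrite ler_norml cos_geN1 cos_le1.
have mcE : measurable_fun setT (fun y : R => (cos (y + b))%:E) by exact/measurable_EFinP.
rewrite /Rintegral; congr fine.
have H1 := @integral_pushforward _ _ _ _ R (lin a) (mlin a) m1 setT _ mcE (ic m1) measurableT.
have H2 := @integral_pushforward _ _ _ _ R (lin a) (mlin a) m2 setT _ mcE (ic m2) measurableT.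
rewrite preimage_setT /comp in H1; rewrite preimage_setT /comp in H2.
rewrite -H1 -H2; apply: eq_measure_integral => A mA _.
exact: m12.
Qed.

Let charB f g : char f -> char g -> char (fun x => f x - g x).
Proof.
move=> cf cg; have [mf [[M fM] ef]] := cf; have [mg [[N gN] eg]] := cg.
split; first exact: measurable_funB.
split; first by exists (M + N) => x; rewrite (le_trans (ler_normB _ _))// lerD.
move=> a b; under eq_Rintegral do rewrite mulrBl.
under [RHS]eq_Rintegral do rewrite mulrBl.
by rewrite RintegralB ?RintegralB ?ef ?eg//; exact: icos.
Qed.

Let charM f k al be : char f -> char (fun x => f x * ((1 + sin (al * tnth x k + be)) / 2)).
Proof.
move=> cf; have [mf [[M fM] ef]] := cf.
have msin : measurable_fun setT (fun x : n.-tuple R => sin (al * tnth x k + be)).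
  apply: (measurableT_comp (f := @sin R)).
    exact: continuous_measurable_fun (@continuous_sin R).
  by apply: measurable_funD => //; apply: measurable_funM => //; exact: measurable_tnth.
split.
  by apply: measurable_funM => //; apply: measurable_funM => //; exact: measurable_funD.
split.
  exists M => x; rewrite normrM -[leRHS]mulr1 ler_pM//.
  have := sin_le1 (al * tnth x k + be); have := sin_geN1 (al * tnth x k + be).
  by rewrite ler_norml => ? ?; apply/andP; split; lra.
move=> a b.
(* Multiplying by the sine shifts the frequency by plus or minus [al] in coordinate [k]; the phase
   pi / 2 turns the resulting sines back into cosines. *)
pose ap i := a i + (i == k)%:R * al; pose am i := a i - (i == k)%:R * al.
have sk x (c : R) : \sum_i (i == k)%:R * c * tnth x i = c * tnth x k.
  rewrite (bigD1 k)//= eqxx mul1r big1 ?addr0// => i /negbTE ->.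
  by rewrite !mul0r.
have ea x : f x * ((1 + sin (al * tnth x k + be)) / 2) * cos (lin a x + b) =
  2^-1 * (f x * cos (lin a x + b)) +
  (4^-1 * (f x * cos (lin ap x + (b + be - pi / 2))) -
   4^-1 * (f x * cos (lin am x + (b - be - pi / 2)))).
  have -> : lin ap x + (b + be - pi / 2) = (lin a x + b) + (al * tnth x k + be) - pi / 2.
    rewrite /lin /ap; under eq_bigr do rewrite mulrDl.
    by rewrite big_split/= sk; ring.
  have -> : lin am x + (b - be - pi / 2) = (lin a x + b) - (al * tnth x k + be) - pi / 2.
    rewrite /lin /am; under eq_bigr do rewrite mulrBl.
    by rewrite sumrB/= sk; ring.
  rewrite !(cosB _ (pi / 2)) cos_pihalf sin_pihalf !mulr0 !add0r !mulr1 sinD sinB.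
  by field.
have ii (P : probability (n.-tuple R) R) c a' b' :
    P.-integrable setT (EFin \o (fun x => c * (f x * cos (lin a' x + b')))).
  exact: (integrableZl measurableT c (icos P a' b' cf)).
have iB (P : probability (n.-tuple R) R) c a' b' a'' b'' : P.-integrable setT
    (EFin \o (fun x => c * (f x * cos (lin a' x + b')) - c * (f x * cos (lin a'' x + b'')))).
  exact: (integrableB measurableT (ii P c a' b') (ii P c a'' b'')).
have E (P : probability (n.-tuple R) R) :
    \int[P]_x (f x * ((1 + sin (al * tnth x k + be)) / 2) * cos (lin a x + b)) =
    2^-1 * \int[P]_x (f x * cos (lin a x + b)) +
    (4^-1 * \int[P]_x (f x * cos (lin ap x + (b + be - pi / 2))) -
     4^-1 * \int[P]_x (f x * cos (lin am x + (b - be - pi / 2)))).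
  under eq_Rintegral do rewrite ea.
  rewrite RintegralD//; [|exact: ii|exact: iB].
  rewrite RintegralB//; [|exact: ii|exact: ii].
  by rewrite !RintegralZl//; exact: icos.
by rewrite !E !ef.
Qed.

Let charM_power f k al be j N : char f ->
  char (fun x => f x * (1 - ((1 + sin (al * tnth x k + be)) / 2) ^+ j) ^+ N).
Proof.
pose u x := (1 + sin (al * tnth x k + be)) / 2.
have stepj i g : char g -> char (fun x => g x * u x ^+ i).
  elim: i g => [|i IHi] g cg.
    by rewrite (_ : (fun x => _) = g)//; apply/funext => x; rewrite expr0 mulr1.
  rewrite (_ : (fun x => _) = fun x => (g x * u x) * u x ^+ i); last first.
    by apply/funext => x; rewrite exprS mulrA.
  exact/IHi/charM.
move=> cf; elim: N => [|N IH].
  by rewrite (_ : (fun x => _) = f)//; apply/funext => x; rewrite expr0 mulr1.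
rewrite (_ : (fun x => _) = fun x =>
  f x * (1 - u x ^+ j) ^+ N - f x * (1 - u x ^+ j) ^+ N * u x ^+ j).
  by apply: charB => //; exact: stepj.
by apply/funext => x; rewrite exprSr /u; ring.
Qed.

Let char_cvg (f_ : nat -> n.-tuple R -> R) (f : n.-tuple R -> R) (M : R) : (forall j, char (f_ j)) ->
  (forall j x, `|f_ j x| <= M) -> (forall x, f_ j x @[j --> \oo] --> f x) -> char f.
Proof.
move=> cf fM ff.
have mf : measurable_fun setT f.
  apply: (measurable_fun_cvg (h := f_)) => [j|x _]; last exact: ff.
  by have [] := cf j.
have bf x : `|f x| <= M.
  have cx := cvg_norm (ff x).
  have -> : `|f x| = limn (fun j => `|f_ j x|) by apply/esym/cvg_lim => //; exact: cx.
  apply: limr_le; first by apply/cvg_ex; exists `|f x|; exact: cx.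
  exact: nearW.
split=> //; split; first by exists M.
move=> a b.
have key (P : probability (n.-tuple R) R) :
    \int[P]_x (f_ j x * cos (lin a x + b)) @[j --> \oo] -->
    \int[P]_x (f x * cos (lin a x + b)).
  apply: fine_cvg; rewrite fineK; last first.
    by apply: integrable_fin_num => //; exact: ibcos bf.
  apply: (@dominated_cvg _ _ _ P setT measurableT _ _ (cst M%:E)) => //.
  - by move=> j; apply/measurable_EFinP/measurable_funM; [have [] := cf j|exact: mcos].
  - move=> x _; apply: cvg_EFin; first exact: nearW.
    by apply: cvgM; [exact: ff|exact: cvg_cst].
  - exact: (@bounded_integrable _ _ P (cst M) `|M|).
  - move=> j x _; rewrite lee_fin normrM -[leRHS]mulr1 ler_pM//.
    by rewrite ler_norml cos_geN1 cos_le1.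
have e12 : (fun j => \int[m1]_x (f_ j x * cos (lin a x + b))) =
    (fun j => \int[m2]_x (f_ j x * cos (lin a x + b))).
  by apply/funext => j; have [_ [_ ->]] := cf j.
apply: (cvg_unique _ (key m1)) => //.
by have := key m2; rewrite -e12.
Qed.

Let char_step f k c : char f -> char (fun x => f x * (tnth x k < c)%R%:R).
Proof.
move=> cf; have [_ [[M fM] _]] := cf.
have u01 (t : R) : 0 <= (1 + sin t) / 2 <= 1.
  by have := sin_le1 t; have := sin_geN1 t; lra.
have stepM (b : bool) x : `|f x * b%:R| <= M.
  by rewrite normrM -[leRHS]mulr1 ler_pM//; case: b; rewrite ?normr1 ?normr0.
(* Two nested limits: powers in [i] produce the indicator of a negative sine, slow sines in [j] then
   produce the half-space. *)
apply: (@char_cvg (fun j x => f x * (sin ((tnth x k - c) / j.+1%:R) < 0)%R%:R) _ M) => //.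
- move=> j.
  apply: (@char_cvg (fun i x => f x *
    (1 - ((1 + sin (j.+1%:R^-1 * tnth x k + - c / j.+1%:R)) / 2) ^+ i) ^+ (i * 2 ^ i)%N) _ M).
  + by move=> i; exact: charM_power.
  + move=> i x; rewrite normrM -[leRHS]mulr1 ler_pM//.
    have /andP[u0 u1] := u01 (j.+1%:R^-1 * tnth x k + - c / j.+1%:R).
    have ui : 0 <= ((1 + sin (j.+1%:R^-1 * tnth x k + - c / j.+1%:R)) / 2) ^+ i <= 1.
      by rewrite exprn_ge0//= exprn_ile1.
    by case/andP: ui => ? ?; rewrite ger0_norm ?exprn_ge0 ?exprn_ile1 ?subr_ge0 ?gerBl.
  + move=> x; apply: cvgM; first exact: cvg_cst.
    rewrite [j.+1%:R^-1 * _]mulrC -mulrDl.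
    rewrite (_ : (sin _ < 0) = ((1 + sin ((tnth x k - c) / j.+1%:R)) / 2 < 2^-1)).
      exact/cvg_power_step/u01.
    by apply/idP/idP; lra.
- move=> x; apply: cvgM; first exact: cvg_cst.
  by rewrite -subr_lt0; exact: cvg_sin_step.
Qed.

Let char_orthant (c : 'I_n -> R) (s : seq 'I_n) :
  char (fun x => \prod_(i <- s) (tnth x i < c i)%R%:R).
Proof.
elim: s => [|i s IH].
  by rewrite (_ : (fun x => _) = cst 1)//; apply/funext => x; rewrite big_nil.
rewrite (_ : (fun x => _) = fun x => \prod_(i <- s) (tnth x i < c i)%R%:R *
    (tnth x i < c i)%R%:R); first exact: char_step.
by apply/funext => x; rewrite big_cons mulrC.
Qed.

Let orthant (c : 'I_n -> R) : set (n.-tuple R) := [set x | forall i, tnth x i < c i].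

Let measurable_orthant c : measurable (orthant c).
Proof.
rewrite (_ : orthant c = \bigcap_(i in [set: 'I_n]) [set x | tnth x i < c i]).
  apply: fin_bigcap_measurable => // i _; rewrite -[X in measurable X]setTI.
  have := @measurable_tnth _ R n i measurableT `]-oo, c i[%classic (measurable_itv _).
  by congr measurable; apply/seteqP; split => x [? /=]; rewrite in_itv.
apply/seteqP; split => x; first by move=> xc i _ /=; exact: xc.
by move=> H i; exact: H.
Qed.

Let orthant_eq c : m1 (orthant c) = m2 (orthant c).
Proof.
(* At zero frequency and phase the cosine is 1 and only the indicator remains. *)
have [_ [_ /(_ (cst 0) 0)]] := char_orthant c (index_enum 'I_n).
have E (P : probability (n.-tuple R) R) :
  \int[P]_x (\prod_i (tnth x i < c i)%R%:R * cos (lin (cst 0) x + 0)) = fine (P (orthant c)).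
  rewrite /Rintegral -[in RHS](setIT (orthant c)) -integral_indic//; congr fine.
  apply: eq_integral => x _; congr EFin.
  have -> : lin (cst 0) x = 0 by rewrite /lin big1// => i _; rewrite mul0r.
  rewrite addr0 cos0 mulr1.
  rewrite indicE; have [|] := boolP (x \in orthant c).
    by rewrite inE => xc; rewrite big1// => i _; rewrite xc.
  rewrite notin_setE => /existsNP[i xi].
  by rewrite (bigD1 i)//= (negbTE (introN idP xi)) mul0r.
rewrite !E => e.
by rewrite -[LHS]fineK ?fin_num_measure// e fineK// fin_num_measure.
Qed.

Let tail_bound (x : n.-tuple R) : exists k : nat, forall i, tnth x i < k%:R.
Proof.
exists (\max_(i < n) (Num.bound `|tnth x i|))%N => i.
apply: (@lt_le_trans _ _ (Num.bound `|tnth x i|)%:R).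
  by rewrite (le_lt_trans (ler_norm _))// archi_boundP.
by rewrite ler_nat (leq_bigmax (F := fun i => (Num.bound `|tnth x i|))).
Qed.

Lemma cramer_wold (A : set (n.-tuple R)) : measurable A -> m1 A = m2 A.
Proof.
pose G := [set B | exists c, B = orthant c].
apply: (@measure_unique _ _ _ G (fun k => orthant (fun=> k%:R))).
- apply/seteqP; split; last first.
    apply: smallest_sub; first exact: sigma_algebra_measurable.
    by move=> _ [c ->]; exact: measurable_orthant.
  apply: smallest_sub; first exact: smallest_sigma_algebra.
  move=> B; rewrite -bigcup_seq => -[i _ [C mC <-]].
  have mt : measurable_fun setT
      ((fun x : n.-tuple R => tnth x i) : g_sigma_algebraType G -> measurableTypeR R).
    (* A half-space in one coordinate is the union of the orthants whose other bounds are k, over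
       all k, so the orthants generate the sigma-algebra. *)
    apply: (measurability _ (RGenInftyO.measurableE R)) => _ [_ [y ->] <-].
    rewrite setTI (_ : _ @^-1` _ = \bigcup_k
        orthant (fun j => if j == i then y else k%:R)).
      by apply: bigcupT_measurable => k; apply: sub_sigma_algebra; eexists.
    apply/seteqP; split => x /=; rewrite in_itv/=.
      move=> xy; have [k xk] := tail_bound x.
      by exists k => // j; case: eqP => [->|_].
    by move=> [k _ /(_ i)]; rewrite eqxx.
  exact: (mt measurableT C mC).
- move=> _ _ [c ->] [c' ->]; exists (fun i => Num.min (c i) (c' i)).
  apply/seteqP; split => x /=.
    by move=> [xc xc'] i; rewrite lt_min xc xc'.
  by move=> H; split=> i; have := H i; rewrite lt_min => /andP[].
- by move=> k; exists (fun=> k%:R).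
- apply/seteqP; split => // x _ /=.
  by have [k xk] := tail_bound x; exists k.
- by move=> _ [c ->]; exact: orthant_eq.
- by move=> k; rewrite (le_lt_trans (probability_le1 m1 (measurable_orthant _)))// ltry.
Qed.

End cramer_wold.

(** * Regression of a Gaussian vector on all but one coordinate *)

(** The covariance is a function of two indices rather than a matrix, so that deleting or repeating
    coordinates is mere composition. *)
Definition gauss_vec d (T : measurableType d) (R : realType)
    (P : probability T R) n (Y : 'I_n -> T -> R) (S : 'I_n -> 'I_n -> R) : Prop :=
  (forall i, measurable_fun setT (Y i)) /\
  forall a : 'I_n -> R, is_normal P (fun w => \sum_i a i * Y i w) 0
    (\sum_i \sum_j a i * a j * S i j).

Definition tuple_of_fam (T R : Type) n (Y : 'I_n -> T -> R) (w : T) : n.-tuple R :=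
  [tuple Y i w | i < n].

Lemma tuple_of_famS (T R : Type) n (Y : 'I_n.+1 -> T -> R) (w : T) :
  tuple_of_fam Y w = [tuple of Y ord0 w :: tuple_of_fam (Y \o lift ord0) w].
Proof.
apply: eq_from_tnth => i; rewrite tnth_mktuple.
by case: (unliftP ord0 i) => [j ->|->]; rewrite ?tnthS ?tnth_mktuple ?tnth0.
Qed.

Lemma measurable_tuple_of_fam d (T : measurableType d) (R : realType) n
    (Y : 'I_n -> T -> R) :
  (forall i, measurable_fun setT (Y i)) -> measurable_fun setT (tuple_of_fam Y).
Proof.
move=> mY; apply/measurable_fun_tnthP => i.
by rewrite (_ : _ \o _ = Y i)//; apply/funext => w /=; rewrite tnth_mktuple.
Qed.

Definition reg_mean (R : realType) n (c : 'I_n -> R) (y : n.-tuple R) : R :=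
  \sum_j c j * tnth y j.

(* E[F(t :: y)] for t ~ N(c . y, v) *)
Definition cond_int (R : realType) n (F : n.+1.-tuple R -> R) (c : 'I_n -> R) (v : R)
    (y : n.-tuple R) : R :=
  \int[leb]_t (F [tuple of t :: y] * gauss_pdf (reg_mean c y) v t).

Section cond_int.
Context (R : realType) (n : nat) (F : n.+1.-tuple R -> R) (c : 'I_n -> R) (v : R).
Hypothesis mF : measurable_fun setT F.
Hypothesis F01 : forall x, 0 <= F x <= 1.

Lemma measurable_reg_mean : measurable_fun setT (reg_mean c).
Proof.
apply: measurable_sum => j; apply: measurable_funM => //.
exact: measurable_tnth.
Qed.

Lemma measurable_section (y : n.-tuple R) : measurable_fun setT (fun t : R => F [tuple of t :: y]).
Proof. by apply: measurableT_comp => //; exact: measurable_cons. Qed.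

Lemma cond_intE (y : n.-tuple R) : (\int[leb]_t ((F [tuple of t :: y])%:E *
  (gauss_pdf (reg_mean c y) v t)%:E) = (cond_int F c v y)%:E)%E.
Proof.
rewrite /cond_int /Rintegral fineK; last first.
  apply: integrable_fin_num => //; apply: integrable_bounded_gauss_pdf => //.
  exact: measurable_section.
by apply: eq_integral => t _; rewrite EFinM.
Qed.

Lemma cond_int01 (y : n.-tuple R) : 0 <= cond_int F c v y <= 1.
Proof.
rewrite -!lee_fin -cond_intE; apply/andP; split.
  apply: integral_ge0 => t _; rewrite -EFinM lee_fin mulr_ge0 ?gauss_pdf_ge0//.
  by have /andP[] := F01 [tuple of t :: y].
rewrite -(integral_gauss_pdf (reg_mean c y) v); apply: ge0_le_integral => //.
- move=> t _; rewrite -EFinM lee_fin mulr_ge0 ?gauss_pdf_ge0//.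
  by have /andP[] := F01 [tuple of t :: y].
- apply/measurable_EFinP/measurable_funM; first exact: measurable_section.
  exact: measurable_gauss_pdf.
- by apply/measurable_EFinP; exact: measurable_gauss_pdf.
- move=> t _; rewrite -EFinM lee_fin ler_piMl ?gauss_pdf_ge0//.
  by have /andP[] := F01 [tuple of t :: y].
Qed.

Lemma measurable_cond_int : 0 < v -> measurable_fun setT (cond_int F c v).
Proof.
move=> v0; apply/measurable_EFinP.
rewrite (_ : _ \o _ = fun y : n.-tuple R => (\int[leb]_t ((F [tuple of t :: y])%:E *
  (gauss_pdf (reg_mean c y) v t)%:E))%E); last first.
  by apply/funext => y; rewrite cond_intE.
apply: (@measurable_fun_fubini_tonelli_F _ _ _ (measurableTypeR R) R leb
  (fun z : n.-tuple R * R => (F [tuple of z.2 :: z.1])%:E *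
    (gauss_pdf (reg_mean c z.1) v z.2)%:E)%E).
- apply: emeasurable_funM; apply/measurable_EFinP.
    by apply: measurableT_comp => //; apply: measurable_cons; [exact: measurable_snd|exact: measurable_fst].
  (* The mean depends on y, so the density is written as a centred one evaluated at a residual,
     which is measurable jointly in both variables. *)
  rewrite (_ : (fun z => _) = gauss_pdf 0 v \o (fun z : n.-tuple R * R => z.2 - reg_mean c z.1)).
    apply: measurableT_comp; first exact: measurable_gauss_pdf.
    apply: measurable_funB; first exact: measurable_snd.
    by apply: measurableT_comp; [exact: measurable_reg_mean|exact: measurable_fst].
  by apply/funext => z /=; rewrite -gauss_pdf_shift// add0r.
- move=> z; rewrite -EFinM lee_fin mulr_ge0 ?gauss_pdf_ge0//.
  by have /andP[] := F01 [tuple of z.2 :: z.1].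
Qed.

End cond_int.

Section regression.
Context d (T : measurableType d) (R : realType) (P : probability T R).
Context (n : nat) (Y : 'I_n.+1 -> T -> R) (S : 'I_n.+1 -> 'I_n.+1 -> R).
Hypothesis gY : gauss_vec P Y S.
Hypothesis symS : forall i j, S i j = S j i.
Variable c : 'I_n -> R.
Local Notation up := (lift ord0).
Hypothesis cS : forall k, \sum_j c j * S (up j) (up k) = S ord0 (up k).

(** The Schur complement, that is, the conditional variance of coordinate 0 given the others, [cS]
    being the normal equations. *)
Definition residual_var : R := S ord0 ord0 - \sum_j c j * S ord0 (up j).

Let A (x : 'I_n -> R) : R := \sum_j x j * S ord0 (up j).
Let D (x y : 'I_n -> R) : R := \sum_i \sum_j x i * y j * S (up i) (up j).

Let Q (b : 'I_n.+1 -> R) : \sum_i \sum_j b i * b j * S i j =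
  b ord0 ^+ 2 * S ord0 ord0 + 2 * b ord0 * A (b \o up) + D (b \o up) (b \o up).
Proof.
rewrite big_ord_recl big_ord_recl -expr2 -!addrA; congr (_ + _).
under [X in _ + X]eq_bigr do rewrite big_ord_recl.
rewrite big_split/= addrA; congr (_ + _).
rewrite /A mulr_sumr -big_split/=; apply: eq_bigr => i _.
by rewrite [S (up i) _]symS; ring.
Qed.

Let Dc y : D c y = A y.
Proof.
rewrite /D exchange_big/=; apply: eq_bigr => k _; rewrite -cS mulr_sumr.
by apply: eq_bigr => j _; rewrite mulrAC mulrC.
Qed.

Let DC x y : D x y = D y x.
Proof.
rewrite /D exchange_big/=; apply: eq_bigr => i _; apply: eq_bigr => j _.
by rewrite symS; ring.
Qed.

Let DB x y z (k : R) : D (fun i => x i - k * y i) z = D x z - k * D y z.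
Proof.
rewrite /D mulr_sumr -sumrB; apply: eq_bigr => i _.
by rewrite mulr_sumr -sumrB; apply: eq_bigr => j _; ring.
Qed.

Let AB x y (k : R) : A (fun i => x i - k * y i) = A x - k * A y.
Proof.
by rewrite /A mulr_sumr -sumrB; apply: eq_bigr => j _; ring.
Qed.

(* the residual is uncorrelated with the regressors *)
Lemma regression_var (b : 'I_n.+1 -> R) (a0 : R) (a : 'I_n -> R) :
  b ord0 = a0 -> (forall j, b (up j) = a j - a0 * c j) ->
  \sum_i \sum_j b i * b j * S i j =
  \sum_i \sum_j a i * a j * S (up i) (up j) + a0 ^+ 2 * residual_var.
Proof.
move=> b0 bS; rewrite Q b0 (_ : b \o up = fun j => a j - a0 * c j); last first.
  by apply/funext => j /=; rewrite bS.
rewrite AB DB (DC a) DB Dc (DC c) DB !Dc -/(D a a) /residual_var -/(A c).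
by rewrite (DC a c) Dc; ring.
Qed.

Let eps w := Y ord0 w - \sum_j c j * Y (up j) w.

Let m_eps : measurable_fun setT eps.
Proof.
have [mY _] := gY; apply: measurable_funB => //.
by apply: measurable_sum => j; exact: measurable_funM.
Qed.

Let m_up : measurable_fun setT (tuple_of_fam (Y \o up)).
Proof. by apply: measurable_tuple_of_fam => i; have [mY _] := gY; exact: mY. Qed.

Let lincomb (a0 : R) (a : 'I_n -> R) :
  is_normal P (fun w => a0 * eps w + \sum_j a j * Y (up j) w) 0
   (\sum_i \sum_j a i * a j * S (up i) (up j) + a0 ^+ 2 * residual_var).
Proof.
pose b i := if unlift ord0 i is Some j then a j - a0 * c j else a0.
have b0 : b ord0 = a0 by rewrite /b unlift_none.
have bS j : b (up j) = a j - a0 * c j by rewrite /b liftK.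
rewrite -(regression_var b0 bS); have [_ /(_ b)] := gY.
congr is_normal; apply/funext => w; rewrite big_ord_recl b0 /eps.
have -> : \sum_(i < n) b (up i) * Y (up i) w =
    \sum_j a j * Y (up j) w - a0 * \sum_j c j * Y (up j) w.
  rewrite mulr_sumr -sumrB; apply: eq_bigr => j _.
  by rewrite bS; ring.
by ring.
Qed.

Let n_eps (a0 : R) : is_normal P (fun w => a0 * eps w) 0 (a0 ^+ 2 * residual_var).
Proof.
have := lincomb a0 (cst 0); congr is_normal.
  by apply/funext => w; rewrite big1 ?addr0// => i _; rewrite mul0r.
by rewrite big1 ?add0r// => i _; rewrite big1// => j _; rewrite !mul0r.
Qed.

Let n_up (a : 'I_n -> R) : is_normal P (fun w => \sum_j a j * Y (up j) w) 0
  (\sum_i \sum_j a i * a j * S (up i) (up j)).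
Proof.
have := lincomb 0 a; congr is_normal; last by rewrite expr0n mul0r addr0.
by apply/funext => w; rewrite mul0r add0r.
Qed.

Lemma gauss_vec_up : gauss_vec P (Y \o up) (fun i j => S (up i) (up j)).
Proof. by split=> [i|a]; [have [mY _] := gY; exact: mY|exact: n_up]. Qed.

(* by Cramer-Wold the residual and the regressors are independent *)
Let indep (F : n.+1.-tuple R -> \bar R) : measurable_fun setT F -> (forall x, 0 <= F x)%E ->
  (\int[P]_w F [tuple of eps w :: tuple_of_fam (Y \o up) w] =
   \int[P]_w \int[P]_w' F [tuple of eps w' :: tuple_of_fam (Y \o up) w])%E.
Proof.
move=> mF F0.
pose X1 w := [tuple of eps w :: tuple_of_fam (Y \o up) w].
pose X2 (z : T * T) := [tuple of eps z.2 :: tuple_of_fam (Y \o up) z.1].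
have mX1 : measurable_fun setT X1 by exact: measurable_cons.
have mX2 : measurable_fun setT X2.
  by apply: measurable_cons; apply: measurableT_comp.
pose X1' : {mfun T >-> n.+1.-tuple R} := mfun_Sub (mem_set mX1).
pose X2' : {mfun (T * T)%type >-> n.+1.-tuple R} := mfun_Sub (mem_set mX2).
pose m1 : probability (n.+1.-tuple R) R := distribution P X1'.
pose m2 : probability (n.+1.-tuple R) R := distribution (P \x P)%E X2'.
(* The variance of a linear form of residual and regressors has no cross term, so its law is the one
   obtained by drawing the residual from an independent copy of the space. *)
have m12 (B : set (n.+1.-tuple R)) : measurable B -> m1 B = m2 B.
  apply: cramer_wold => a A0 mA.
  have [_ l1] := lincomb (a ord0) (a \o up).
  have m_lin : measurable_fun setT (fun w => \sum_j (a \o up) j * Y (up j) w).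
    by apply: measurable_sum => j; apply: measurable_funM => //; have [mY _] := gY.
  have m_e : measurable_fun setT (fun w => a ord0 * eps w) by exact: measurable_funM.
  have [_ l2] := is_normalD m_lin m_e (n_up (a \o up)) (n_eps (a ord0)).
  have E t w : \sum_i a i * tnth [tuple of t :: tuple_of_fam (Y \o up) w] i =
      a ord0 * t + \sum_j (a \o up) j * Y (up j) w.
    rewrite big_ord_recl tnth0; congr (_ + _); apply: eq_bigr => j _.
    by rewrite tnthS tnth_mktuple.
  transitivity (P ((fun w => a ord0 * eps w + \sum_j (a \o up) j * Y (up j) w) @^-1` A0)).
    by congr (P _); apply/funext => w; exact: (congr1 A0 (E _ _)).
  rewrite l1// -l2//; congr ((P \x P)%E _).
  by apply/funext => w; rewrite /preimage/= addrC; apply/esym/(congr1 A0 (E _ _)).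
have i1 : (\int[P]_w F (X1 w) = \int[m1]_x F x)%E.
  rewrite (@ge0_integral_distribution _ _ _ _ _ P X1')//.
have i2 : (\int[P \x P]_w F (X2 w) = \int[m2]_x F x)%E.
  rewrite (@ge0_integral_distribution _ _ _ _ _ (P \x P)%E X2')//.
rewrite -/X1 i1 (eq_measure_integral m2); last by move=> B mB _; exact: m12.
rewrite -i2 fubini_tonelli1//.
exact: measurableT_comp.
Qed.

(** [G] adds the regression back to the residual. With the regressors frozen by independence, a
    translation by their regression turns the centred density of the residual into the one in
    [cond_int]. *)
Lemma regression_integral (F : n.+1.-tuple R -> R) :
  measurable_fun setT F -> (forall x, 0 <= F x <= 1) -> 0 < residual_var ->
  \int[P]_w F (tuple_of_fam Y w) =
  \int[P]_w cond_int F c residual_var (tuple_of_fam (Y \o up) w).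
Proof.
move=> mF F01 v0; rewrite /Rintegral; congr fine.
pose G (x : n.+1.-tuple R) : n.+1.-tuple R :=
  [tuple of (tnth x ord0 + reg_mean c [tuple of behead x]) :: [tuple of behead x]].
have mG : measurable_fun setT G.
  apply: measurable_cons; last exact: measurable_behead.
  apply: measurable_funD; first exact: measurable_tnth.
  by apply: measurableT_comp; [exact: measurable_reg_mean|exact: measurable_behead].
have GE t (y : n.-tuple R) : G [tuple of t :: y] = [tuple of t + reg_mean c y :: y].
  have yb : ([tuple of behead [tuple of t :: y]] : n.-tuple R) = y by exact: val_inj.
  by rewrite /G tnth0 yb.
have F0 x : (0 <= (F x)%:E)%E by rewrite lee_fin; case/andP: (F01 x).
transitivity (\int[P]_w (F (G [tuple of eps w :: tuple_of_fam (Y \o up) w]))%:E)%E.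
  apply: eq_integral => w _; rewrite GE tuple_of_famS /eps /reg_mean.
  under [X in _ - _ + X]eq_bigr do rewrite tnth_mktuple.
  by rewrite subrK.
rewrite (indep (F := fun x => (F (G x))%:E))//; last first.
  by apply/measurable_EFinP; exact: measurableT_comp.
apply: eq_integral => w _; rewrite -cond_intE//.
set y := tuple_of_fam _ w.
under eq_integral do rewrite GE.
have mf : measurable_fun setT (fun t : R => (F [tuple of t + reg_mean c y :: y])%:E).
  apply/measurable_EFinP; apply: measurableT_comp => //; apply: measurable_cons => //.
  exact: measurable_funD.
have neps : is_normal P eps 0 residual_var.
  have := n_eps 1; congr is_normal; last by rewrite expr1n mul1r.
  by apply/funext => w'; rewrite mul1r.
rewrite (is_normal_ge0_integral m_eps neps v0 mf)//.
rewrite -[RHS](ge0_integral_translate (reg_mean c y)).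
- apply: eq_integral => t _; have := gauss_pdf_shift 0 (reg_mean c y + t) (reg_mean c y) v0.
  by rewrite add0r => ->; rewrite [_ + t]addrC addrK.
- apply: emeasurable_funM; apply/measurable_EFinP; last exact: measurable_gauss_pdf.
  exact: measurable_section.
- by move=> t; rewrite mule_ge0// lee_fin gauss_pdf_ge0.
Qed.
End regression.

(** * Dependence of a Gaussian law on its covariance matrix *)

Section near_identity.
Context {R : realType}.

(** The tolerance shrinks with the dimension: the deviations in a row add up to less than 1/4, and
    the condition only loosens when a coordinate is dropped. *)
Definition near_id n (S : 'I_n -> 'I_n -> R) : Prop :=
  forall i j, `|S i j - (i == j)%:R| <= (4 * n.+1%:R)^-1.

Lemma sum_norm_le n (x b : 'I_n -> R) (e : R) : (forall j, `|b j| <= e) ->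
  `|\sum_j x j * b j| <= e * \sum_j `|x j|.
Proof.
move=> be; rewrite (le_trans (ler_norm_sum _ _ _))// mulr_sumr ler_sum// => j _.
by rewrite normrM mulrC ler_wpM2r.
Qed.

(** From x = x S - x (S - I) one gets |x_k| <= b + e X, with X the sum of the |x_j|. After summation
    over k the term n e X <= X / 4 is absorbed on the left. *)
Lemma near_id_solution_le n (S : 'I_n -> 'I_n -> R) (x : 'I_n -> R) (b e : R) :
  0 <= e -> n%:R * e <= 4^-1 -> (forall i j, `|S i j - (i == j)%:R| <= e) ->
  (forall k, `|\sum_j x j * S j k| <= b) ->
  \sum_j `|x j| <= 2 * n%:R * b.
Proof.
move=> e0 ne Se xS; set X := \sum_j _.
have X0 : 0 <= X by rewrite sumr_ge0.
have [n0|n_gt0] := posnP n.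
  have -> : X = 0.
    by rewrite /X big1// => j _; have := leq_ltn_trans (leq0n j) (ltn_ord j); rewrite n0.
  by rewrite n0 mulr0 mul0r.
have b0 : 0 <= b by rewrite (le_trans _ (xS (Ordinal n_gt0))).
have xk k : `|x k| <= b + e * X.
  have -> : x k = \sum_j x j * S j k - \sum_j x j * (S j k - (j == k)%:R).
    rewrite -sumrB (eq_bigr (fun j => x j * (j == k)%:R)); last first.
      by move=> j _; ring.
    rewrite (bigD1 k)//= eqxx mulr1 big1 ?addr0// => j /negbTE ->.
    by rewrite mulr0.
  by rewrite (le_trans (ler_normB _ _))// lerD// sum_norm_le.
have : X <= n%:R * (b + e * X).
  rewrite /X (le_trans (ler_sum _ (fun k _ => xk k)))//.
  by rewrite sumr_const card_ord mulr_natl.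
rewrite mulrDr mulrA; have : n%:R * e * X <= 4^-1 * X by rewrite ler_wpM2r.
have : 0 <= n%:R * b by rewrite mulr_ge0.
lra.
Qed.

(** The a priori estimate with right-hand side 0 makes the kernel trivial. *)
Lemma near_id_solve n (S : 'I_n -> 'I_n -> R) (b : 'I_n -> R) (e : R) :
  0 <= e -> n%:R * e <= 4^-1 -> (forall i j, `|S i j - (i == j)%:R| <= e) ->
  exists c : 'I_n -> R, forall k, \sum_j c j * S j k = b k.
Proof.
move=> e0 ne Se; pose M : 'M[R]_n := \matrix_(i, j) S i j.
have Mu : M \in unitmx.
  rewrite unitmxE unitfE; apply/negP => /det0P[v v0 vM].
  have xS k : `|\sum_j v 0 j * S j k| <= 0.
    have /matrixP/(_ 0 k) := vM; rewrite !mxE => vMk.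
    rewrite (eq_bigr (fun j => v 0 j * M j k)) ?vMk ?normr0// => j _.
    by rewrite !mxE.
  have := near_id_solution_le e0 ne Se xS; rewrite mulr0 => v_le0.
  case/negP: v0; apply/eqP/rowP => j; rewrite mxE; apply/eqP.
  rewrite -normr_eq0 eq_le normr_ge0 andbT (le_trans _ v_le0)//.
  by rewrite (bigD1 j)//= lerDl sumr_ge0.
exists (fun j => (\row_k b k *m invmx M) 0 j) => k.
have /matrixP/(_ 0 k) : \row_k b k *m invmx M *m M = \row_k b k by rewrite mulmxKV.
by rewrite !mxE => <-; apply: eq_bigr => j _; rewrite !mxE.
Qed.

Lemma sqr_sum_norm_le n (y : 'I_n -> R) :
  (\sum_j `|y j|) ^+ 2 <= n%:R * \sum_j y j ^+ 2.
Proof.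
rewrite expr2 mulr_suml.
apply: (@le_trans _ _ (\sum_i \sum_j (y i ^+ 2 + y j ^+ 2) / 2)).
  apply: ler_sum => i _; rewrite mulr_sumr; apply: ler_sum => j _.
  rewrite -(real_normK (num_real (y i))) -(real_normK (num_real (y j))).
  have := sqr_ge0 (`|y i| - `|y j|); rewrite sqrrB; set a := `|y i|; set b := `|y j|.
  by rewrite -mulr_natr; lra.
set q := \sum_j y j ^+ 2.
have inner i : \sum_j (y i ^+ 2 + y j ^+ 2) / 2 = (n%:R * y i ^+ 2 + q) / 2.
  by rewrite -mulr_suml big_split/= sumr_const card_ord mulr_natl.
rewrite (eq_bigr _ (fun i _ => inner i)) -mulr_suml big_split/= -mulr_sumr.
rewrite sumr_const card_ord -[q *+ n]mulr_natl -/q.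
by move: (n%:R * q) => t; lra.
Qed.
End near_identity.

Lemma gauss_vec_coord d (T : measurableType d) (R : realType) (P : probability T R)
    n (Y : 'I_n -> T -> R) (S : 'I_n -> 'I_n -> R) i :
  gauss_vec P Y S -> is_normal P (Y i) 0 (S i i).
Proof.
move=> [_ /(_ (fun j => (j == i)%:R))]; congr is_normal.
  apply/funext => w; rewrite (bigD1 i)//= eqxx mul1r big1 ?addr0// => j /negbTE ->.
  by rewrite mul0r.
rewrite (bigD1 i)//= [X in _ + X]big1 ?addr0; last first.
  by move=> j /negbTE ->; rewrite big1// => k _; rewrite !mul0r.
rewrite (bigD1 i)//= eqxx !mul1r big1 ?addr0// => j /negbTE ->.
by rewrite mulr0 mul0r.
Qed.

Section near_id_regression.
Context {R : realType}.
Variable n : nat.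
Implicit Types S : 'I_n.+1 -> 'I_n.+1 -> R.
Local Notation up := (lift ord0).

Let eta : R := (4 * n.+2%:R)^-1.

Let eta_ge0 : 0 <= eta. Proof. by rewrite invr_ge0 mulr_ge0. Qed.

Let eta_n : n%:R * eta <= 4^-1.
Proof.
by rewrite /eta invfM mulrCA ler_piMr ?invr_ge0// ler_pdivrMr// mul1r ler_nat ltnW.
Qed.

Let eta_le8 : eta <= 8^-1.
Proof.
rewrite lef_pV2 ?posrE ?mulr_gt0//.
have : (2 : R) <= n.+2%:R by rewrite ler_nat.
lra.
Qed.

Let eq_up (i j : 'I_n) : (up i == up j) = (i == j).
Proof. by rewrite (inj_eq lift_inj). Qed.

Lemma near_id_up S : near_id S -> near_id (fun i j => S (up i) (up j)).
Proof.
move=> nS i j; rewrite -(eq_up i j); apply: le_trans (nS _ _) _.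
by rewrite lef_pV2 ?posrE ?mulr_gt0// ler_wpM2l// ler_nat.
Qed.

(** The a priori estimate bounds the sum of the |c_j| by 2 n eta <= 1/2. The residual variance then
    differs from 1 by at most 1/8 + 1/16, well inside the interval on which normal densities were
    compared. *)
Lemma near_id_regression S : near_id S ->
  exists c : 'I_n -> R, [/\ forall k, \sum_j c j * S (up j) (up k) = S ord0 (up k),
    \sum_j `|c j| <= 2^-1 & 2^-1 <= residual_var S c <= 2].
Proof.
move=> nS.
have nSup i j : `|S (up i) (up j) - (i == j)%:R| <= eta by rewrite -eq_up; exact: nS.
have nS0 k : `|S ord0 (up k)| <= eta by have := nS ord0 (up k); rewrite subr0.
have [c cS] := near_id_solve (fun k => S ord0 (up k)) eta_ge0 eta_n nSup.
exists c.
have c1 : \sum_j `|c j| <= 2^-1.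
  have := near_id_solution_le eta_ge0 eta_n nSup (b := eta) (x := c).
  move=> /(_ _)/le_trans; apply; last first.
    by rewrite -mulrA; have := eta_n; lra.
  by move=> k; rewrite cS.
split=> //; rewrite /residual_var.
have := nS ord0 ord0; rewrite eqxx (_ : true%:R = 1 :> R)// ler_norml => /andP[s1 s2].
have := sum_norm_le c nS0; rewrite ler_norml => /andP[s3 s4].
have : eta * \sum_j `|c j| <= 8^-1 * 2^-1 by rewrite ler_pM// sumr_ge0.
rewrite -/eta in s1 s2; have := eta_le8; move: s1 s2 s3 s4.
by move=> *; apply/andP; split; lra.
Qed.

(** [c - c'] solves the system with matrix [S] whose right-hand side, the change of the data, has
    size at most del + del / 2; the a priori estimate is applied with 2 del. The residual variance
    changes by three terms, each at most del. *)
Lemma near_id_regression_lipschitz S S' (c c' : 'I_n -> R) (del : R) :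
  near_id S -> near_id S' -> (forall i j, `|S i j - S' i j| <= del) ->
  (forall k, \sum_j c j * S (up j) (up k) = S ord0 (up k)) ->
  (forall k, \sum_j c' j * S' (up j) (up k) = S' ord0 (up k)) ->
  \sum_j `|c' j| <= 2^-1 ->
  \sum_j `|c j - c' j| <= 4 * n%:R * del /\
  `|residual_var S c - residual_var S' c'| <= 3 * del.
Proof.
move=> nS nS' SS' cS cS' c1.
have del0 : 0 <= del by apply: le_trans (SS' ord0 ord0).
have nSup i j : `|S (up i) (up j) - (i == j)%:R| <= eta by rewrite -eq_up; exact: nS.
have nS0 k : `|S ord0 (up k)| <= eta by have := nS ord0 (up k); rewrite subr0.
have cc : \sum_j `|c j - c' j| <= 4 * n%:R * del.
  have -> : 4 * n%:R * del = 2 * n%:R * (2 * del) by ring.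
  apply: (near_id_solution_le eta_ge0 eta_n nSup) => k.
  have -> : \sum_j (c j - c' j) * S (up j) (up k) =
      (S ord0 (up k) - S' ord0 (up k)) -
      \sum_j c' j * (S (up j) (up k) - S' (up j) (up k)).
    rewrite -cS -cS' -!sumrB; apply: eq_bigr => j _; ring.
  rewrite (le_trans (ler_normB _ _))//.
  have -> : 2 * del = del + del by ring.
  rewrite lerD// (le_trans (sum_norm_le c' (fun j => SS' (up j) (up k))))//.
  by have : del * \sum_j `|c' j| <= del * 2^-1 by [rewrite ler_wpM2l]; lra.
split=> //; rewrite /residual_var.
have -> : S ord0 ord0 - \sum_j c j * S ord0 (up j) -
    (S' ord0 ord0 - \sum_j c' j * S' ord0 (up j)) =
  (S ord0 ord0 - S' ord0 ord0) - \sum_j (c j - c' j) * S ord0 (up j)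
  - \sum_j c' j * (S ord0 (up j) - S' ord0 (up j)).
  have -> : \sum_j (c j - c' j) * S ord0 (up j) =
      \sum_j c j * S ord0 (up j) - \sum_j c' j * S ord0 (up j).
    by rewrite -sumrB; apply: eq_bigr => j _; ring.
  have -> : \sum_j c' j * (S ord0 (up j) - S' ord0 (up j)) =
      \sum_j c' j * S ord0 (up j) - \sum_j c' j * S' ord0 (up j).
    by rewrite -sumrB; apply: eq_bigr => j _; ring.
  by ring.
have -> : 3 * del = del + del + del by ring.
rewrite (le_trans (ler_normB _ _))// lerD//.
  rewrite (le_trans (ler_normB _ _))// lerD//.
  rewrite (le_trans (sum_norm_le (fun j => c j - c' j) nS0))//.
  have : eta * \sum_j `|c j - c' j| <= eta * (4 * n%:R * del) by rewrite ler_wpM2l.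
  have : n%:R * eta * del <= 4^-1 * del by rewrite ler_wpM2r.
  by lra.
rewrite (le_trans (sum_norm_le c' (fun j => SS' ord0 (up j))))//.
by have : del * \sum_j `|c' j| <= del * 2^-1 by [rewrite ler_wpM2l]; lra.
Qed.

End near_id_regression.

Lemma Rintegral_probability_cst d (T : measurableType d) (R : realType)
    (P : probability T R) (r : R) : \int[P]_w r = r.
Proof. by have := expectation_cst P r; rewrite unlock /Rintegral => ->. Qed.

Lemma Rintegral_sum d (T : measurableType d) (R : realType)
    (m : {measure set T -> \bar R}) (I : Type) (s : seq I) (f : I -> T -> R) :
  (forall i, m.-integrable setT (EFin \o f i)) ->
  \int[m]_w (\sum_(i <- s) f i w) = \sum_(i <- s) \int[m]_w f i w.
Proof.
move=> If; elim: s => [|i s IH].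
  by under eq_Rintegral do rewrite big_nil; rewrite Rintegral_cst// mul0r big_nil.
under eq_Rintegral do rewrite big_cons.
rewrite big_cons RintegralD// ?IH//.
rewrite (_ : _ \o _ = fun w => \sum_(i <- s) (f i w)%:E)%E; last first.
  by apply/funext => w /=; rewrite sumEFin.
by apply: integrable_sum => // j _; exact: If.
Qed.

Section gauss_vec_lipschitz.
Context {R : realType}.

(** The means differ by at most 4 n del s, s being the sum of the |y_j|. As del <= 1, the
    one-dimensional bound becomes del (3 + 4 n s) (16 + 8 n s); with q the sum of squares, s^2 <= n
    q and s <= 1 + n q give the coefficients 48, 88, 88 and 32. *)
Lemma cond_int_lipschitz n (F : n.+1.-tuple R -> R) (c c' : 'I_n -> R) (v v' del : R)
    (y : n.-tuple R) :
  measurable_fun setT F -> (forall x, 0 <= F x <= 1) ->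
  2^-1 <= v <= 2 -> 2^-1 <= v' <= 2 -> 0 <= del <= 1 ->
  \sum_j `|c j - c' j| <= 4 * n%:R * del -> `|v - v'| <= 3 * del ->
  `|cond_int F c v y - cond_int F c' v' y| <=
    del * (48 + 88 * n%:R + 88 * n%:R ^+ 2 + 32 * n%:R ^+ 3) * (1 + \sum_j tnth y j ^+ 2).
Proof.
move=> mF F01 v12 v12' /andP[d0 d1] cc vv.
apply: le_trans (integral_gauss_pdf_lipschitz _ _ (measurable_section mF y)
   (fun t => F01 _) v12 v12') _.
set q := \sum_j _; have q0 : 0 <= q by apply: sumr_ge0 => j _; exact: sqr_ge0.
pose s := \sum_j `|tnth y j|; have s0 : 0 <= s by apply: sumr_ge0.
have sq : s ^+ 2 <= n%:R * q by exact: sqr_sum_norm_le.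
have n0 : 0 <= n%:R :> R by [].
have mm : `|reg_mean c y - reg_mean c' y| <= 4 * n%:R * del * s.
  rewrite /reg_mean -sumrB (eq_bigr (fun j => (c j - c' j) * tnth y j)); last first.
    by move=> j _; rewrite mulrBl.
  have ys j : `|tnth y j| <= s by rewrite /s (bigD1 j)//= lerDl sumr_ge0.
  by rewrite (le_trans (sum_norm_le _ ys))// mulrC ler_wpM2r.
set D := `|reg_mean _ _ - _| in mm *; have D0 : 0 <= D by exact: normr_ge0.
set V := `|v - v'| in vv *; have V0 : 0 <= V by exact: normr_ge0.
apply: (@le_trans _ _ ((3 * del + 4 * n%:R * del * s) * (16 + 2 * (4 * n%:R * s)))).
  apply: ler_pM; rewrite ?addr_ge0 ?mulr_ge0 ?lerD//.
  rewrite ler_wpM2l// (le_trans mm)// -mulrA ler_wpM2l ?mulr_ge0// ler_piMl//.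
have -> : 3 * del + 4 * n%:R * del * s = del * (3 + 4 * n%:R * s) by ring.
rewrite -!mulrA ler_wpM2l//.
move: (n%:R : R) n0 sq => m m0 sq.
have h1 : m * s <= m * (1 + m * q).
  by rewrite ler_wpM2l//; have := sqr_ge0 (s - 1); rewrite sqrrB; nra.
have h2 : m ^+ 2 * s ^+ 2 <= m ^+ 2 * (m * q) by rewrite ler_wpM2l ?sqr_ge0.
have h3 : 0 <= m * q by rewrite mulr_ge0.
have h4 : 0 <= m ^+ 2 * q by rewrite mulr_ge0 ?sqr_ge0.
have h5 : 0 <= m ^+ 3 * q by rewrite mulr_ge0 ?exprn_ge0.
have h6 : 0 <= m ^+ 2 by rewrite sqr_ge0.
have h7 : 0 <= m ^+ 3 by rewrite exprn_ge0.
rewrite !exprS !expr0 !mulr1 in h2 h4 h5 h6 h7 *; lra.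
Qed.

(** The pointwise bound grows quadratically with the regressors; averaging it only costs their
    variances, each at most 2 near the identity. *)
Lemma gauss_vec_average_lipschitz d (T : measurableType d) (P : probability T R)
    n (Y : 'I_n -> T -> R) (S : 'I_n -> 'I_n -> R) (H H' : n.-tuple R -> R) (k : R) :
  gauss_vec P Y S -> near_id S -> 0 <= k ->
  measurable_fun setT H -> measurable_fun setT H' ->
  (forall x, 0 <= H x <= 1) -> (forall x, 0 <= H' x <= 1) ->
  (forall y, `|H y - H' y| <= k * (1 + \sum_j tnth y j ^+ 2)) ->
  `|\int[P]_w H (tuple_of_fam Y w) - \int[P]_w H' (tuple_of_fam Y w)| <= k * (1 + 2 * n%:R).
Proof.
move=> gY nS k0 mH mH' H01 H01' HH'; have [mY _] := gY.
have mtY := measurable_tuple_of_fam mY.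
have iH (h : n.-tuple R -> R) : measurable_fun setT h -> (forall x, 0 <= h x <= 1) ->
    P.-integrable setT (EFin \o (fun w => h (tuple_of_fam Y w))).
  move=> mh h01; apply: (@bounded_integrable R _ T P _ 1 (measurableT_comp mh mtY)) => w.
  by case/andP: (h01 (tuple_of_fam Y w)) => ? ?; rewrite /= ger0_norm.
have i1 := iH _ mH H01; have i2 := iH _ mH' H01'.
have iHB : P.-integrable setT
    (EFin \o (fun w => H (tuple_of_fam Y w) - H' (tuple_of_fam Y w))).
  exact: (integrableB measurableT i1 i2).
rewrite -(RintegralB measurableT i1 i2).
apply: le_trans (le_normr_Rintegral measurableT iHB) _.
pose q w := \sum_j Y j w ^+ 2.
have nYj j : is_normal P (Y j) 0 (S j j) by exact: (gauss_vec_coord j gY).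
have iq : P.-integrable setT (EFin \o q).
  rewrite (_ : _ \o _ = fun w => \sum_j (Y j w ^+ 2)%:E)%E; last first.
    by apply/funext => w /=; rewrite /q sumEFin.
  by apply: integrable_sum => // j _; exact: (is_normal_integrable (mY j) (nYj j)).
have ic1 : P.-integrable setT (EFin \o (cst (1 : R))).
  by apply: (@bounded_integrable R _ T P (cst 1) 1) => // w; rewrite normr1.
have i1q : P.-integrable setT (EFin \o (fun w => 1 + q w)).
  exact: (integrableD measurableT ic1 iq).
apply: (@le_trans _ _ (\int[P]_w (k * (1 + q w)))).
  apply: (le_Rintegral measurableT (integrable_norm iHB) (integrableZl measurableT k i1q)).
  move=> w _; apply: le_trans (HH' _) _.
  by under eq_bigr do rewrite tnth_mktuple.
rewrite (RintegralZl _ measurableT i1q) ler_wpM2l//.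
rewrite (RintegralD measurableT ic1 iq) Rintegral_probability_cst lerD2l.
rewrite (Rintegral_sum _ (fun j => is_normal_integrable (mY j) (nYj j) (isT : 2 <= 4)%N)).
rewrite (eq_bigr (fun j => S j j)); last first.
  by move=> j _; rewrite (is_normal_moment2 (mY j) (nYj j)).
rewrite (@le_trans _ _ (\sum_(j < n) 2))//; last first.
  by rewrite sumr_const card_ord mulr_natr.
apply: ler_sum => j _; have := nS j j.
rewrite eqxx (_ : true%:R = 1 :> R)// ler_norml => /andP[_].
rewrite lerBlDr => /le_trans; apply.
have : (4 * n.+1%:R)^-1 <= 1 :> R by rewrite invf_le1 ?mulr_gt0// -natrM ler1n.
by move: (4 * n.+1%:R)^-1 => e; lra.
Qed.

(* Induction on the dimension: conditionally on the other coordinates, the first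
   one is normal with mean and variance depending on the covariances in a
   Lipschitz way. *)
Lemma gauss_vec_lipschitz n : exists2 C : R, 0 <= C &
  forall d (T : measurableType d) (P : probability T R) (Y : 'I_n -> T -> R)
    d' (T' : measurableType d') (Q : probability T' R) (Z : 'I_n -> T' -> R)
    (S S' : 'I_n -> 'I_n -> R) (del : R) (F : n.-tuple R -> R),
  gauss_vec P Y S -> gauss_vec Q Z S' ->
  (forall i j, S i j = S j i) -> (forall i j, S' i j = S' j i) ->
  near_id S -> near_id S' -> 0 <= del <= 1 -> (forall i j, `|S i j - S' i j| <= del) ->
  measurable_fun setT F -> (forall x, 0 <= F x <= 1) ->
  `|\int[P]_w F (tuple_of_fam Y w) - \int[Q]_w F (tuple_of_fam Z w)| <= C * del.
Proof.
elim: n => [|n [C C0 IH]].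
  exists 0 => // d T P Y d' T' Q Z S S' del F _ _ _ _ _ _ _ _ mF F01.
  have E d0 (T0 : measurableType d0) (P0 : probability T0 R) (Y0 : 'I_0 -> T0 -> R) :
      \int[P0]_w F (tuple_of_fam Y0 w) = F [tuple of [::]].
    under eq_Rintegral do rewrite [tuple_of_fam _ _]tuple0.
    by rewrite Rintegral_probability_cst.
  by rewrite !E subrr normr0 mul0r.
pose Ct : R := 48 + 88 * n%:R + 88 * n%:R ^+ 2 + 32 * n%:R ^+ 3.
have Ct0 : 0 <= Ct by rewrite !addr_ge0 ?mulr_ge0 ?exprn_ge0.
exists (Ct * (1 + 2 * n%:R) + C).
  by rewrite addr_ge0 ?mulr_ge0 ?addr_ge0 ?mulr_ge0.
move=> d T P Y d' T' Q Z S S' del F gY gZ sS sS' nS nS' del01 SS' mF F01.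
have [c [cS c1 v12]] := near_id_regression nS.
have [c' [cS' c1' v12']] := near_id_regression nS'.
have [cc vv] := near_id_regression_lipschitz nS nS' SS' cS cS' c1'.
have v0 : 0 < residual_var S c by case/andP: v12 => + _; apply: lt_le_trans; rewrite invr_gt0.
have v0' : 0 < residual_var S' c' by case/andP: v12' => + _; apply: lt_le_trans; rewrite invr_gt0.
rewrite (regression_integral gY sS cS mF F01 v0) (regression_integral gZ sS' cS' mF F01 v0').
set v := residual_var S c in v12 vv v0 *; set v' := residual_var S' c' in v12' vv v0' *.
have gYu := gauss_vec_up gY sS cS; have gZu := gauss_vec_up gZ sS' cS'.
set Y' := Y \o lift ord0 in gYu *; set Z' := Z \o lift ord0 in gZu *.
have [mY' _] := gYu; have [mZ' _] := gZu.
pose H := cond_int F c v; pose H' := cond_int F c' v'.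
have mH : measurable_fun setT H by exact: measurable_cond_int.
have mH' : measurable_fun setT H' by exact: measurable_cond_int.
have H01 : forall x, 0 <= H x <= 1 := cond_int01 c v mF F01.
have H01' : forall x, 0 <= H' x <= 1 := cond_int01 c' v' mF F01.
have HH' y : `|H y - H' y| <= del * Ct * (1 + \sum_j tnth y j ^+ 2).
  exact: cond_int_lipschitz.
have dCt : 0 <= del * Ct by rewrite mulr_ge0//; case/andP: del01.
(* The intermediate term is [H'] averaged under the first law: [A1] changes the conditional law,
   [A2] the law of the remaining coordinates. [H'] need not be an indicator, which is why [F] ranges
   over all functions into [0, 1]. *)
have A1 := gauss_vec_average_lipschitz gYu (near_id_up nS) dCt mH mH' H01 H01' HH'.
have A2 := IH _ _ _ _ _ _ _ _ _ _ _ _ gYu gZu (fun i j => sS _ _) (fun i j => sS' _ _)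
    (near_id_up nS) (near_id_up nS') del01 (fun i j => SS' _ _) mH' H01'.
have -> : (Ct * (1 + 2 * n%:R) + C) * del = del * Ct * (1 + 2 * n%:R) + C * del by ring.
by apply: le_trans (lerD A1 A2); apply: le_trans (ler_normD _ _); rewrite addrA subrK.
Qed.

End gauss_vec_lipschitz.

(** * Gaussian families and quadratic forms *)

Lemma is_normal_center d (T : measurableType d) (R : realType) (P : probability T R)
    (Y : T -> R) (m v : R) :
  is_normal P Y m v -> is_normal P (fun w => Y w - m) 0 v.
Proof.
move=> [v0 nY]; split=> // A mA.
have ms : measurable_fun setT (fun y : R => y - m) by exact: measurable_funB.
have mA' : measurable [set y : R | A (y - m)].
  by have := ms measurableT _ mA; rewrite setTI.
apply: etrans (nY _ mA') _; rewrite /normal_law.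
case: ifPn => [_|v_neq0].
  rewrite !diracE; congr ((nat_of_bool _)%:R%:E).
  by apply/idP/idP; rewrite !inE/= subrr.
have vgt0 : 0 < v by rewrite lt_neqAle eq_sym v_neq0.
rewrite /normal_prob [LHS]integral_mkcond [RHS]integral_mkcond.
rewrite -[LHS](ge0_integral_translate m).
- apply: eq_integral => x _; rewrite /= !patchE addrC.
  rewrite (_ : (x + m \in [set y | A (y - m)]) = (x \in A)); last first.
    by apply/idP/idP; rewrite !inE/= addrK.
  case: ifP => // _; congr EFin.
  have := gauss_pdf_shift 0 (x + m) m vgt0; rewrite add0r addrK.
  by rewrite /gauss_pdf.
- apply/(measurable_restrictT _ _).1 => //; apply: measurable_funTS.
  by apply/measurable_EFinP; exact: measurable_normal_pdf.
- by move=> x; rewrite patchE; case: ifP => // _; rewrite lee_fin normal_pdf_ge0.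
Qed.

(** The map [t] may repeat indices, as Wick's formula with coinciding factors requires. *)
Definition gauss_family d (T : measurableType d) (R : realType)
    (P : probability T R) (I : Type) (U : I -> T -> R) (s : I -> I -> R) : Prop :=
  forall n (t : 'I_n -> I), gauss_vec P (fun i => U (t i)) (fun i j => s (t i) (t j)).

Section moments.
Context d (T : measurableType d) (R : realType) (P : probability T R).

Lemma integrable_mul (f g : T -> R) :
  measurable_fun setT f -> measurable_fun setT g ->
  P.-integrable setT (fun w => (f w ^+ 2)%:E) ->
  P.-integrable setT (fun w => (g w ^+ 2)%:E) ->
  P.-integrable setT (fun w => (f w * g w)%:E).
Proof.
move=> mf mg f2 g2.
apply: (le_integrable measurableT _ _ (integrableD measurableT f2 g2)).
  by apply/measurable_EFinP; exact: measurable_funM.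
move=> w _; rewrite -EFinD lee_fin [leRHS]ger0_norm ?addr_ge0 ?sqr_ge0//.
rewrite ler_norml; have := sqr_ge0 (f w - g w); have := sqr_ge0 (f w + g w).
have := sqr_ge0 (f w); have := sqr_ge0 (g w).
by move=> *; apply/andP; split; lra.
Qed.

Lemma Rintegral_lincomb (I : Type) (s : seq I) (a : I -> R) (f : I -> T -> R) :
  (forall i, P.-integrable setT (EFin \o f i)) ->
  \int[P]_w (\sum_(i <- s) a i * f i w) = \sum_(i <- s) a i * \int[P]_w f i w.
Proof.
move=> If; rewrite (@Rintegral_sum _ _ _ P _ s (fun i w => a i * f i w)); last first.
  by move=> i; exact: (integrableZl measurableT (a i) (If i)).
by apply: eq_bigr => i _; rewrite (RintegralZl _ measurableT (If i)).
Qed.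
End moments.

Section stationary.
Context d (T : measurableType d) (R : realType) (P : probability T R).
Context (X : int -> {mfun T >-> R}) (m : R) (gamma : int -> R).
Hypotheses (gX : gaussian_series P X) (sX : stationary_with P X m gamma).

Let U i w := X i w - m.

Let mU i : measurable_fun setT (U i).
Proof. exact: measurable_funB. Qed.

Lemma stationary_cov i j : \int[P]_w (U i w * U j w) = gamma (i - j).
Proof.
have [EX /(_ j (i - j))] := sX; rewrite addrC subrK covariance.unlock !EX expectation.unlock.
by rewrite /Rintegral => /(congr1 fine).
Qed.

Lemma stationary_cov_even h : gamma (- h) = gamma h.
Proof.
have := stationary_cov h 0; rewrite subr0 => <-.
have := stationary_cov 0 h; rewrite sub0r => <-.
by apply: eq_Rintegral => w _; rewrite mulrC.
Qed.

(** [gaussian_series] only asserts that some mean vector and some matrix exist. The means are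
    identified by testing single coordinates, the variance of a linear form by expanding its second
    moment with [gamma]. *)
Lemma gaussian_stationary : gauss_family P U (fun i j => gamma (i - j)).
Proof.
move=> n t; split=> [i|a]; first exact: mU.
have [mm [Sig nX]] := gX t.
pose W (b : 'I_n -> R) w := \sum_i b i * X (t i) w - \sum_i b i * mm 0 i.
have mW b : measurable_fun setT (W b).
  apply: measurable_funB => //; apply: measurable_sum => i.
  exact: measurable_funM.
have nW b : exists v, is_normal P (W b) 0 v.
  exists (((\row_i b i) *m Sig *m (\row_i b i)^T) 0 0).
  have := is_normal_center (nX (\row_i b i)); congr is_normal.
  apply/funext => w; rewrite /W; congr (_ - _); apply: eq_bigr => i _; by rewrite mxE.
have W1 i w : W (fun j => (j == i)%:R) w = X (t i) w - mm 0 i.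
  have del (f : 'I_n -> R) : \sum_j (j == i)%:R * f j = f i.
    rewrite (bigD1 i)//= eqxx mul1r big1 ?addr0// => j /negbTE ->.
    by rewrite mul0r.
  by rewrite /W (del (fun j => X (t j) w)) del.
have mmE i : mm 0 i = m.
  have [v nv] := nW (fun j => (j == i)%:R).
  have := is_normal_mean (mW _) nv.
  have iW := is_normal_integrable (mW _) nv (isT : 1 <= 4)%N.
  move=> W0; have [EX _] := sX; have := EX (t i); rewrite expectation.unlock => /(congr1 fine) /= <-.
  have ic : P.-integrable setT (EFin \o (cst (mm 0 i))).
    exact: (@bounded_integrable R _ T P (cst (mm 0 i)) `|mm 0 i|).
  have := RintegralD measurableT iW ic; rewrite W0 Rintegral_probability_cst add0r => <-.
  by apply: eq_Rintegral => w _; rewrite /= W1 subrK.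
have WE b w : W b w = \sum_i b i * U (t i) w.
  rewrite /W -sumrB; apply: eq_bigr => i _; rewrite mmE /U; ring.
have iU i : P.-integrable setT (fun w => (U (t i) w ^+ 2)%:E).
  have [v nv] := nW (fun j => (j == i)%:R).
  have := is_normal_integrable (mW _) nv (isT : 2 <= 4)%N.
  by apply: eq_integrable => // w _; rewrite W1 mmE.
have [v nv] := nW a; have := is_normal_moment2 (mW a) nv.
have -> : \int[P]_w (W a w ^+ 2) = \sum_i \sum_j a i * a j * gamma (t i - t j).
  have iUU i j : P.-integrable setT (EFin \o (fun w => U (t i) w * U (t j) w)).
    exact: (integrable_mul (mU (t i)) (mU (t j)) (iU i) (iU j)).
  have iS i : P.-integrable setT (EFin \o (fun w => \sum_j a j * (U (t i) w * U (t j) w))).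
    rewrite (_ : _ \o _ = fun w => \sum_j (a j * (U (t i) w * U (t j) w))%:E)%E; last first.
      by apply/funext => w /=; rewrite sumEFin.
    by apply: integrable_sum => // j _; exact: (integrableZl measurableT (a j) (iUU i j)).
  transitivity (\int[P]_w (\sum_i a i * (\sum_j a j * (U (t i) w * U (t j) w)))).
    apply: eq_Rintegral => w _; rewrite WE expr2 mulr_suml; apply: eq_bigr => i _.
    rewrite -mulrA; congr (_ * _); rewrite mulr_sumr; apply: eq_bigr => j _; ring.
  rewrite (Rintegral_lincomb _ _ iS); apply: eq_bigr => i _.
  rewrite (Rintegral_lincomb _ _ (iUU i)) mulr_sumr; apply: eq_bigr => j _.
  by rewrite stationary_cov mulrA.
move=> ve; rewrite ve; have := nv; congr is_normal.
by apply/funext => w; rewrite WE.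
Qed.

End stationary.

(** * Wick's formula for products of four Gaussian variables *)

Section wick.
Context d (T : measurableType d) (R : realType) (P : probability T R).
Context (I : Type) (U : I -> T -> R) (s : I -> I -> R).
Hypotheses (gU : gauss_family P U s) (symS : forall i j, s i j = s j i).

Let mU i : measurable_fun setT (U i).
Proof. by have [/(_ ord0)] := gU (fun=> i : I) (n := 1). Qed.

(** Signs of the last three variables relative to the first. Each fourth power contains x1 x2 x3 x4
    with coefficient 4! times the product of signs, and there are 8 of them, whence 1/192 below. *)
Let signs : seq (R * R * R) :=
  [:: (1, 1, 1); (1, 1, -1); (1, -1, 1); (1, -1, -1);
      (-1, 1, 1); (-1, 1, -1); (-1, -1, 1); (-1, -1, -1)].

(* polarization: only the monomial [x1 x2 x3 x4] is odd in each of [x2], [x3] and [x4] *)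
Let polarization (x1 x2 x3 x4 : R) : x1 * x2 * x3 * x4 =
  \sum_(e <- signs) (192^-1 * (e.1.1 * e.1.2 * e.2)) *
    (x1 + e.1.1 * x2 + e.1.2 * x3 + e.2 * x4) ^+ 4.
Proof. by rewrite /signs !big_cons big_nil /=; field. Qed.

Let normal4 i j k l (e : R * R * R) :
  is_normal P (fun w => U i w + e.1.1 * U j w + e.1.2 * U k w + e.2 * U l w) 0
   (s i i + e.1.1 ^+ 2 * s j j + e.1.2 ^+ 2 * s k k + e.2 ^+ 2 * s l l +
    2 * (e.1.1 * s i j + e.1.2 * s i k + e.2 * s i l + e.1.1 * e.1.2 * s j k +
      e.1.1 * e.2 * s j l + e.1.2 * e.2 * s k l)).
Proof.
have [_] := gU (fun x : 'I_4 => nth i [:: i; j; k; l] x).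
move=> /(_ (fun x : 'I_4 => nth 0 [:: 1; e.1.1; e.1.2; e.2] x)).
congr is_normal.
  by apply/funext => w; rewrite !big_ord_recl big_ord0/=; ring.
rewrite !big_ord_recl !big_ord0/=.
by rewrite [s j i]symS [s k i]symS [s l i]symS [s k j]symS [s l j]symS [s l k]symS; ring.
Qed.

Let m4 i j k l (e : R * R * R) :
  measurable_fun setT (fun w => U i w + e.1.1 * U j w + e.1.2 * U k w + e.2 * U l w).
Proof. by do ![apply: measurable_funD => //|apply: measurable_funM => //]. Qed.

Let i4 i j k l (e : R * R * R) : P.-integrable setT
  (EFin \o (fun w => (U i w + e.1.1 * U j w + e.1.2 * U k w + e.2 * U l w) ^+ 4)).
Proof. exact: (is_normal_integrable (m4 i j k l e) (normal4 i j k l e) (isT : 4 <= 4)%N). Qed.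

Lemma integrable_wick i j k l :
  P.-integrable setT (EFin \o (fun w => U i w * U j w * U k w * U l w)).
Proof.
rewrite (_ : _ \o _ = fun w => \sum_(e <- signs) ((192^-1 * (e.1.1 * e.1.2 * e.2)) *
    (U i w + e.1.1 * U j w + e.1.2 * U k w + e.2 * U l w) ^+ 4)%:E)%E; last first.
  by apply/funext => w /=; rewrite polarization sumEFin.
apply: integrable_sum => // e _.
exact: (integrableZl measurableT _ (i4 i j k l e)).
Qed.

Lemma wick i j k l : \int[P]_w (U i w * U j w * U k w * U l w) =
  s i j * s k l + s i k * s j l + s i l * s j k.
Proof.
under eq_Rintegral do rewrite polarization.
rewrite (Rintegral_lincomb _ _ (i4 i j k l)).
under eq_bigr do rewrite (is_normal_moment4 (m4 i j k l _) (normal4 i j k l _)).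
by rewrite /signs !big_cons big_nil /=; field.
Qed.

Lemma integrable_gauss_mul i j : P.-integrable setT (EFin \o (fun w => U i w * U j w)).
Proof.
have n1 k : is_normal P (U k) 0 (s k k).
  exact: (gauss_vec_coord ord0 (gU (fun x : 'I_1 => k))).
exact: (integrable_mul (mU i) (mU j)
  (is_normal_integrable (mU i) (n1 i) (isT : 2 <= 4)%N)
  (is_normal_integrable (mU j) (n1 j) (isT : 2 <= 4)%N)).
Qed.

Lemma gauss_cov i j : \int[P]_w (U i w * U j w) = s i j.
Proof.
pose t (x : 'I_2) := if x == ord0 then i else j.
have [_ nt] := gU t.
have nij e : is_normal P (fun w => U i w + e * U j w) 0 (s i i + e ^+ 2 * s j j + 2 * e * s i j).
  have := nt (fun x : 'I_2 => if x == ord0 then 1 else e); congr is_normal.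
    by apply/funext => w; rewrite !big_ord_recl big_ord0 /t /=; ring.
  by rewrite !big_ord_recl !big_ord0 /t /= [s j i]symS; ring.
have mij e : measurable_fun setT (fun w => U i w + e * U j w).
  by apply: measurable_funD => //; exact: measurable_funM.
have iij e : P.-integrable setT (EFin \o (fun w => (U i w + e * U j w) ^+ 2)).
  exact: (is_normal_integrable (mij e) (nij e) (isT : 2 <= 4)%N).
have -> : \int[P]_w (U i w * U j w) =
    \int[P]_w (\sum_(e <- [:: 1; -1]) 4^-1 * e * (U i w + e * U j w) ^+ 2).
  by apply: eq_Rintegral => w _; rewrite !big_cons big_nil; field.
rewrite (Rintegral_lincomb _ _ iij) !big_cons big_nil.
by rewrite !(is_normal_moment2 (mij _) (nij _)); field.
Qed.

End wick.

Section quadratic_form.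
Context d (T : measurableType d) (R : realType) (P : probability T R).
Context (J : finType) (I : Type) (U : I -> T -> R) (s : I -> I -> R) (t : J -> I).
Hypotheses (gU : gauss_family P U s) (symS : forall i j, s i j = s j i).
Variable w : J -> J -> R.

Let u j x := U (t j) x.
Let c i j := s (t i) (t j).
Let q x := \sum_i \sum_j w i j * (u i x * u j x).

Variable G : R.
Hypothesis sG : forall i, \sum_j `|c i j| <= G.

(* the covariance of [u_i u_j] and [u_k u_l] is [c_ik c_jl + c_il c_jk] *)
Lemma quadratic_form_variance :
  P.-integrable setT (EFin \o (fun x => (q x - \sum_i \sum_j w i j * c i j) ^+ 2)) /\
  \int[P]_x ((q x - \sum_i \sum_j w i j * c i j) ^+ 2) <=
    2 * G ^+ 2 * \sum_i \sum_j w i j ^+ 2.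
Proof.
pose z (p : J * J) x := u p.1 x * u p.2 x - c p.1 p.2.
have qE x : (q x - \sum_i \sum_j w i j * c i j) ^+ 2 =
    \sum_(pp : (J * J) * (J * J)) (w pp.1.1 pp.1.2 * w pp.2.1 pp.2.2) * (z pp.1 x * z pp.2 x).
  have -> : q x - \sum_i \sum_j w i j * c i j = \sum_(p : J * J) w p.1 p.2 * z p x.
    rewrite /q !pair_bigA/= -sumrB; apply: eq_bigr => p _; rewrite /z; ring.
  rewrite expr2 mulr_suml -(pair_bigA _ (fun p p' => (w p.1 p.2 * w p'.1 p'.2) * (z p x * z p' x)))/=.
  apply: eq_bigr => p _; rewrite mulr_sumr; apply: eq_bigr => p' _; ring.
have i1 p p' : P.-integrable setT (EFin \o (fun x => u p.1 x * u p.2 x * u p'.1 x * u p'.2 x)).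
  exact: (integrable_wick gU symS (t p.1) (t p.2) (t p'.1) (t p'.2)).
have i2 i j : P.-integrable setT (EFin \o (fun x => u i x * u j x)).
  exact: (integrable_gauss_mul gU (t i) (t j)).
have ic (k : R) : P.-integrable setT (EFin \o (cst k)).
  exact: (@bounded_integrable R _ T P (cst k) `|k|).
pose rest (p p' : J * J) x := c p'.1 p'.2 * (u p.1 x * u p.2 x) +
   c p.1 p.2 * (u p'.1 x * u p'.2 x).
have ir p p' : P.-integrable setT (EFin \o rest p p').
  exact: (integrableD measurableT (integrableZl measurableT _ (i2 _ _))
    (integrableZl measurableT _ (i2 _ _))).
have iBr p p' : P.-integrable setT (EFin \o
    (fun x => u p.1 x * u p.2 x * u p'.1 x * u p'.2 x - rest p p' x)).
  exact: (integrableB measurableT (i1 p p') (ir p p')).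
have zE p p' x : z p x * z p' x =
    (u p.1 x * u p.2 x * u p'.1 x * u p'.2 x - rest p p' x) + c p.1 p.2 * c p'.1 p'.2.
  by rewrite /z /rest; ring.
have iz p p' : P.-integrable setT (EFin \o (fun x => z p x * z p' x)).
  rewrite (_ : (fun x => _) = (fun x =>
    (u p.1 x * u p.2 x * u p'.1 x * u p'.2 x - rest p p' x) + c p.1 p.2 * c p'.1 p'.2)).
    exact: (integrableD measurableT (iBr p p') (ic _)).
  by apply/funext => x; exact: zE.
have Ez p p' : \int[P]_x (z p x * z p' x) =
    c p.1 p'.1 * c p.2 p'.2 + c p.1 p'.2 * c p.2 p'.1.
  under eq_Rintegral do rewrite zE.
  rewrite (RintegralD measurableT (iBr p p') (ic _)).
  rewrite (RintegralB measurableT (i1 p p') (ir p p')).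
  rewrite (RintegralD measurableT (integrableZl measurableT (c p'.1 p'.2) (i2 _ _))
    (integrableZl measurableT (c p.1 p.2) (i2 _ _))).
  have -> : \int[P]_x (c p.1 p.2 * c p'.1 p'.2) = c p.1 p.2 * c p'.1 p'.2.
    exact: Rintegral_probability_cst.
  rewrite !(RintegralZl _ measurableT (i2 _ _)).
  rewrite (wick gU symS) !(gauss_cov gU symS) /c; ring.
split.
  rewrite (_ : _ \o _ = fun x => \sum_(pp : (J * J) * (J * J))
    ((w pp.1.1 pp.1.2 * w pp.2.1 pp.2.2) * (z pp.1 x * z pp.2 x))%:E)%E; last first.
    by apply/funext => x /=; rewrite qE sumEFin.
  by apply: integrable_sum => // pp _; exact: (integrableZl measurableT _ (iz _ _)).
under eq_Rintegral do rewrite qE.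
rewrite (Rintegral_lincomb _ (fun pp : (J * J) * (J * J) => w pp.1.1 pp.1.2 * w pp.2.1 pp.2.2)
  (fun pp => iz pp.1 pp.2)).
rewrite -(pair_bigA _ (fun p p' => (w p.1 p.2 * w p'.1 p'.2) * \int[P]_x (z p x * z p' x)))/=.
pose Y p p' := `|c p.1 p'.1| * `|c p.2 p'.2| + `|c p.1 p'.2| * `|c p.2 p'.1|.
have Y0 p p' : 0 <= Y p p' by rewrite addr_ge0 ?mulr_ge0.
have symY p p' : Y p p' = Y p' p.
  rewrite /Y /c (symS (t p.1) (t p'.1)) (symS (t p.2) (t p'.2)).
  by rewrite (symS (t p.1) (t p'.2)) (symS (t p.2) (t p'.1)) [X in _ + X]mulrC.
have sY p : \sum_p' Y p p' <= 2 * G ^+ 2.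
  have prod i j : \sum_(k : J) \sum_(l : J) `|c i k| * `|c j l| <= G ^+ 2.
    under eq_bigr do rewrite -mulr_sumr.
    by rewrite -mulr_suml expr2 ler_pM ?sumr_ge0.
  rewrite /Y big_split/= mulr_natl mulr2n lerD//.
    by rewrite -(pair_bigA _ (fun k l => `|c p.1 k| * `|c p.2 l|))/=; exact: prod.
  rewrite -(pair_bigA _ (fun k l => `|c p.1 l| * `|c p.2 k|))/= exchange_big/=.
  exact: prod.
rewrite (pair_bigA _ (fun i j => w i j ^+ 2))/=.
pose W (p : J * J) := w p.1 p.2.
(* Schur's test: 2 |W_p W_p'| <= W_p^2 + W_p'^2, and the row sums of the symmetric kernel [Y] are at
   most 2 G^2. *)
apply: (@le_trans _ _ (\sum_p \sum_p' (W p ^+ 2 / 2 * Y p p' + W p' ^+ 2 / 2 * Y p' p))).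
  apply: ler_sum => p _; apply: ler_sum => p' _; rewrite Ez -(symY p p') -mulrDl.
  apply: le_trans (ler_norm _) _; rewrite normrM; apply: ler_pM => //.
    rewrite normrM -/(W p) -/(W p').
    rewrite -(real_normK (num_real (W p))) -(real_normK (num_real (W p'))).
    have := sqr_ge0 (`|W p| - `|W p'|); rewrite sqrrB.
    by move: (`|W p| : R) (`|W p'| : R) => a b; rewrite -mulr_natr; lra.
  by rewrite (le_trans (ler_normD _ _))// !normrM.
rewrite (eq_bigr (fun p => \sum_p' W p ^+ 2 / 2 * Y p p' +
  \sum_p' W p' ^+ 2 / 2 * Y p' p)); last by move=> p _; rewrite big_split.
rewrite big_split/= [X in _ + X]exchange_big/=.
have half : \sum_p \sum_p' W p ^+ 2 / 2 * Y p p' <= G ^+ 2 * \sum_p W p ^+ 2.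
  rewrite mulr_sumr; apply: ler_sum => p _; rewrite -mulr_sumr.
  rewrite (le_trans (ler_wpM2l _ (sY p)))// ?divr_ge0 ?sqr_ge0//.
  by rewrite le_eqVlt; apply/orP; left; apply/eqP; field.
by rewrite -mulrA mulr_natl mulr2n lerD.
Qed.

End quadratic_form.

(** * Lag sums and covariances of the group sums *)

Section isum.
Context {R : realType}.
Implicit Types (f g r : int -> R) (m : nat).

(** Pairing h with -h turns symmetric partial sums into an ordinary series, and an induction on m
    extends both ends at once. *)
Definition isum m f : R := f 0 + \sum_(h < m) (f h.+1%:Z + f (- h.+1%:Z)).

Lemma isumS m f : isum m.+1 f = isum m f + (f m.+1%:Z + f (- m.+1%:Z)).
Proof. by rewrite /isum big_ord_recr addrA. Qed.

Lemma isum_shift m f : \sum_(i < m.*2.+1) f (i%:Z - m%:Z) = isum m f.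
Proof.
elim: m => [|m IH]; first by rewrite big_ord_recl big_ord0 /isum big_ord0 subr0.
rewrite doubleS big_ord_recl big_ord_recr isumS -IH sub0r /=.
rewrite [LHS]addrC -addrA; congr (_ + (_ + _)).
- by apply: eq_bigr => i _; congr f; rewrite /bump/=; lia.
- by congr f; rewrite /bump/=; lia.
Qed.

Lemma eq_isum m f g : (forall h, (`|h| <= m)%N -> f h = g h) -> isum m f = isum m g.
Proof.
move=> fg; rewrite /isum fg//; congr (_ + _); apply: eq_bigr => h _.
by rewrite !fg// ?abszN/= ltn_ord.
Qed.

Lemma isumD m f g : isum m (fun h => f h + g h) = isum m f + isum m g.
Proof.
rewrite /isum (eq_bigr (fun h : 'I_m => (f h.+1%:Z + f (- h.+1%:Z)) +
  (g h.+1%:Z + g (- h.+1%:Z)))); last by move=> h _; ring.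
by rewrite big_split/=; ring.
Qed.

Lemma isumZ m f (k : R) : isum m (fun h => k * f h) = k * isum m f.
Proof. by rewrite /isum mulrDr mulr_sumr; congr (_ + _); apply: eq_bigr => h _; ring. Qed.

Lemma isumB m f g : isum m (fun h => f h - g h) = isum m f - isum m g.
Proof.
have -> : isum m (fun h => f h - g h) = isum m (fun h => f h + -1 * g h).
  by apply: eq_isum => h _; rewrite mulN1r.
by rewrite isumD isumZ mulN1r.
Qed.

Lemma le_isum m f g : (forall h, (`|h| <= m)%N -> f h <= g h) -> isum m f <= isum m g.
Proof.
move=> fg; rewrite /isum lerD ?fg// ler_sum// => h _.
by rewrite lerD// fg// ?abszN/= ltn_ord.
Qed.

Lemma ler_norm_isum m f : `|isum m f| <= isum m (fun h => `|f h|).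
Proof.
rewrite /isum (le_trans (ler_normD _ _))// lerD// (le_trans (ler_norm_sum _ _ _))//.
by apply: ler_sum => h _; exact: ler_normD.
Qed.

Lemma isum_exchange (I : Type) (s : seq I) m (f : I -> int -> R) :
  \sum_(i <- s) isum m (f i) = isum m (fun h => \sum_(i <- s) f i h).
Proof.
rewrite /isum big_split/=; congr (_ + _); rewrite exchange_big/=.
by apply: eq_bigr => h _; rewrite big_split.
Qed.

Lemma isum_delta m f (k : int) : (`|k| <= m)%N ->
  isum m (fun h => (h == k)%:R * f h) = f k.
Proof.
elim: m => [|m IH].
  by rewrite leqn0 absz_eq0 => /eqP ->; rewrite /isum big_ord0 eqxx mul1r addr0.
rewrite leq_eqVlt isumS => /orP[/eqP km|].
  have -> : isum m (fun h => (h == k)%:R * f h) = 0.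
    rewrite -[RHS](mul0r (isum m f)) -isumZ; apply: eq_isum => h hm.
    by rewrite (_ : (h == k) = false)//; apply/eqP; lia.
  have [->|->] : k = m.+1%:Z \/ k = - m.+1%:Z by lia.
    by rewrite eqxx (_ : (- m.+1%:Z == m.+1%:Z) = false) ?mul0r ?addr0 ?add0r ?mul1r//;
       apply/eqP; lia.
  by rewrite eqxx (_ : (m.+1%:Z == - m.+1%:Z) = false) ?mul0r ?addr0 ?add0r ?mul1r//;
     apply/eqP; lia.
rewrite ltnS => km; rewrite IH//.
rewrite (_ : (m.+1%:Z == k) = false); last by apply/eqP; lia.
rewrite (_ : (- m.+1%:Z == k) = false); last by apply/eqP; lia.
by rewrite !mul0r !addr0.
Qed.

Lemma isum_support m n f : (m <= n)%N -> (forall h, (m < `|h|)%N -> f h = 0) ->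
  isum n f = isum m f.
Proof.
move=> mn f0; elim: n mn => [|n IH]; first by rewrite leqn0 => /eqP ->.
rewrite leq_eqVlt => /orP[/eqP <-//|]; rewrite ltnS => mn.
rewrite isumS IH// !f0 ?addr0//; lia.
Qed.

Lemma isum_even m f : (forall h, f (- h) = f h) ->
  isum m f = f 0 + 2 * \sum_(h < m) f h.+1%:Z.
Proof.
move=> fe; rewrite /isum mulr_sumr; congr (_ + _); apply: eq_bigr => h _.
by rewrite fe; ring.
Qed.

(* a Toeplitz sum counts the lag [u] exactly [m - |u|] times *)
Lemma toeplitz_sum m f :
  \sum_(a < m) \sum_(b < m) f (a%:Z - b%:Z) =
  isum m (fun u => (m%:R - `|u|%N%:R) * f u).
Proof.
elim: m => [|m IH]; first by rewrite big_ord0 /isum big_ord0 subr0 mul0r addr0.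
rewrite big_ord_recr/=.
under eq_bigr do rewrite big_ord_recr/=.
rewrite big_split/= IH big_ord_recr/=.
rewrite isumS /= !subrr !mul0r !addr0.
have -> : isum m (fun u => (m.+1%:R - `|u|%N%:R) * f u) =
    isum m (fun u => (m%:R - `|u|%N%:R) * f u) + isum m f.
  by rewrite -isumD; apply: eq_isum => h _; rewrite -natr1; ring.
rewrite -addrA; congr (_ + _); rewrite /isum big_split/=.
have -> : \sum_(i < m) f (i%:Z - m%:Z) = \sum_(h < m) f (- h.+1%:Z).
  rewrite (reindex_inj rev_ord_inj)/=; apply: eq_bigr => i _; congr f.
  by have := ltn_ord i; lia.
have -> : \sum_(i < m) f (m%:Z - i%:Z) = \sum_(h < m) f h.+1%:Z.
  rewrite (reindex_inj rev_ord_inj)/=; apply: eq_bigr => i _; congr f.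
  by have := ltn_ord i; lia.
by ring.
Qed.

End isum.

(** * The groups as consecutive blocks of equal length *)

Section groups.
Context (K T : nat).
Hypotheses (K0 : (0 < K)%N) (T0 : (0 < T)%N).

Lemma in_groupE (j : 'I_K) (s : 'I_T) :
  (s \in group T j) = (j * T < s.+1 * K <= j.+1 * T)%N.
Proof.
rewrite inE ltr_pdivrMr ?ltr0n// ler_pdivlMr ?ltr0n//.
by rewrite -!natrM ltr_nat ler_nat.
Qed.

(** The predecessor accounts for intervals open on the left and closed on the right: j T < x <= (j +
    1) T means that j is the quotient of x - 1 by T. *)
Let index (s : 'I_T) : nat := (s.+1 * K).-1 %/ T.

Let index_lt s : (index s < K)%N.
Proof.
rewrite /index ltn_divLR//; have := ltn_ord s; move: (nat_of_ord s) => i iT.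
by rewrite prednK ?muln_gt0// mulnC leq_mul2l iT orbT.
Qed.

Let group_index (j : 'I_K) (s : 'I_T) :
  (s \in group T j) = (j == Ordinal (index_lt s)).
Proof.
rewrite in_groupE -val_eqE/= /index.
have : (0 < s.+1 * K)%N by rewrite muln_gt0.
move: (s.+1 * K)%N => x; case: x => // x _; rewrite /= ltnS.
rewrite -leq_divRL// -(ltn_divLR _ _ T0) ltnS.
by rewrite eqn_leq andbC.
Qed.

Hypothesis eqg : equal_groups K T.

(** The groups partition the T indices, so equal sizes force K to divide T. *)
Lemma equal_groups_mul : T = (K * (T %/ K))%N.
Proof.
pose m := #|group T (Ordinal K0)|.
suff -> : T = (K * m)%N by rewrite mulKn.
have cardE (j : 'I_K) : #|group T j| = m by exact: eqg.
have : (\sum_(j < K) #|group T j| = T)%N.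
  under eq_bigr do rewrite -sum1_card big_mkcond.
  rewrite exchange_big/= -[RHS]card_ord -sum1_card; apply: eq_bigr => s _.
  under eq_bigr do rewrite group_index.
  by rewrite -big_mkcond big_pred1_eq.
by rewrite (eq_bigr (fun=> m))// sum_nat_const card_ord => ->.
Qed.

Lemma in_group_equal (j : 'I_K) (s : 'I_T) :
  (s \in group T j) = (j * (T %/ K) <= s < j.+1 * (T %/ K))%N.
Proof.
rewrite in_groupE; have := equal_groups_mul.
move: (T %/ K)%N (nat_of_ord s) (nat_of_ord j) => m i k ->.
by rewrite !(mulnC K) !mulnA ltn_mul2r leq_mul2r eqn0Ngt K0/= ltnS.
Qed.

Lemma sum_group (V : nmodType) (j : 'I_K) (F : nat -> V) :
  \sum_(s in group T j) F s = \sum_(a < T %/ K) F (j * (T %/ K) + a)%N.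
Proof.
under eq_bigl do rewrite in_group_equal.
set m := (T %/ K)%N.
have jm : (j * m + m <= T)%N.
  by rewrite [X in (_ <= X)%N]equal_groups_mul -/m addnC -mulSn leq_mul2r ltn_ord orbT.
rewrite -(big_mkord (fun s => j * m <= s < j.+1 * m)%N F).
rewrite -(big_mkord xpredT (fun a => F (j * m + a)%N)).
have -> : \sum_(0 <= a < m) F (j * m + a)%N = \sum_(j * m <= s < j * m + m) F s.
  rewrite -{2}[(j * m)%N]add0n big_addn addKn.
  by apply: eq_bigr => a _; rewrite addnC.
rewrite [RHS](big_nat_widen _ _ T)// [RHS](big_nat_widenl _ 0%N)//.
by apply: eq_bigl => s; rewrite mulSn addnC andbC.
Qed.

Lemma card_group (j : 'I_K) : #|group T j| = (T %/ K)%N.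
Proof.
rewrite -sum1_card; have := @sum_group nat j (fun=> 1%N).
by move=> ->; rewrite sum_nat_const card_ord muln1.
Qed.
End groups.

Section group_covariance.
Context {R : realType} (K T : nat).
Hypotheses (K0 : (0 < K)%N) (T0 : (0 < T)%N) (eqg : equal_groups K T).
Local Notation m := (T %/ K)%N.

(** The matrix A. At lag h a group of size m has only m - |h| pairs, hence -1 on the diagonal; the
    |h| missing pairs go to the next or the previous group according to the sign of h, hence 1/2
    beside it. *)
Definition tridiag (j k : nat) : R :=
  if j == k then -1 else if (j == k.+1) || (k == j.+1) then 2^-1 else 0.

Lemma sum_group2 (j k : 'I_K) (r : int -> R) :
  \sum_(s in group T j) \sum_(t in group T k) r (s%:Z - t%:Z) =
  isum m (fun u => (m%:R - `|u|%N%:R) * r ((j%:Z - k%:Z) * m%:Z + u)).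
Proof.
rewrite -(toeplitz_sum m (fun u => r ((j%:Z - k%:Z) * m%:Z + u))).
rewrite (sum_group K0 T0 eqg j (fun s => \sum_(t in group T k) r (s%:Z - t%:Z))).
apply: eq_bigr => a _.
rewrite (sum_group K0 T0 eqg k (fun t => r ((j * m + a)%N%:Z - t%:Z))).
by apply: eq_bigr => b _; congr r; lia.
Qed.

Let abs_sum (r : int -> R) := isum m (fun u => `|u|%N%:R * r u).

Lemma group_toeplitz (j k : 'I_K) (r : int -> R) :
  (0 < m)%N -> (forall u, r (- u) = r u) -> (forall u, (m < `|u|)%N -> r u = 0) ->
  \sum_(s in group T j) \sum_(t in group T k) r (s%:Z - t%:Z) =
  (j == k)%:R * (m%:R * isum m r) + tridiag j k * abs_sum r.
Proof.
move=> m0 r_even r_supp.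
wlog jk : j k / (k <= j)%N.
  move=> H; have [/H//|kj] := leqP k j.
  rewrite exchange_big/= (eq_sym j) /tridiag (eq_sym (j : nat)) orbC.
  rewrite -[RHS](H k j (ltnW kj)); apply: eq_bigr => s _; apply: eq_bigr => t _.
  by rewrite -r_even opprB.
rewrite sum_group2 /tridiag.
have [jk_eq|jk_neq] := eqVneq j k.
  rewrite jk_eq eqxx mul1r subrr mul0r.
  have -> : isum m (fun u => (m%:R - `|u|%N%:R) * r (0 + u)) =
      isum m (fun u => m%:R * r u - `|u|%N%:R * r u).
    by apply: eq_isum => u _; rewrite add0r mulrBl.
  by rewrite isumB isumZ /abs_sum; ring.
have kj : (k < j)%N by rewrite ltn_neqAle jk andbT eq_sym.
have -> : (j == k :> nat) = false by apply/negbTE.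
rewrite [X in _ = X + _](_ : _ = 0); last exact: mul0r.
rewrite add0r.
have [j1|j1] := eqVneq (j : nat) k.+1; last first.
  (* Two or more groups apart, the lag exceeds m unless |u| = m, and there the weight vanishes. *)
  rewrite (_ : (k == j.+1 :> nat) = false) /=; last by apply/eqP; lia.
  rewrite mul0r -[RHS](mul0r (isum m r)) -isumZ; apply: eq_isum => u um.
  rewrite mul0r; have [->|um'] := eqVneq `|u|%N m; first by rewrite subrr mul0r.
  rewrite r_supp ?mulr0//.
  have : (2 * m%:Z <= (j%:Z - k%:Z) * m%:Z) by rewrite ler_wpM2r//; lia.
  lia.
rewrite j1 /= (_ : (k.+1%:Z - k%:Z) * m%:Z = m%:Z); last by lia.
have -> : abs_sum r = 2 * \sum_(h < m) h.+1%:R * r h.+1%:Z.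
  rewrite /abs_sum isum_even ?mul0r ?add0r//.
  by move=> h; rewrite abszN r_even.
rewrite [RHS]mulrA mulVf ?pnatr_eq0// mul1r.
(* For adjacent groups put h = m + u: the weight m - |u| equals h when u <= 0, and u > 0 gives lags
   beyond m. *)
transitivity (\sum_(i < m.+1) i%:R * r i%:Z); last first.
  by rewrite big_ord_recl mul0r add0r.
rewrite big_ord_recr /isum /= addrC subr0 addr0; congr (_ + _).
rewrite [RHS](reindex_inj rev_ord_inj)/=; apply: eq_bigr => h _.
rewrite (r_supp (m%:Z + h.+1%:Z)) ?mulr0 ?add0r; last by lia.
rewrite natrB ?ltn_ord//; congr (_ * r _).
by have := ltn_ord h; lia.
Qed.

End group_covariance.

Section summability.
Context {R : realType}.

(** Rows of Toeplitz matrices run over windows of consecutive lags, so the summability hypothesis is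
    converted into a bound on such windows, uniform in their position. *)
Lemma esum_int_le (f : int -> R) (C : R) : (forall h, 0 <= f h) ->
  (\esum_(h in [set: int]) (f h)%:E <= C%:E)%E ->
  forall (c : int) n, \sum_(b < n) f (c - b%:Z) <= C.
Proof.
move=> f0 fC c n; rewrite -lee_fin; apply: le_trans fC; apply: esum_ge.
pose s := [seq c - i%:Z | i <- iota 0 n].
have us : uniq s by rewrite map_inj_uniq ?iota_uniq// => x y; lia.
exists [set` s]; first by split => //; exact: finite_seq.
rewrite -fsbig_seq// big_map -sumEFin -(big_mkord xpredT (fun b => (f (c - b%:Z))%:E)).
by rewrite /index_iota subn0.
Qed.

Lemma isum_le_sum (f : int -> R) (C : R) m :
  (forall (c : int) n, \sum_(b < n) f (c - b%:Z) <= C) -> isum m f <= C.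
Proof.
move=> fC; rewrite -isum_shift (reindex_inj rev_ord_inj)/=.
apply: le_trans (fC m m.*2.+1); apply: ler_sum => i _.
by rewrite le_eqVlt; apply/orP; left; apply/eqP; congr f; have := ltn_ord i; lia.
Qed.
End summability.

Section autocovariance_sums.
Context {R : realType} (gamma : int -> R) (C : R).
Hypothesis gamma2 : forall (c : int) n,
  \sum_(b < n) ((c - b%:Z)%:~R ^+ 2 * `|gamma (c - b%:Z)|) <= C.

Let sq (h : int) : R := h%:~R ^+ 2 * `|gamma h|.

Lemma moment2_bound_ge0 : 0 <= C.
Proof. by have := gamma2 0 0; rewrite big_ord0. Qed.

Lemma sqr_intr (h : int) : h%:~R ^+ 2 = (`|h|%N%:R : R) ^+ 2.
Proof. by rewrite natr_absz intr_norm real_normK ?num_real. Qed.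

Lemma sum_pred1_le1 (c : int) n : \sum_(b < n) ((c - b%:Z == 0)%:R : R) <= 1.
Proof.
elim: n => [|n IH]; first by rewrite big_ord0.
rewrite big_ord_recr/=; have [cn|_] := eqVneq (c - n%:Z) 0; last by rewrite addr0.
rewrite big1 ?add0r// => b _; rewrite (_ : (_ == _) = false)//.
by apply/eqP; have := ltn_ord b; lia.
Qed.

(** A nonzero integer has h^2 >= 1, so only lag 0 escapes the second moment. *)
Lemma sum_norm_gamma_le (c : int) n :
  \sum_(b < n) `|gamma (c - b%:Z)| <= `|gamma 0| + C.
Proof.
apply: (@le_trans _ _ (\sum_(b < n) (`|gamma 0| * (c - b%:Z == 0)%:R + sq (c - b%:Z)))).
  apply: ler_sum => b _; move: (c - _) => h; rewrite /sq.
  have [->|h0] := eqVneq h 0; first by rewrite mulr1 expr0n mul0r addr0.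
  rewrite mulr0 add0r ler_peMl// sqr_intr -natrX ler1n expn_gt0 lt0n.
  by rewrite absz_eq0 h0.
rewrite big_split/= lerD ?gamma2// -mulr_sumr.
by rewrite -[leRHS]mulr1 ler_wpM2l// sum_pred1_le1.
Qed.

Lemma sum_lag_gamma_le (c : int) n :
  \sum_(b < n) (`|c - b%:Z|%N%:R * `|gamma (c - b%:Z)|) <= C.
Proof.
apply: le_trans (gamma2 c n); apply: ler_sum => b _; rewrite sqr_intr ler_wpM2r//.
by rewrite -natrX ler_nat; case: absz => // k; rewrite expnS leq_pmulr ?expn_gt0.
Qed.

Lemma isum_lag_le m : `|isum m (fun h => `|h|%N%:R * gamma h)| <= C.
Proof.
apply: le_trans (ler_norm_isum _ _) _.
have -> : isum m (fun h => `|(`|h|%N%:R * gamma h : R)|) = isum m (fun h => `|h|%N%:R * `|gamma h|).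
  by apply: eq_isum => h _; rewrite normrM normr_nat.
by apply: isum_le_sum => c n; exact: sum_lag_gamma_le.
Qed.

Lemma isum_cvg : (fun m => isum m gamma) @ \oo --> zseries gamma.
Proof.
have -> : zseries gamma = limn (fun m => isum m gamma).
  by rewrite /zseries; congr (limn _); apply: funext => m; exact: isum_shift.
pose f k := gamma k.+1%:Z + gamma (- k.+1%:Z).
have cf : cvgn (series f).
  apply: normed_cvg; apply: nondecreasing_is_cvgn.
    by apply: nondecreasing_series => k _ _; exact: normr_ge0.
  exists (`|gamma 0| + C) => _ [m _ <-].
  apply: (@le_trans _ _ (\sum_(k < m) `|f k|)); first by rewrite -(big_mkord xpredT (fun k => `|f k|)). 
  apply: le_trans (isum_le_sum (f := fun h => `|gamma h|) m sum_norm_gamma_le).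
  rewrite /isum -[leLHS]add0r lerD//; apply: ler_sum => k _; exact: ler_normD.
have -> : (fun m => isum m gamma) = (fun m => gamma 0 + series f m).
  by apply/funext => m; rewrite /isum /series/= big_mkord.
by apply: is_cvgD => //; exact: is_cvg_cst.
Qed.

Section groups.
Context (K T : nat).
Hypotheses (K0 : (0 < K)%N) (T0 : (0 < T)%N) (eqg : equal_groups K T).
Hypothesis gamma_even : forall h, gamma (- h) = gamma h.
Local Notation m := (T %/ K)%N.
Hypothesis m0 : (0 < m)%N.

Definition group_cov (r : int -> R) (j k : 'I_K) : R :=
  \sum_(s in group T j) \sum_(t in group T k) r (s%:Z - t%:Z).

Let lagsum (r : int -> R) := isum m (fun u => `|u|%N%:R * r u).

(* covariances at lags beyond [m] contribute at most [m * sum_{|h|>m} |gamma h|] *)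
Lemma group_cov_toeplitz (j k : 'I_K) :
  `|group_cov gamma j k -
    ((j == k)%:R * (m%:R * isum m gamma) + tridiag j k * lagsum gamma)| <= C / m%:R.
Proof.
pose gm (h : int) := if (`|h| <= m)%N then gamma h else 0.
have gmE h : (`|h| <= m)%N -> gm h = gamma h by rewrite /gm => ->.
have -> : isum m gamma = isum m gm by apply: eq_isum => h /gmE.
have -> : lagsum gamma = lagsum gm by apply: eq_isum => h /gmE ->.
rewrite -(group_toeplitz K0 T0 eqg)//; last 2 first.
- by move=> u; rewrite /gm abszN gamma_even.
- by move=> u um; rewrite /gm leqNgt um.
rewrite /group_cov !(sum_group2 K0 T0 eqg) -isumB.
apply: le_trans (ler_norm_isum _ _) _.
set c := (_ * m%:Z).
have mR : (0 : R) < m%:R by rewrite ltr0n.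
(* Where the lag c + u exceeds m, the weight is at most m and m * m <= (c + u)^2, so the weight is
   at most (c + u)^2 / m. *)
apply: (@le_trans _ _ (isum m (fun u => m%:R^-1 * sq (c + u)))).
  apply: le_isum => u um; rewrite -mulrBr normrM /gm.
  have [_|mh] := leqP; first by rewrite subrr normr0 mulr0 mulr_ge0// mulr_ge0// sqr_ge0.
  rewrite subr0 /sq mulrA ler_wpM2r//.
  rewrite ger0_norm ?subr_ge0 ?ler_nat// ler_pdivlMl//.
  apply: (@le_trans _ _ (m%:R * m%:R)); first by rewrite ler_wpM2l// gerBl.
  by rewrite sqr_intr expr2 ler_pM// ler_nat ltnW.
rewrite isumZ mulrC ler_wpM2r ?invr_ge0//.
apply: isum_le_sum => c' n; rewrite /sq.
by under eq_bigr do rewrite addrA; exact: gamma2.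
Qed.

Lemma norm_tridiag_le1 (j k : nat) : `|tridiag j k : R| <= 1.
Proof.
rewrite /tridiag; case: ifP => _; first by rewrite normrN normr1.
by case: ifP => _; rewrite ?normr0// ger0_norm; lra.
Qed.

Variables (r : int -> R) (kap e : R).
Hypotheses (r_even : forall h, r (- h) = r h)
  (r_supp : forall h, (m < `|h|)%N -> r h = 0).
Hypotheses (kap0 : 0 < kap) (e01 : 0 <= e <= 1).
Hypotheses (s_ge : kap <= isum m gamma) (s'_ge : kap <= isum m r).
Hypotheses (s_e : `|isum m r - isum m gamma| <= e)
  (b_e : `|lagsum r - lagsum gamma| <= e).

(** Each matrix is divided by its own truncated lag sum rather than by the limit [zseries gamma].
    Scale invariance permits this, and the leading term becomes exactly the identity. *)
Let S j k := (m%:R * isum m gamma)^-1 * group_cov gamma j k.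
Let S' j k := (m%:R * isum m r)^-1 * group_cov r j k.

Let mR : (0 : R) < m%:R.
Proof. by rewrite ltr0n. Qed.

Let s0 : 0 < isum m gamma. Proof. exact: lt_le_trans s_ge. Qed.
Let s'0 : 0 < isum m r. Proof. exact: lt_le_trans s'_ge. Qed.

Let S'E j k : S' j k = (j == k)%:R + tridiag j k * (lagsum r / isum m r) / m%:R.
Proof.
rewrite /S' /group_cov (group_toeplitz K0 T0 eqg)//.
move: s'0; rewrite -/(lagsum r); move: (isum m r) (lagsum r) mR => x y mR' x0.
by move: m%:R mR' => M M0; move: (tridiag j k) (_ == _)%:R => t D; field; rewrite ?gt_eqF.
Qed.

Let SE j k : `|S j k - ((j == k)%:R + tridiag j k * (lagsum gamma / isum m gamma) / m%:R)|
  <= C / kap / m%:R / m%:R.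
Proof.
have := group_cov_toeplitz j k; rewrite /S.
move: s0 s_ge; move: (isum m gamma) (lagsum gamma) mR => x y mR' x0 xk.
move: m%:R mR' => M M0; move: (group_cov _ _ _) (tridiag j k) (_ == _)%:R => W t D H.
have -> : (M * x)^-1 * W - (D + t * (y / x) / M) = (M * x)^-1 * (W - (D * (M * x) + t * y)).
  by field; rewrite ?gt_eqF.
have Mx0 : 0 <= (M * x)^-1 by rewrite invr_ge0 mulr_ge0 ?ltW.
rewrite normrM (ger0_norm Mx0).
have -> : C / kap / M / M = (M * kap)^-1 * (C / M) by field; rewrite ?gt_eqF.
by apply: ler_pM => //; rewrite lef_pV2 ?posrE ?mulr_gt0// ler_pM2l.
Qed.

Let C0 := moment2_bound_ge0.

Let mV : (0 : R) <= m%:R^-1. Proof. by rewrite invr_ge0 ltW. Qed.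

Let kV : 0 <= kap^-1. Proof. by rewrite invr_ge0 ltW. Qed.

Let sV : `|(isum m gamma)^-1| <= kap^-1.
Proof. by rewrite ger0_norm ?lef_pV2 ?posrE// invr_ge0 ltW. Qed.

Let s'V : `|(isum m r)^-1| <= kap^-1.
Proof. by rewrite ger0_norm ?lef_pV2 ?posrE// invr_ge0 ltW. Qed.

(** The tridiagonal part deviates by at most C / (kap m), distant lags by C / (kap m^2). The
    additional 1 is for the bootstrap matrix, whose weighted lag sum is only bounded by C + 1, so
    that one condition serves both. *)
Lemma near_id_group_cov : (2 * C + 1) / kap / m%:R <= (4 * K.+1%:R)^-1 ->
  near_id S.
Proof.
move=> mK j k; apply: le_trans mK.
have := SE j k; set t := tridiag j k * _ / _.
have -> : (2 * C + 1) / kap / m%:R = C / kap / m%:R + C / kap / m%:R + kap^-1 / m%:R by field; rewrite ?gt_eqF.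
have tC : `|t| <= C / kap / m%:R.
  rewrite /t normrM (ger0_norm mV) ler_wpM2r//.
  rewrite normrM -[leRHS]mul1r ler_pM ?norm_tridiag_le1//.
  by rewrite normrM ler_pM ?isum_lag_le.
have i0 : 0 <= kap^-1 / m%:R by rewrite mulr_ge0.
have i1 : C / kap / m%:R / m%:R <= C / kap / m%:R.
  by rewrite ler_piMr ?mulr_ge0// invf_le1// ler1n.
move: (C / kap / m%:R / m%:R) (C / kap / m%:R) (kap^-1 / m%:R) i0 i1 tC => A B D i0 i1 tC.
rewrite opprD addrA; move: (S j k - _) => z zt.
have := ler_normD (z - t) t; rewrite subrK; lra.
Qed.

Lemma near_id_group_cov_boot : (2 * C + 1) / kap / m%:R <= (4 * K.+1%:R)^-1 ->
  near_id S'.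
Proof.
move=> mK j k; apply: le_trans mK; rewrite S'E addrAC subrr add0r.
rewrite normrM (ger0_norm mV) ler_wpM2r//.
rewrite normrM -[leRHS]mul1r ler_pM ?norm_tridiag_le1//.
rewrite normrM ler_pM//.
have := isum_lag_le m; rewrite -/(lagsum gamma).
have := ler_normD (lagsum r - lagsum gamma) (lagsum gamma); rewrite subrK.
have /andP[_ e1] := e01; move: C0 b_e e1; lra.
Qed.

(** Only the ratios differ: b'/s' - b/s = (b' - b)/s' + (s - s') b/(s s') gives e/kap + e C/kap^2,
    and distant lags add C/(kap m^2). The overall factor 1/m is the reason why mere consistency of
    the estimates yields o(1/T). *)
Lemma group_cov_close j k :
  `|S j k - S' j k| <= (kap^-1 + C / kap / kap + C / kap) * (e + m%:R^-1) / m%:R.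
Proof.
have := SE j k; rewrite S'E.
set q := lagsum gamma / _; set q' := lagsum r / _.
have qq : `|q' - q| <= (kap^-1 + C / kap / kap) * e.
  have -> : q' - q = (lagsum r - lagsum gamma) / isum m r +
      (isum m gamma - isum m r) * lagsum gamma / isum m r / isum m gamma.
    by rewrite /q /q'; field; rewrite ?gt_eqF.
  apply: le_trans (ler_normD _ _) _; rewrite [leRHS]mulrDl.
  apply: lerD; first by rewrite normrM mulrC ler_pM.
  rewrite [leRHS](_ : _ = e * C / kap / kap); last by field; rewrite ?gt_eqF.
  rewrite normrM ler_pM// normrM ler_pM// normrM ler_pM ?isum_lag_le// distrC.
  exact: s_e.
move=> H.
have -> : S j k - ((j == k)%:R + tridiag j k * q' / m%:R) =
   (S j k - ((j == k)%:R + tridiag j k * q / m%:R)) - tridiag j k * (q' - q) / m%:R.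
  by ring.
apply: le_trans (ler_normB _ _) _; rewrite !normrM.
have tq : `|tridiag j k| * `|q' - q| * `|m%:R^-1 : R| <= (kap^-1 + C / kap / kap) * e / m%:R.
  rewrite (ger0_norm mV) ler_wpM2r//.
  by rewrite -[leRHS]mul1r ler_pM ?norm_tridiag_le1.
apply: le_trans (lerD H tq) _.
have -> : (kap^-1 + C / kap / kap + C / kap) * (e + m%:R^-1) / m%:R =
  C / kap / m%:R / m%:R + (kap^-1 + C / kap / kap) * e / m%:R +
  ((kap^-1 + C / kap / kap) / m%:R / m%:R + C / kap * e / m%:R).
  by field; rewrite ?gt_eqF.
rewrite lerDl; have /andP[e0 _] := e01.
by rewrite addr_ge0// !mulr_ge0 ?addr_ge0 ?mulr_ge0.
Qed.

End groups.
End autocovariance_sums.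

(** * The t-statistic as a function of the group sums *)

Section tstat_region.
Context {R : realType} (K : nat).

Definition tuple_mean (y : K.-tuple R) : R := K%:R^-1 * \sum_j tnth y j.

Definition tuple_var (y : K.-tuple R) : R :=
  (K%:R - 1)^-1 * \sum_j (tnth y j - tuple_mean y) ^+ 2.

(* [|t| <= x] in terms of the group means, without square roots or quotients;
   since [t = 0] when the variance vanishes, that case is always included. *)
Definition tstat_region (x : R) : set (K.-tuple R) :=
  [set y | tuple_var y <= 0] `|`
  [set y | K%:R * tuple_mean y ^+ 2 <= x ^+ 2 * tuple_var y].

Lemma measurable_tuple_mean : measurable_fun setT tuple_mean.
Proof.
apply: measurable_funM => //; apply: measurable_sum => j; exact: measurable_tnth.
Qed.

Lemma measurable_tuple_var : measurable_fun setT tuple_var.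
Proof.
apply: measurable_funM => //; apply: measurable_sum => j.
apply: measurable_funX; apply: measurable_funB; last exact: measurable_tuple_mean.
exact: measurable_tnth.
Qed.

Lemma measurable_tstat_region x : measurable (tstat_region x).
Proof.
have mV := measurable_tuple_var; have mM := measurable_tuple_mean.
rewrite -[X in measurable X]setTI setIUr; apply: measurableU.
  by apply: (measurable_fun_le (g := fun=> 0) measurableT mV); exact: measurable_cst.
apply: (measurable_fun_le measurableT); apply: measurable_funM => //.
exact: measurable_funX.
Qed.

Lemma tstat_regionZ (x c : R) (y y' : K.-tuple R) : 0 < c ->
  (forall j, tnth y' j = c * tnth y j) -> tstat_region x y' <-> tstat_region x y.
Proof.
move=> c0 yy.
have mE : tuple_mean y' = c * tuple_mean y.
  by rewrite /tuple_mean (eq_bigr _ (fun j _ => yy j)) -mulr_sumr mulrCA.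
have vE : tuple_var y' = c ^+ 2 * tuple_var y.
  rewrite /tuple_var mE [RHS]mulrCA; congr (_ * _); rewrite mulr_sumr.
  by apply: eq_bigr => j _; rewrite yy; ring.
have c2 : 0 < c ^+ 2 by rewrite exprn_gt0.
rewrite /tstat_region /= vE mE pmulr_rle0// exprMn.
by rewrite mulrCA [x ^+ 2 * _]mulrCA ler_pM2l.
Qed.

Lemma tstat_le T (z : 'I_T -> R) (x : R) : (0 < K)%N -> 0 <= x ->
  `|tstat K z| <= x <-> tstat_region x [tuple group_mean z j | j < K].
Proof.
move=> K0 x0; set y := [tuple _ | _ < _].
have yE j : tnth y j = group_mean z j by rewrite tnth_mktuple.
have mE : mean_of_groups K z = tuple_mean y.
  by rewrite /tuple_mean (eq_bigr _ (fun j _ => yE j)).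
have vE : sd_of_groups K z = Num.sqrt (tuple_var y).
  rewrite /sd_of_groups mE /tuple_var; congr (Num.sqrt (_ * _)).
  by apply: eq_bigr => j _; rewrite yE.
rewrite /tstat mE vE /tstat_region /=.
have [v0|v0] := leP (tuple_var y) 0.
  by split=> _; [left | rewrite (ler0_sqrtr v0) invr0 mulr0 normr0].
have s0 : 0 < Num.sqrt (tuple_var y) by rewrite sqrtr_gt0.
rewrite normrM normfV (gtr0_norm s0) ler_pdivrMr//.
have -> : (`|Num.sqrt K%:R * tuple_mean y| <= x * Num.sqrt (tuple_var y)) =
    (K%:R * tuple_mean y ^+ 2 <= x ^+ 2 * tuple_var y).
  rewrite -(@ler_pXn2r _ 2%N) ?nnegrE ?mulr_ge0 ?sqrtr_ge0//.
  by rewrite real_normK ?num_real// !exprMn !sqr_sqrtr ?ler0n ?(ltW v0).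
by split=> [|[]//]; right.
Qed.

(** The free factor [c] will be the square root of the constant that brings the covariance of the
    group sums near the identity. *)
Lemma tstat_le_scaled T (z : 'I_T -> R) (x c : R) : (0 < K)%N -> (0 < T)%N ->
  equal_groups K T -> 0 <= x -> 0 < c ->
  `|tstat K z| <= x <->
  tstat_region x [tuple c * \sum_(s in group T j) z s | j < K].
Proof.
move=> K0 T0 eqg x0 c0; rewrite tstat_le//; apply: iff_sym.
have TE := equal_groups_mul K0 T0 eqg.
have m0 : (0 < T %/ K)%N by have := T0; rewrite [X in (_ < X)%N]TE muln_gt0 => /andP[].
apply: (@tstat_regionZ _ (c * (T %/ K)%:R)).
  by rewrite mulr_gt0 ?ltr0n.
move=> j; rewrite !tnth_mktuple /group_mean (card_group K0 T0 eqg).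
by rewrite -mulrA mulVKf ?pnatr_eq0 -?lt0n.
Qed.

Lemma fine_probability_indic d (S : measurableType d) (P : probability S R)
    (A : set S) : measurable A -> fine (P A) = \int[P]_w (\1_A w : R).
Proof. by move=> mA; rewrite /Rintegral integral_indic// setIT. Qed.

Lemma probability_tstat_le d (S : measurableType d) (P : probability S R) T
    (Z : 'I_T -> S -> R) (x c : R) : (0 < K)%N -> (0 < T)%N ->
  equal_groups K T -> 0 <= x -> 0 < c -> (forall s, measurable_fun setT (Z s)) ->
  fine (P [set w | `|tstat K (fun s => Z s w)| <= x]) =
  \int[P]_w (\1_(tstat_region x)
    (tuple_of_fam (fun j w => c * \sum_(s in group T j) Z s w) w) : R).
Proof.
move=> K0 T0 eqg x0 c0 mZ.
have -> : [set w | `|tstat K (fun s => Z s w)| <= x] =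
    tuple_of_fam (fun j w => c * \sum_(s in group T j) Z s w) @^-1` tstat_region x.
  by apply/seteqP; split => w /=; rewrite /tuple_of_fam => /(tstat_le_scaled _ K0 T0 eqg x0 c0).
rewrite fine_probability_indic.
  by apply: eq_Rintegral => w _; rewrite /indic.
rewrite -[X in measurable X]setTI; apply: measurable_tuple_of_fam => //.
  move=> j; apply: measurable_funM => //.
  rewrite (_ : (fun w => _) = fun w => \sum_s (s \in group T j)%:R * Z s w).
    by apply: measurable_sum => s; exact: measurable_funM.
  apply/funext => w; rewrite big_mkcond; apply: eq_bigr => s _.
  by case: ifP; rewrite ?mul1r ?mul0r.
exact: measurable_tstat_region.
Qed.
End tstat_region.

(** * Estimation of the lag sums *)

Section centering.
Context {R : realType} (n : nat) (k : 'I_n -> 'I_n -> R).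
Hypotheses (n0 : (0 < n)%N) (k_sym : forall i j, k i j = k j i).

Let rho i := \sum_j k i j.
Let nR : (n%:R : R) != 0.
Proof. by rewrite pnatr_eq0 -lt0n. Qed.

(** Double centring H k H, with H the projection orthogonal to constant vectors: it moves the
    subtraction of the sample mean from the data to the weights. *)
Definition centered_weight (i j : 'I_n) : R :=
  k i j - (rho i + rho j) / n%:R + (\sum_i rho i) / n%:R ^+ 2.

Lemma centered_quadratic (u : 'I_n -> R) :
  \sum_i \sum_j k i j * ((u i - sample_mean u) * (u j - sample_mean u)) =
  \sum_i \sum_j centered_weight i j * (u i * u j).
Proof.
set v := sample_mean u; set om := \sum_i rho i.
pose g i := \sum_j k i j * u j; pose a := \sum_j rho j * u j.
have uv : \sum_j u j = n%:R * v by rewrite /v /sample_mean mulVKf.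
have gS : \sum_i g i = a.
  rewrite exchange_big/=; apply: eq_bigr => j _; rewrite -mulr_suml; congr (_ * _).
  by apply: eq_bigr => i _; exact: k_sym.
transitivity (\sum_i u i * g i - 2 * v * a + v ^+ 2 * om).
  under eq_bigr => i _.
    rewrite (_ : \sum_j _ = u i * g i + (- v) * g i + (- v) * (rho i * u i) + v ^+ 2 * rho i).
      over.
    rewrite (eq_bigr (fun j => (u i - v) * (k i j * u j) + ((u i - v) * (- v)) * k i j)); last first.
      by move=> j _; ring.
    by rewrite big_split/= -!mulr_sumr -/(g i) -/(rho i); ring.
  by rewrite !big_split/= -!mulr_sumr gS -/a -/om; ring.
symmetry; under eq_bigr => i _.
  rewrite (_ : \sum_j _ = u i * g i + (- v) * (rho i * u i) + (- a / n%:R + om * v / n%:R) * u i).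
    over.
  rewrite (eq_bigr (fun j => u i * (k i j * u j) + (u i * (- rho i / n%:R + om / n%:R ^+ 2)) * u j
      + (u i * (- n%:R^-1)) * (rho j * u j))); last first.
    by move=> j _; rewrite /centered_weight -/om; field.
  rewrite !big_split/= -!mulr_sumr -/(g i) -/a uv; field; exact: nR.
rewrite !big_split/= -!mulr_sumr -/a uv; field; exact: nR.
Qed.

Variables A M : R.
Hypotheses (kM : forall i j, `|k i j| <= M) (kA : forall i, \sum_j `|k i j| <= A).

Let nR0 : (0 : R) < n%:R. Proof. by rewrite ltr0n. Qed.

Let A0 : 0 <= A.
Proof. by apply: le_trans (kA (Ordinal n0)); apply: sumr_ge0. Qed.

Let rhoA i : `|rho i| <= A.
Proof. by apply: le_trans (kA i); exact: ler_norm_sum. Qed.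

Let omA : `|\sum_i rho i| <= n%:R * A.
Proof.
apply: le_trans (ler_norm_sum _ _ _) _.
apply: (@le_trans _ _ (\sum_(i < n) A)); first by apply: ler_sum.
by rewrite sumr_const card_ord mulr_natl.
Qed.

(** The square of a sum of four terms is at most 4 times the sum of squares. The kernel contributes
    k^2 <= M |k|, in all n M A; each of the three centring terms is at most A / n, in all 3 A^2 over
    the n^2 entries. *)
Lemma sum_centered_weight_sqr :
  \sum_i \sum_j centered_weight i j ^+ 2 <= 4 * (n%:R * M * A + 3 * A ^+ 2).
Proof.
apply: (@le_trans _ _ (\sum_(i < n) \sum_(j < n)
    (4 * M * `|k i j| + 4 * (3 * A ^+ 2 / n%:R ^+ 2)))).
  apply: ler_sum => i _; apply: ler_sum => j _; rewrite /centered_weight.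
  have c2 (x y : R) : `|x| <= y -> x ^+ 2 <= y ^+ 2.
    by move=> xy; rewrite -(real_normK (num_real x)) lerXn2r ?nnegrE// (le_trans _ xy).
  have H1 := c2 _ _ (rhoA i); have H2 := c2 _ _ (rhoA j); have H3 := c2 _ _ omA.
  have H4 : k i j ^+ 2 <= M * `|k i j|.
    by rewrite -real_normK ?num_real// expr2 ler_wpM2r.
  set N : R := n%:R in H3 *.
  have N2 : 0 <= N^-1 ^+ 2 by rewrite sqr_ge0.
  have h1 := ler_wpM2r N2 H1; have h2 := ler_wpM2r N2 H2.
  have h3 : ((\sum_i rho i) / N ^+ 2) ^+ 2 <= A ^+ 2 * N^-1 ^+ 2.
    rewrite [leLHS](_ : _ = (\sum_i rho i) ^+ 2 * (N^-1 ^+ 2 * N^-1 ^+ 2)); last by field; exact: nR.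
    rewrite [leRHS](_ : _ = (N * A) ^+ 2 * (N^-1 ^+ 2 * N^-1 ^+ 2)); last by field; exact: nR.
    by rewrite ler_wpM2r// mulr_ge0.
  rewrite -exprMn in h1; rewrite -exprMn in h2.
  rewrite -(exprVn N) in h3 *; rewrite mulrDl.
  rewrite -[3 * _ * _]mulrA -[4 * M * _]mulrA.
  move: (k i j) (rho i / N) (rho j / N) (_ * N^-1 ^+ 2) (A ^+ 2 * _) h1 h2 h3 H4 =>
    x y z w B h1 h2 h3.
  move: (M * _) => E h4.
  apply: (@le_trans _ _ (4 * (x ^+ 2 + y ^+ 2 + z ^+ 2 + w ^+ 2))); last by lra.
  (* The difference is the sum of the squared pairwise differences of x, -y, -z and w. *)
  rewrite -subr_ge0.
  rewrite (_ : _ - _ = (x + y) ^+ 2 + (x + z) ^+ 2 + (x - w) ^+ 2 + (y - z) ^+ 2 +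
    (y + w) ^+ 2 + (z + w) ^+ 2); last by ring.
  by rewrite !addr_ge0 ?sqr_ge0.
apply: (@le_trans _ _ (\sum_(i < n) (4 * M * A + n%:R * (4 * (3 * A ^+ 2 / n%:R ^+ 2))))).
  apply: ler_sum => i _; rewrite big_split/= -mulr_sumr sumr_const card_ord [X in _ <= _ + X]mulr_natl lerD2r.
  by rewrite ler_wpM2l// mulr_ge0// (le_trans _ (kM i i)).
rewrite sumr_const card_ord -[leLHS]mulr_natl le_eqVlt; apply/orP; left; apply/eqP.
by field.
Qed.

(** Centring moves each weight by at most 3 A / n, and each of the n rows of [c] has absolute sum at
    most G. *)
Lemma centered_weight_bias (c : 'I_n -> 'I_n -> R) (G : R) :
  (forall i, \sum_j `|c i j| <= G) ->
  `|\sum_i \sum_j centered_weight i j * c i j - \sum_i \sum_j k i j * c i j| <=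
  3 * A * G.
Proof.
move=> cG; rewrite -sumrB; under eq_bigr do rewrite -sumrB.
apply: le_trans (ler_norm_sum _ _ _) _.
apply: (@le_trans _ _ (\sum_(i < n) (3 * A / n%:R * G))); last first.
  rewrite sumr_const card_ord -[leLHS]mulr_natl le_eqVlt; apply/orP; left; apply/eqP.
  by field.
apply: ler_sum => i _; apply: le_trans (ler_norm_sum _ _ _) _.
apply: (@le_trans _ _ (\sum_j 3 * A / n%:R * `|c i j|)); last first.
  by rewrite -mulr_sumr ler_wpM2l// divr_ge0 ?mulr_ge0// ltW.
apply: ler_sum => j _; rewrite -mulrBl normrM ler_wpM2r//.
rewrite (_ : _ - _ = ((\sum_i rho i) / n%:R - (rho i + rho j)) / n%:R); last first.
  by rewrite /centered_weight; field.
have nV : (0 : R) <= n%:R^-1 by rewrite invr_ge0 ltW.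
rewrite normrM (ger0_norm nV) ler_wpM2r//.
apply: le_trans (ler_normB _ _) _.
have h1 : `|(\sum_i rho i) / n%:R| <= A.
  by rewrite normrM (ger0_norm nV) ler_pdivrMr// mulrC.
have := ler_normD (rho i) (rho j); have := rhoA i; have := rhoA j; lra.
Qed.

End centering.

(** * The Bartlett kernel and its lag-weighted version *)

Section bartlett.
Context {R : realType}.
Implicit Types x l : R.

Lemma bartlettN x : bartlett (- x) = bartlett x.
Proof. by rewrite /bartlett normrN. Qed.

Lemma bartlett_ge0 x : 0 <= bartlett x.
Proof. by rewrite /bartlett; case: ifP => [/ltW|//]; rewrite subr_ge0. Qed.

Lemma bartlett_le1 x : bartlett x <= 1.
Proof. by rewrite /bartlett; case: ifP => // _; rewrite gerBl. Qed.

Lemma bartlett_ge1B x : 1 - `|x| <= bartlett x.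
Proof. by rewrite /bartlett; have [//|] := ltP; rewrite subr_le0. Qed.

Lemma bartlett_eq0 x : 1 <= `|x| -> bartlett x = 0.
Proof. by rewrite /bartlett ltNge => ->. Qed.

Definition lag_kernel (e : nat) l (h : int) : R :=
  `|h|%N%:R ^+ e * bartlett (h%:~R / l).

Lemma lag_kernelN e l h : lag_kernel e l (- h) = lag_kernel e l h.
Proof. by rewrite /lag_kernel abszN mulrNz mulNr bartlettN. Qed.

Lemma norm_lag_div l (h : int) : 0 < l -> `|h%:~R / l| = `|h|%N%:R / l.
Proof.
by move=> l0; rewrite normrM normfV (gtr0_norm l0) natr_absz intr_norm.
Qed.

Lemma lag_kernel_eq0 e l h : 0 < l -> l <= `|h|%N%:R -> lag_kernel e l h = 0.
Proof.
by move=> l0 lh; rewrite /lag_kernel bartlett_eq0 ?mulr0// norm_lag_div// ler_pdivlMr// mul1r.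
Qed.

Lemma lag_kernel_ge0 e l h : 0 <= lag_kernel e l h.
Proof. by rewrite mulr_ge0 ?bartlett_ge0 ?exprn_ge0. Qed.

Lemma lag_kernel_le e l h : (e <= 1)%N -> 1 <= l -> lag_kernel e l h <= l.
Proof.
move=> e1 l1; have l0 : 0 < l by exact: lt_le_trans l1.
have [lh|hl] := leP l `|h|%N%:R; first by rewrite lag_kernel_eq0// ltW.
apply: (@le_trans _ _ (`|h|%N%:R ^+ e)).
  by rewrite -[leRHS]mulr1 ler_wpM2l ?bartlett_le1 ?exprn_ge0.
by case: e e1 => [|[|//]] _; rewrite ?expr0 ?expr1 ?(ltW hl).
Qed.

Lemma sum_lag_le (c : int) (L n : nat) :
  \sum_(b < n) ((`|c - b%:Z| <= L)%N%:R : R) <= L.*2.+1%:R.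
Proof.
apply: (@le_trans _ _ (\sum_(b < n) isum L (fun h => ((c - h) - b%:Z == 0)%:R))).
  apply: ler_sum => b _; have [cL|_] := leqP; last first.
    by rewrite addr_ge0 ?sumr_ge0// => h _; rewrite addr_ge0.
  rewrite le_eqVlt; apply/orP; left; apply/eqP; apply: esym.
  rewrite -[RHS](isum_delta (fun=> 1) cL); apply: eq_isum => h _.
  by rewrite mulr1; congr (_%:R); congr nat_of_bool; apply/eqP/eqP; lia.
rewrite isum_exchange; apply: (@le_trans _ _ (isum L (fun=> 1))).
  by apply: le_isum => h _; exact: sum_pred1_le1.
rewrite /isum sumr_const card_ord -[X in _ + X]mulr_natr -addnn -addn1 !natrD; lra.
Qed.

(** At most 2 L + 1 <= 3 l lags fall under the kernel, L being the integer part of l, and each value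
    is at most l. For [e] = 0 this is wasteful by a factor l, but it treats both lag sums at
    once. *)
Lemma sum_lag_kernel_le e l (c : int) n : (e <= 1)%N -> 1 <= l ->
  \sum_(b < n) `|lag_kernel e l (c - b%:Z)| <= 3 * l ^+ 2.
Proof.
move=> e1 l1; have l0 : 0 < l by exact: lt_le_trans l1.
have [L Ll lL] : exists2 L, (L%:R <= l) & (l < L.+1%:R).
  by have /andP[] := truncn_itv (ltW l0); exists (Num.truncn l).
apply: (@le_trans _ _ (\sum_(b < n) l * (`|c - b%:Z| <= L)%N%:R)).
  apply: ler_sum => b _; rewrite ger0_norm ?lag_kernel_ge0//.
  have [_|Lh] := leqP; first by rewrite mulr1 lag_kernel_le.
  by rewrite mulr0 lag_kernel_eq0// (le_trans (ltW lL))// ler_nat.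
rewrite -mulr_sumr expr2 mulrCA ler_wpM2l ?(ltW l0)//.
apply: le_trans (sum_lag_le _ _ _) _.
rewrite -addnn -addn1 !natrD; lra.
Qed.
End bartlett.

Section lag_sums.
Context {R : realType} (n : nat).

Lemma sample_acovE (x : 'I_n -> R) (h : int) :
  sample_acov x `|h|%N = n%:R^-1 * \sum_(i < n) \sum_(j < n)
    (h == i%:Z - j%:Z)%:R * ((x i - sample_mean x) * (x j - sample_mean x)).
Proof.
rewrite /sample_acov; congr (_ * _); set z := fun i => x i - sample_mean x.
under eq_bigr do rewrite big_mkcond.
case: h => p; last first.
  apply: eq_bigr => i _; apply: eq_bigr => j _.
  rewrite (_ : (Negz p == _) = (j == i + absz (Negz p) :> nat)%N).
    by case: ifP; rewrite ?mul1r ?mul0r.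
  by apply/eqP/eqP; lia.
rewrite [RHS]exchange_big; apply: eq_bigr => i _; apply: eq_bigr => j _.
rewrite (_ : (Posz p == _) = (j == i + absz (Posz p) :> nat)%N).
  by case: ifP; rewrite ?mul1r ?mul0r// mulrC.
by apply/eqP/eqP; lia.
Qed.

Lemma isum_sample_acov (x : 'I_n -> R) (k : int -> R) m :
  (forall h, (m < `|h|)%N -> k h = 0) ->
  isum m (fun h => k h * sample_acov x `|h|%N) =
  n%:R^-1 * \sum_(i < n) \sum_(j < n)
    k (i%:Z - j%:Z) * ((x i - sample_mean x) * (x j - sample_mean x)).
Proof.
move=> k0; set z := fun i => x i - sample_mean x.
(* The range is widened so that every difference i - j of sample indices lies in it, even beyond m
   where the kernel vanishes. *)
rewrite -(@isum_support _ m (maxn m n)) ?leq_maxl//; last first.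
  by move=> h mh; rewrite k0// mul0r.
rewrite (eq_isum (g := fun h => n%:R^-1 * \sum_(p : 'I_n * 'I_n)
    ((h == p.1%:Z - p.2%:Z)%:R * (k h * (z p.1 * z p.2))))); last first.
  move=> h _; rewrite sample_acovE mulrCA; congr (_ * _).
  rewrite mulr_sumr -(pair_bigA _ (fun i j : 'I_n =>
    ((h == i%:Z - j%:Z)%:R * (k h * (z i * z j)))))/=.
  apply: eq_bigr => i _; rewrite mulr_sumr; apply: eq_bigr => j _.
  by rewrite mulrCA.
rewrite isumZ; congr (_ * _).
rewrite (pair_bigA _ (fun i j : 'I_n => k (i%:Z - j%:Z) * (z i * z j)))/=.
rewrite -isum_exchange; apply: eq_bigr => p _.
rewrite (isum_delta (fun h => k h * (z p.1 * z p.2)))//.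
by rewrite leq_max; apply/orP; right; have := ltn_ord p.1; have := ltn_ord p.2; lia.
Qed.

Lemma sub_sample_mean (x : 'I_n -> R) (c : R) i : (0 < n)%N ->
  x i - sample_mean x = (x i - c) - sample_mean (fun j => x j - c).
Proof.
move=> n0; rewrite /sample_mean sumrB sumr_const card_ord -[c *+ n]mulr_natl.
by rewrite mulrBr mulKf ?pnatr_eq0 -?lt0n//; ring.
Qed.
End lag_sums.

Lemma chebyshev_second_moment d (S : measurableType d) (R : realType)
    (P : probability S R) (Z : S -> R) (eps V : R) :
  0 < eps -> measurable_fun setT Z ->
  P.-integrable setT (EFin \o (fun w => Z w ^+ 2)) ->
  \int[P]_w (Z w ^+ 2) <= V ->
  (P [set w | (eps <= `|Z w|)%R] <= (V / eps ^+ 2)%:E)%E.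
Proof.
move=> e0 mZ iZ ZV; set A := [set w | _].
have mA : measurable A.
  rewrite -[A]setTI; apply: (measurable_fun_le (f := fun=> eps) measurableT).
    exact: measurable_cst.
  exact: measurableT_comp.
rewrite -(fineK (fin_num_measure P _ mA)) lee_fin fine_probability_indic//.
have i1 : P.-integrable setT (EFin \o (\1_A : S -> R)).
  apply: (@bounded_integrable R _ S P _ 1); first exact: measurable_indic.
  by move=> w; rewrite indicE; case: (_ \in _); rewrite ?normr1 ?normr0.
rewrite ler_pdivlMr ?exprn_gt0// mulrC -(RintegralZl _ measurableT i1).
apply: le_trans ZV; apply: le_Rintegral => //.
  exact: (integrableZl measurableT (eps ^+ 2) i1).
move=> w _; rewrite indicE; have [wA|_] := boolP (w \in A); last first.
  by rewrite mulr0 sqr_ge0.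
rewrite mulr1 -(real_normK (num_real (Z w))) lerXn2r ?nnegrE ?(ltW e0)//.
by move: wA; rewrite inE.
Qed.

Section lag_sum_estimate.
Context d (S : measurableType d) (R : realType) (P : probability S R).
Context (X : int -> {mfun S >-> R}) (mean : R) (gamma : int -> R) (C : R).
Hypotheses (gX : gaussian_series P X) (sX : stationary_with P X mean gamma).
Hypothesis gamma2 : forall (c : int) n,
  \sum_(b < n) ((c - b%:Z)%:~R ^+ 2 * `|gamma (c - b%:Z)|) <= C.
Context (n m e : nat) (l : R).
Hypotheses (n0 : (0 < n)%N) (mn : (m <= n)%N) (e1 : (e <= 1)%N)
  (l1 : 1 <= l) (lm : l <= m%:R).

Let G := `|gamma 0| + C.
Let del : R := 1 / l + l ^+ 3 / n%:R.

(* [e = 0] and [e = 1] give the sums of [r(h)] and of [|h| r(h)] over all lags, [r]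
   being the autocovariance function of the bootstrap series *)
Definition acov_lag_sum (w : S) : R :=
  isum m (fun h => lag_kernel e l h *
    sample_acov (fun i : 'I_n => X i.+1%:Z w) `|h|%N).

Let l0 : 0 < l. Proof. exact: lt_le_trans l1. Qed.
Let nR0 : (0 : R) < n%:R. Proof. by rewrite ltr0n. Qed.
Let C0 : 0 <= C := moment2_bound_ge0 gamma2.
Let G0 : 0 <= G. Proof. exact: addr_ge0. Qed.

Let t (i : 'I_n) : int := i.+1%:Z.
Let U (i : int) w := X i w - mean.
Let s (i j : int) := gamma (i - j).
Let k (i j : 'I_n) := lag_kernel e l (i%:Z - j%:Z).
Let W (i j : 'I_n) := n%:R^-1 * centered_weight k i j.

Let k_sym i j : k i j = k j i.
Proof. by rewrite /k -lag_kernelN opprB. Qed.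

Let kM i j : `|k i j| <= l.
Proof. by rewrite ger0_norm ?lag_kernel_ge0// lag_kernel_le. Qed.

Let kA i : \sum_j `|k i j| <= 3 * l ^+ 2.
Proof. exact: sum_lag_kernel_le. Qed.

Let s_sym i j : s i j = s j i.
Proof. by rewrite /s -(stationary_cov_even sX) opprB. Qed.

Let sE (i j : 'I_n) : s (t i) (t j) = gamma (i%:Z - j%:Z).
Proof. by rewrite /s /t; congr gamma; lia. Qed.

Let sG (i : 'I_n) : \sum_j `|s (t i) (t j)| <= G.
Proof. by under eq_bigr do rewrite sE; exact: (sum_norm_gamma_le gamma2). Qed.

Let gU : gauss_family P U s := gaussian_stationary gX sX.

Let ker_supp h : (m < `|h|)%N -> lag_kernel e l h = 0.
Proof. by move=> mh; rewrite lag_kernel_eq0// (le_trans lm)// ler_nat ltnW. Qed.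

Lemma acov_lag_sumE w :
  acov_lag_sum w = \sum_i \sum_j W i j * (U (t i) w * U (t j) w).
Proof.
rewrite /acov_lag_sum isum_sample_acov//.
under eq_bigr => i _ do under eq_bigr => j _ do
  rewrite (sub_sample_mean _ mean i n0) (sub_sample_mean _ mean j n0).
rewrite (centered_quadratic n0 k_sym (fun i : 'I_n => U (t i) w)).
rewrite mulr_sumr; apply: eq_bigr => i _; rewrite mulr_sumr.
by apply: eq_bigr => j _; rewrite /W -[RHS]mulrA.
Qed.

Lemma measurable_acov_lag_sum : measurable_fun setT acov_lag_sum.
Proof.
pose xbar w := sample_mean (fun i : 'I_n => X i.+1%:Z w).
rewrite (_ : acov_lag_sum = fun w => n%:R^-1 * \sum_(i < n) \sum_(j < n)
    lag_kernel e l (i%:Z - j%:Z) * ((X i.+1%:Z w - xbar w) * (X j.+1%:Z w - xbar w))); last first.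
  by apply/funext => w; rewrite /acov_lag_sum isum_sample_acov.
have mx : measurable_fun setT xbar by apply: measurable_funM => //; exact: measurable_sum.
apply: measurable_funM => //; apply: measurable_sum => i; apply: measurable_sum => j.
by apply: measurable_funM => //; apply: measurable_funM; exact: measurable_funB.
Qed.

Let EQ := \sum_i \sum_j W i j * s (t i) (t j).

Let del_ge : (n%:R^-1 <= del) * (l ^+ 3 / n%:R <= del) * (l^-1 <= del) * (l / n%:R <= del)
  * (l ^+ 2 / n%:R <= del).
Proof.
have nV : (0 : R) <= n%:R^-1 by rewrite invr_ge0 ltW.
have lV : 0 <= l^-1 by rewrite invr_ge0 ltW.
have l3 : 1 <= l ^+ 3 by rewrite exprn_ege1.
have l2 : l <= l ^+ 2 by rewrite -[leLHS]expr1 ler_weXn2l.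
have l23 : l ^+ 2 <= l ^+ 3 by rewrite ler_weXn2l.
have h3 : l ^+ 3 / n%:R <= del by rewrite /del lerDr mul1r.
have hl (x : R) : x <= l ^+ 3 -> x / n%:R <= del.
  by move=> xl; apply: le_trans h3; rewrite ler_wpM2r.
do !split => //.
- by rewrite -[leLHS]mul1r hl.
- by rewrite /del div1r lerDl mulr_ge0// ltW// (lt_le_trans _ l3).
- by rewrite hl// (le_trans l2).
- by rewrite hl.
Qed.

(** Centring costs 3 A G with A = 3 l^2, divided by n. The missing pairs and the kernel together
    cost a relative error of at most |h| (1/n + 1/l); multiplied by |h|^e with e <= 1, it is charged
    to the second moment of [gamma]. *)
Lemma acov_lag_sum_bias :
  `|EQ - isum m (fun h => `|h|%N%:R ^+ e * gamma h)| <= (9 * G + C) * del.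
Proof.
have nV : (0 : R) <= n%:R^-1 by rewrite invr_ge0 ltW.
have := centered_weight_bias n0 kA sG.
set E1 := \sum_i \sum_j centered_weight k i j * _; set E2 := \sum_i \sum_j _.
have EQE : EQ = n%:R^-1 * E1.
  rewrite /EQ /E1 mulr_sumr; apply: eq_bigr => i _; rewrite mulr_sumr.
  by apply: eq_bigr => j _; rewrite /W -[LHS]mulrA.
have E2E : E2 = isum m (fun h => (n%:R - `|h|%N%:R) * (lag_kernel e l h * gamma h)).
  rewrite -(@isum_support _ m n)//; last first.
    by move=> h /ker_supp ->; rewrite mul0r mulr0.
  rewrite -toeplitz_sum; apply: eq_bigr => i _; apply: eq_bigr => j _.
  by rewrite sE.
move=> H1.
have H2 : `|n%:R^-1 * E2 - isum m (fun h => `|h|%N%:R ^+ e * gamma h)| <= C * (n%:R^-1 + l^-1).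
  rewrite E2E -isumZ -isumB; apply: le_trans (ler_norm_isum _ _) _.
  apply: (@le_trans _ _ (isum m (fun h => (n%:R^-1 + l^-1) * (h%:~R ^+ 2 * `|gamma h|)))).
    apply: le_isum => h hm; rewrite /lag_kernel.
    set b := bartlett _; set x : R := `|h|%N%:R.
    rewrite (_ : _ - _ = (x ^+ e * ((1 - x / n%:R) * b - 1)) * gamma h); last by field; rewrite gt_eqF.
    rewrite normrM mulrA ler_wpM2r// normrM sqr_intr -/x.
    have x0 : 0 <= x by rewrite /x.
    have xe : x ^+ e * x <= x ^+ 2.
      rewrite /x -!natrX -natrM ler_nat; case: e e1 => [|[|//]] _.
        by case: absz => // p; rewrite mul1n expnS leq_pmulr ?expn_gt0.
      by rewrite expn1 mulnn.
    have bb : `|(1 - x / n%:R) * b - 1| <= (n%:R^-1 + l^-1) * x.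
      have b1 : 1 - x / l <= b by have := bartlett_ge1B (h%:~R / l); rewrite norm_lag_div.
      have b2 := bartlett_le1 (h%:~R / l); have b3 := bartlett_ge0 (h%:~R / l).
      rewrite -/b in b2 b3.
      have xn0 : 0 <= x / n%:R by rewrite mulr_ge0.
      have xn : x / n%:R <= 1 by rewrite ler_pdivrMr// mul1r ler_nat (leq_trans hm).
      have -> : (n%:R^-1 + l^-1) * x = x / n%:R + x / l by ring.
      by rewrite ler_norml; apply/andP; split; nra.
    rewrite (ger0_norm (exprn_ge0 e x0)).
    apply: le_trans (ler_wpM2l (exprn_ge0 e x0) bb) _.
    by rewrite mulrCA ler_wpM2l// addr_ge0// invr_ge0 ltW.
  rewrite isumZ mulrC ler_wpM2r ?addr_ge0 ?invr_ge0 ?(ltW l0)//.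
  exact: (isum_le_sum (f := fun h => h%:~R ^+ 2 * `|gamma h|) m gamma2).
rewrite EQE (_ : _ - _ = n%:R^-1 * (E1 - E2) +
  (n%:R^-1 * E2 - isum m (fun h => `|h|%N%:R ^+ e * gamma h))); last by ring.
apply: le_trans (ler_normD _ _) _; rewrite mulrDl; apply: lerD.
  rewrite normrM (ger0_norm nV) mulrC; apply: le_trans (ler_wpM2r nV H1) _.
  rewrite (_ : _ / n%:R = 9 * G * (l ^+ 2 / n%:R)); last by ring.
  by rewrite ler_wpM2l ?mulr_ge0// del_ge.
apply: le_trans H2 _; rewrite ler_wpM2l// /del addrC div1r lerD2l.
rewrite -[leLHS]mul1r ler_wpM2r// exprn_ege1//.
Qed.

(** With M = l and A = 3 l^2 the squared weights add up to at most 12 l^3/n + 108 l^4/n^2. As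
    [del <= 1], l^4/n^2 is at most del as well, which gives 120 del, to be multiplied by 2 G^2. *)
Lemma acov_lag_sum_variance : del <= 1 ->
  P.-integrable setT (EFin \o (fun w => (acov_lag_sum w - EQ) ^+ 2)) /\
  \int[P]_w ((acov_lag_sum w - EQ) ^+ 2) <= 240 * G ^+ 2 * del.
Proof.
move=> del1; have [] := quadratic_form_variance gU s_sym W sG.
have QE : (fun w => (\sum_i \sum_j W i j * (U (t i) w * U (t j) w) - EQ) ^+ 2) =
    (fun w => (acov_lag_sum w - EQ) ^+ 2).
  by apply/funext => w; rewrite acov_lag_sumE.
rewrite -/EQ QE => iQ vQ; split=> //; apply: le_trans vQ _.
have -> : \sum_i \sum_j W i j ^+ 2 = n%:R^-1 ^+ 2 * \sum_i \sum_j centered_weight k i j ^+ 2.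
  rewrite mulr_sumr; apply: eq_bigr => i _; rewrite mulr_sumr.
  by apply: eq_bigr => j _; rewrite exprMn.
have H := sum_centered_weight_sqr n0 kM kA.
have n2 : (0 : R) <= n%:R^-1 ^+ 2 by rewrite sqr_ge0.
have := ler_wpM2l n2 H.
have -> : n%:R^-1 ^+ 2 * (4 * (n%:R * l * (3 * l ^+ 2) + 3 * (3 * l ^+ 2) ^+ 2)) =
    12 * (l ^+ 3 / n%:R) + 108 * ((l ^+ 3 / n%:R) * (l / n%:R)) :> R.
  by field; rewrite gt_eqF.
have h1 : (l ^+ 3 / n%:R) * (l / n%:R) <= del.
  rewrite -[leRHS]mulr1 ler_pM ?del_ge// ?mulr_ge0 ?exprn_ge0 ?invr_ge0 ?(ltW l0) ?(ltW nR0)//.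
  by rewrite (le_trans _ del1)// del_ge.
have h2 : l ^+ 3 / n%:R <= del by rewrite del_ge.
move: h1 h2; move: (l ^+ 3 / n%:R * (l / n%:R)) (l ^+ 3 / n%:R) => a b h1 h2 h3.
have -> : 240 * G ^+ 2 * del = 2 * G ^+ 2 * (120 * del) by ring.
rewrite ler_wpM2l ?mulr_ge0 ?sqr_ge0//.
by apply: le_trans h3 _; lra.
Qed.

(** Half of [eps] absorbs the bias; Chebyshev's inequality at eps / 2 turns 240 into 960. *)
Lemma acov_lag_sum_deviation (eps : R) : 0 < eps ->
  (9 * G + C) * del <= eps / 2 -> del <= 1 ->
  (P [set w | (eps <= `|acov_lag_sum w - isum m (fun h => `|h|%N%:R ^+ e * gamma h)|)%R] <=
   (960 * G ^+ 2 / eps ^+ 2 * del)%:E)%E.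
Proof.
move=> eps0 bias del1; have [iQ vQ] := acov_lag_sum_variance del1.
have mQ := measurable_acov_lag_sum.
have mB : measurable_fun setT (fun w => acov_lag_sum w - EQ) by exact: measurable_funB.
have e2 : 0 < eps / 2 by rewrite divr_gt0.
have := chebyshev_second_moment e2 mB iQ vQ.
rewrite (_ : 240 * G ^+ 2 * del / (eps / 2) ^+ 2 = 960 * G ^+ 2 / eps ^+ 2 * del); last first.
  by field; rewrite gt_eqF.
apply: le_trans; apply: le_measure; rewrite ?inE.
- rewrite -[X in measurable X]setTI; apply: (measurable_fun_le (f := fun=> eps) measurableT).
    exact: measurable_cst.
  by apply: measurableT_comp => //; exact: measurable_funB.
- rewrite -[X in measurable X]setTI; apply: (measurable_fun_le (f := fun=> eps / 2) measurableT).
    exact: measurable_cst.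
  exact: measurableT_comp.
move=> w /=; have := acov_lag_sum_bias; move: (isum m _) (acov_lag_sum w) => q Q b H.
have := ler_normD (Q - EQ) (EQ - q); rewrite addrA subrK; lra.
Qed.
End lag_sum_estimate.

(** * Comparison of the two laws *)

Section gauss_vec_maps.
Context d (S : measurableType d) (R : realType) (P : probability S R).

Lemma gauss_vec_linear n k (L : 'I_k -> 'I_n -> R) (Y : 'I_n -> S -> R) V :
  gauss_vec P Y V ->
  gauss_vec P (fun j w => \sum_i L j i * Y i w)
    (fun j j' => \sum_i \sum_i' L j i * L j' i' * V i i').
Proof.
move=> [mY nY]; split=> [j|a].
  by apply: measurable_sum => i; apply: measurable_funM => //; exact: mY.
have := nY (fun i => \sum_j a j * L j i); congr is_normal.
  apply/funext => w; under eq_bigr do rewrite mulr_suml.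
  rewrite exchange_big/=; apply: eq_bigr => j _; rewrite mulr_sumr.
  by apply: eq_bigr => i _; rewrite mulrA.
transitivity (\sum_j \sum_j' \sum_i \sum_i' (a j * a j') * (L j i * L j' i' * V i i')); last first.
  apply: eq_bigr => j _; apply: eq_bigr => j' _; rewrite mulr_sumr.
  by apply: eq_bigr => i _; rewrite mulr_sumr.
transitivity (\sum_i \sum_i' \sum_j \sum_j' (a j * a j') * (L j i * L j' i' * V i i')).
  apply: eq_bigr => i _; apply: eq_bigr => i' _; rewrite -mulrA mulr_suml.
  apply: eq_bigr => j _; rewrite mulr_suml mulr_sumr; apply: eq_bigr => j' _; ring.
rewrite [RHS]exchange_big/=.
under [RHS]eq_bigr => j' _ do rewrite exchange_big/=.
rewrite [RHS]exchange_big/=; apply: eq_bigr => i _.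
under [RHS]eq_bigr => j' _ do rewrite exchange_big/=.
rewrite [RHS]exchange_big/=; apply: eq_bigr => i' _.
by rewrite exchange_big.
Qed.

Lemma gauss_vec_group K T (c : R) (Z : 'I_T -> S -> R) V : gauss_vec P Z V ->
  gauss_vec P (fun (j : 'I_K) w => c * \sum_(s in group T j) Z s w)
    (fun j k => c ^+ 2 * \sum_(s in group T j) \sum_(t in group T k) V s t).
Proof.
move=> gZ; have := gauss_vec_linear (fun (j : 'I_K) s => c * (s \in group T j)%:R) gZ.
congr gauss_vec.
  apply/funext => j; apply/funext => w; rewrite [in RHS]big_mkcond mulr_sumr; apply: eq_bigr => s _.
  by rewrite mulrb; case: ifP => _; rewrite ?mulr1// !mulr0 mul0r.
apply/funext => j; apply/funext => k; rewrite [in RHS]big_mkcond [RHS]mulr_sumr; apply: eq_bigr => s _.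
rewrite mulrb; case: ifP => _; last by rewrite !mulr0 big1// => t _; rewrite !mul0r.
rewrite [in RHS]big_mkcond [RHS]mulr_sumr; apply: eq_bigr => t _.
by rewrite mulrb; case: ifP => _; rewrite ?mulr0 ?mul0r ?mulr1// expr2.
Qed.

Lemma gauss_vec_mvnormal n (Y : 'I_n -> {mfun S >-> R}) (V : 'M[R]_n) :
  is_mvnormal P Y 0 V -> gauss_vec P (fun i => Y i) (fun i j => V i j).
Proof.
move=> nY; split=> // a; have := nY (\row_i a i); congr is_normal.
- by apply/funext => w; apply: eq_bigr => i _; rewrite mxE.
- by rewrite big1// => i _; rewrite !mxE mulr0.
rewrite mxE exchange_big/=; apply: eq_bigr => j _; rewrite !mxE mulr_suml.
by apply: eq_bigr => i _; rewrite !mxE; ring.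
Qed.
End gauss_vec_maps.

Section abs_cdf_dist_bounds.
Context d d' (S : measurableType d) (S' : measurableType d') (R : realType).
Context (P : probability S R) (Y : S -> R) (Q : probability S' R) (Z : S' -> R) (b : R).
Hypothesis PQ : forall x, 0 <= x ->
  `|fine (P [set w | `|Y w| <= x]) - fine (Q [set w | `|Z w| <= x])| <= b.

Lemma abs_cdf_dist_le : 0 <= abs_cdf_dist P Y Q Z <= b.
Proof.
rewrite /abs_cdf_dist; set A := [set _ | _ in _].
have A0 : A (`|fine (P [set w | `|Y w| <= 0]) - fine (Q [set w | `|Z w| <= 0])|).
  by exists 0 => //=; rewrite in_itv/= lexx.
have Ab : ubound A b by move=> _ [x x0 <-]; apply: PQ; move: x0; rewrite /= in_itv/= andbT.
apply/andP; split; last by apply: ge_sup => //; exists (`|fine (P [set w | `|Y w| <= 0]) - fine (Q [set w | `|Z w| <= 0])|).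
apply: le_trans (normr_ge0 _) (ub_le_sup _ A0).
by exists b.
Qed.
End abs_cdf_dist_bounds.

Lemma group_cov_sym (R : realType) K T (r : int -> R) (j k : 'I_K) :
  (forall h, r (- h) = r h) -> group_cov T r j k = group_cov T r k j.
Proof.
move=> re; rewrite /group_cov exchange_big/=; apply: eq_bigr => s _; apply: eq_bigr => t _.
by rewrite -re opprB.
Qed.

(** [L] is chosen before the spaces, the sample size and the covariances, so it is uniform in T and
    in the data. Scale invariance lets the two normalisations [c] and [c'] differ. *)
Lemma tstat_comparison (R : realType) (K : nat) :
  exists2 L, 0 <= L & forall d (S : measurableType d) (P : probability S R)
    d' (S' : measurableType d') (Q : probability S' R) T
    (Z : 'I_T -> S -> R) (Z' : 'I_T -> S' -> R) (r r' : int -> R) (b : R),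
  (0 < K)%N -> (0 < T)%N -> equal_groups K T ->
  gauss_vec P Z (fun i j => r (i%:Z - j%:Z)) ->
  gauss_vec Q Z' (fun i j => r' (i%:Z - j%:Z)) ->
  (forall h, r (- h) = r h) -> (forall h, r' (- h) = r' h) ->
  forall c c', 0 < c -> 0 < c' ->
  near_id (fun j k : 'I_K => c * group_cov T r j k) ->
  near_id (fun j k : 'I_K => c' * group_cov T r' j k) ->
  0 <= b <= 1 ->
  (forall j k : 'I_K, `|c * group_cov T r j k - c' * group_cov T r' j k| <= b) ->
  0 <= abs_cdf_dist P (fun w => tstat K (fun i => Z i w))
    Q (fun w => tstat K (fun i => Z' i w)) <= L * b.
Proof.
have [L L0 HL] := @gauss_vec_lipschitz R K; exists L => //.
move=> d S P d' S' Q T Z Z' r r' b K0 T0 eqg gZ gZ' re re' c c' c0 c'0 nr nr' b01 rr'.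
apply: abs_cdf_dist_le => x x0.
have s0 : 0 < Num.sqrt c by rewrite sqrtr_gt0.
have s'0 : 0 < Num.sqrt c' by rewrite sqrtr_gt0.
rewrite (probability_tstat_le P K0 T0 eqg x0 s0 gZ.1).
rewrite (probability_tstat_le Q K0 T0 eqg x0 s'0 gZ'.1).
have g := gauss_vec_group K (Num.sqrt c) gZ.
have g' := gauss_vec_group K (Num.sqrt c') gZ'.
rewrite (sqr_sqrtr (ltW c0)) in g; rewrite (sqr_sqrtr (ltW c'0)) in g'.
apply: (HL _ _ _ _ _ _ _ _ _ _ _ _ g g' _ _ nr nr' b01 rr').
- by move=> j k; congr (_ * _); exact: group_cov_sym.
- by move=> j k; congr (_ * _); exact: group_cov_sym.
- exact: measurable_indic (measurable_tstat_region x).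
- by move=> y; rewrite indicE; case: (_ \in _); rewrite ?lexx ?ler01.
Qed.

Lemma boot_cov_lag (R : realType) T (x : 'I_T -> R) (l : R) i j :
  boot_cov x l i j =
  (fun h : int => bartlett (h%:~R / l) * sample_acov x `|h|%N) (i%:Z - j%:Z).
Proof. by rewrite mxE intrB. Qed.

Lemma subSSz (i j : nat) : i.+1%:Z - j.+1%:Z = i%:Z - j%:Z.
Proof. lia. Qed.

Section bootstrap.
Context d (S : measurableType d) (R : realType) (P : probability S R).
Context (X : int -> {mfun S >-> R}) (mean : R) (gamma : int -> R) (C : R).
Hypotheses (gX : gaussian_series P X) (sX : stationary_with P X mean gamma).
Hypothesis gamma2 : forall (c : int) n,
  \sum_(b < n) ((c - b%:Z)%:~R ^+ 2 * `|gamma (c - b%:Z)|) <= C.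

Definition lag_deviation T m e l (w : S) : R :=
  `|acov_lag_sum X T m e l w - isum m (fun h => `|h|%N%:R ^+ e * gamma h)|.

(** The data point [w] is frozen and enters only through the covariance of [Xs] and the two
    deviations. From 2 kap <= s and e <= kap, the estimated lag sum is at least kap, so division by
    it is safe. *)
Lemma bootstrap_tstat_close (K : nat) : (0 < K)%N -> exists2 L, 0 <= L &
  forall d' (S' : measurableType d') (Q : probability S' R) T
    (Xs : 'I_T -> {mfun S' >-> R}) (l kap e : R) (w : S),
  let m := (T %/ K)%N in
  (0 < T)%N -> equal_groups K T -> 0 < l -> l <= m%:R ->
  is_mvnormal Q Xs 0 (boot_cov (fun i : 'I_T => X i.+1%:Z w) l) ->
  0 < kap -> e <= kap -> 0 <= e <= 1 -> 2 * kap <= isum m gamma ->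
  lag_deviation T m 0 l w <= e -> lag_deviation T m 1 l w <= e ->
  (2 * C + 1) / kap / m%:R <= (4 * K.+1%:R)^-1 ->
  (kap^-1 + C / kap / kap + C / kap) * (e + m%:R^-1) / m%:R <= 1 ->
  0 <= abs_cdf_dist P (fun u => tstat K (fun i : 'I_T => X i.+1%:Z u - mean))
    Q (fun u => tstat K (fun i => Xs i u)) <=
  L * ((kap^-1 + C / kap / kap + C / kap) * (e + m%:R^-1) / m%:R).
Proof.
move=> K0; have [L L0 HL] := tstat_comparison R K; exists L => //.
move=> d' S' Q T Xs l kap e w m T0 eqg l0 lm nX kap0 ek e01 sk d0 d1 near1 b1.
pose r (h : int) := bartlett (h%:~R / l) * sample_acov (fun i : 'I_T => X i.+1%:Z w) `|h|%N.
have TE := equal_groups_mul K0 T0 eqg.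
have m0 : (0 < m)%N by have := T0; rewrite [X in (_ < X)%N]TE muln_gt0 => /andP[].
have ge h : gamma (- h) = gamma h by exact: stationary_cov_even sX h.
have re h : r (- h) = r h by rewrite /r abszN mulrNz mulNr bartlettN.
have r_supp h : (m < `|h|)%N -> r h = 0.
  move=> mh; have := @lag_kernel_eq0 _ 0 l h l0.
  rewrite /lag_kernel expr0 mul1r /r => ->; first by rewrite mul0r.
  by rewrite (le_trans lm)// ler_nat ltnW.
have s0E : acov_lag_sum X T m 0 l w = isum m r.
  by apply: eq_isum => h _; rewrite /lag_kernel expr0 mul1r.
have s1E : acov_lag_sum X T m 1 l w = isum m (fun h => `|h|%N%:R * r h).
  by apply: eq_isum => h _; rewrite /lag_kernel expr1 -[LHS]mulrA.
have g0E : isum m (fun h => `|h|%N%:R ^+ 0 * gamma h) = isum m gamma.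
  by apply: eq_isum => h _; rewrite expr0 mul1r.
have g1E : isum m (fun h => `|h|%N%:R ^+ 1 * gamma h) = isum m (fun h => `|h|%N%:R * gamma h).
  by apply: eq_isum => h _; rewrite expr1.
rewrite /lag_deviation s0E g0E in d0; rewrite /lag_deviation s1E g1E in d1.
have kg : kap <= isum m gamma by move: sk kap0; lra.
have kr : kap <= isum m r.
  by move: d0; rewrite ler_norml => /andP[]; move: sk ek; lra.
have gZ : gauss_vec P (fun (i : 'I_T) u => X i.+1%:Z u - mean)
    (fun i j => gamma (i%:Z - j%:Z)).
  rewrite (_ : (fun i j : 'I_T => gamma (i%:Z - j%:Z)) = (fun i j => gamma (i.+1%:Z - j.+1%:Z))).
    exact: (gaussian_stationary gX sX (fun i : 'I_T => i.+1%:Z)).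
  apply/funext => i; apply/funext => j.
  by rewrite subSSz.
have gZ' : gauss_vec Q (fun i => Xs i) (fun i j => r (i%:Z - j%:Z)).
  rewrite (_ : (fun i j : 'I_T => r (i%:Z - j%:Z)) =
      (fun i j => boot_cov (fun i : 'I_T => X i.+1%:Z w) l i j)).
    exact: gauss_vec_mvnormal nX.
  by apply/funext => i; apply/funext => j; rewrite boot_cov_lag.
have mR : (0 : R) < m%:R by rewrite ltr0n.
have C0 := moment2_bound_ge0 gamma2.
apply: (HL _ _ _ _ _ _ _ _ _ _ _ _ K0 T0 eqg gZ gZ' ge re
   (m%:R * isum m gamma)^-1 (m%:R * isum m r)^-1).
- by rewrite invr_gt0 mulr_gt0// (lt_le_trans _ kg).
- by rewrite invr_gt0 mulr_gt0// (lt_le_trans _ kr).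
- exact: (near_id_group_cov gamma2 K0 T0 eqg ge m0 kap0 kg).
- exact: (near_id_group_cov_boot gamma2 K0 T0 eqg m0 re r_supp kap0 e01 kr).
- have /andP[e0 _] := e01.
  rewrite b1 andbT !mulr_ge0 ?addr_ge0 ?invr_ge0 ?mulr_ge0 ?invr_ge0 ?(ltW kap0) ?(ltW mR)//.
- exact: (group_cov_close gamma2 K0 T0 eqg ge m0 re r_supp kap0 e01 kg kr d0 d1).
Qed.
End bootstrap.

(** * Choice of the thresholds and conclusion *)

Lemma div_natr_small (R : realType) (a t : R) : 0 < t ->
  exists N, forall m, (N < m)%N -> a / m%:R <= t.
Proof.
move=> t0; exists (Num.bound (a / t)) => m Nm.
have m0 : (0 : R) < m%:R by rewrite ltr0n (leq_trans _ Nm).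
rewrite ler_pdivrMr// mulrC -ler_pdivrMr//; apply/ltW.
have [at0|at0] := leP 0 (a / t); last exact: lt_trans m0.
by apply: lt_trans (archi_boundP at0) _; rewrite ltr_nat.
Qed.

Lemma measurable_lag_deviation d (S : measurableType d) (R : realType)
    (X : int -> {mfun S >-> R}) (gamma : int -> R) n m e (l c : R) :
  (0 < n)%N -> 1 <= l -> l <= m%:R ->
  measurable [set w | c <= lag_deviation X gamma n m e l w].
Proof.
move=> n0 l1 lm; rewrite -[X in measurable X]setTI.
apply: (measurable_fun_le (f := fun=> c) measurableT); first exact: measurable_cst.
apply: measurableT_comp => //; apply: measurable_funB => //.
exact: measurable_acov_lag_sum.
Qed.

(** 1/l < 1/K forces l >= 1, and l^3 / (K m) < 1/K forces l^3 < m, whence l <= l^3 <= m. *)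
Lemma bandwidth_le (R : realType) (l : R) (K m : nat) : (0 < K)%N -> (0 < m)%N -> 0 < l ->
  1 / l + l ^+ 3 / (K * m)%:R < K%:R^-1 -> 1 <= l <= m%:R.
Proof.
move=> K0 m0 l0 H.
have KR : (0 : R) < K%:R by rewrite ltr0n.
have mR : (0 : R) < m%:R by rewrite ltr0n.
have q0 : 0 < l ^+ 3 / (K * m)%:R by rewrite divr_gt0 ?exprn_gt0// natrM mulr_gt0.
have i0 : 0 < 1 / l by rewrite divr_gt0.
have l1 : 1 <= l.
  rewrite -(@invf_le1 _ l)// -div1r.
  apply: (@le_trans _ _ K%:R^-1); first by move: H q0; lra.
  by rewrite invf_le1// ler1n.
rewrite l1 /=; have : l ^+ 3 / (K * m)%:R < K%:R^-1 by move: H i0; lra.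
rewrite natrM invfM mulrCA -[ltRHS]mulr1 ltr_pM2l ?invr_gt0// ltr_pdivrMr// mul1r.
move=> /ltW; apply: le_trans; rewrite -[leLHS]expr1 ler_weXn2l//.
Qed.

Lemma addn4_lt a b c k m : (a + b + c + k < m)%N ->
  [/\ (a < m)%N, (b < m)%N, (c < m)%N & (k < m)%N].
Proof. by move=> H; split; lia. Qed.

Theorem theorem3p1 (R : realType)
  (d : measure_display) (Omega : measurableType d) (P : probability Omega R)
  (X : int -> {mfun Omega >-> R}) (mu mu0 : R) (gamma : int -> R)
  (K : nat) (l : nat -> R)
  (d' : measure_display) (Omega' : measurableType d')
  (Pstar : nat -> Omega -> probability Omega' R)
  (Xstar : forall T : nat, Omega -> 'I_T -> {mfun Omega' >-> R}) :
  let data (T : nat) (w : Omega) : 'I_T -> R := fun i => X (i.+1)%:Z w in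
  let Tinfty : set_system nat := within [set T | equal_groups K T] \oo in
  gaussian_series P X ->
  stationary_with P X mu gamma ->
  0 < zseries gamma ->
  (\esum_(h in [set: int]) (h%:~R ^+ 2 * `|gamma h|)%:E < +oo)%E ->
  (2 <= K)%N ->
  mu = mu0 ->
  (forall T : nat, (0 < T)%N -> 0 < l T) ->
  (1 / l T + l T ^+ 3 / T%:R) @[T --> Tinfty] --> (0 : R) ->
  (forall (T : nat) (w : Omega),
     is_mvnormal (Pstar T w) (Xstar T w) 0 (boot_cov (data T w) (l T))) ->
  little_op P Tinfty
    (fun T w =>
       abs_cdf_dist
         P (fun u => tstat K (fun i => data T u i - mu0))
         (Pstar T w) (fun u => tstat K (fun i => Xstar T w i u)))
    (fun T => 1 / T%:R).
Proof.
move=> data Tinfty gX sX zpos sum_fin K2 mumu0 l0 lim nX eps eps0.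
rewrite -mumu0.
have K0 : (0 < K)%N by exact: ltn_trans K2.
have [C gamma2] : exists C, forall (c : int) n,
    \sum_(b < n) ((c - b%:Z)%:~R ^+ 2 * `|gamma (c - b%:Z)|) <= C.
  exists (fine (\esum_(h in [set: int]) (h%:~R ^+ 2 * `|gamma h|)%:E)) => c n.
  apply: (@esum_int_le _ (fun h => h%:~R ^+ 2 * `|gamma h|)).
    by move=> h; rewrite mulr_ge0// sqr_ge0.
  rewrite fineK// ge0_fin_numE//; apply: esum_ge0 => h _.
  by rewrite lee_fin mulr_ge0// sqr_ge0.
have C0 := moment2_bound_ge0 gamma2.
have [L L0 HL] := bootstrap_tstat_close gX sX gamma2 K0.
(* The truncated sums tend to 4 kap, hence eventually exceed 2 kap; an estimation error of at most
   kap then leaves at least kap. *)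
pose kap := zseries gamma / 4.
have kap0 : 0 < kap by rewrite divr_gt0.
pose Lam := kap^-1 + C / kap / kap + C / kap.
have Lam0 : 0 <= Lam by rewrite !addr_ge0 ?mulr_ge0 ?invr_ge0 ?(ltW kap0).
pose B := K%:R * L * Lam.
have B0 : 0 <= B by rewrite !mulr_ge0.
(* The three bounds keep the estimated lag sum away from 0, meet the condition [e <= 1], and give B
   e <= eps / 4; B + 1 guards against B = 0. *)
pose e := Num.min kap (Num.min 1 (eps / (4 * (B + 1)))).
have e0 : 0 < e by rewrite !lt_min kap0 ltr01 divr_gt0// mulr_gt0// ltr_pwDr.
have ek : e <= kap by rewrite ge_min lexx.
have e1 : e <= 1 by rewrite !ge_min lexx orbT.
have Be : B * e <= eps / 4.
  apply: (@le_trans _ _ (B * (eps / (4 * (B + 1))))).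
    by rewrite ler_wpM2l// !ge_min lexx !orbT.
  rewrite mulrA ler_pdivrMr ?mulr_gt0 ?ltr_pwDr//.
  have : 0 <= eps * 1 by rewrite mulr1 ltW.
  nra.
pose G := `|gamma 0| + C.
have G0 : 0 <= G by exact: addr_ge0.
pose del T := 1 / l T + l T ^+ 3 / T%:R.
pose c1 := 960 * G ^+ 2 / e ^+ 2.
have [N1 _ HN1] : \forall m \near \oo, 2 * kap < isum m gamma.
  by apply: (cvgr_gt _ (isum_cvg gamma2)); rewrite /kap; move: zpos; lra.
have Knear : 0 < (4 * K.+1%:R)^-1 :> R by rewrite invr_gt0 mulr_gt0.
have [N2 HN2] := @div_natr_small _ ((2 * C + 1) / kap) _ Knear.
have [N3 HN3] := @div_natr_small _ (Lam * 2) _ (@ltr01 R).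
have eps4 : 0 < eps / 4 by rewrite divr_gt0.
have [N4 HN4] := @div_natr_small _ B _ eps4.
have KV : (0 : R) < K%:R^-1 by rewrite invr_gt0 ltr0n.
have dG : 0 < e / (2 * (9 * G + C + 1)).
  by rewrite divr_gt0// mulr_gt0// ltr_pwDr// addr_ge0// mulr_ge0.
have FT : Filter Tinfty by exact: within_filter.
have small t : 0 < t -> \forall T \near Tinfty, del T < t by move=> t0; exact: (@cvgr_lt R nat Tinfty FT del 0 lim t t0).
have large N : \forall T \near Tinfty, (N <= T)%N.
  by apply: cvg_within; exact: nbhs_infty_ge.
have groups : \forall T \near Tinfty, equal_groups K T by exact: withinT.
apply: (@squeeze_cvge _ Tinfty _ _ (fun=> 0%E) _ (fun T => ((c1 + c1) * del T)%:E)); last 2 first.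
- exact: cvg_cst.
- apply: cvg_EFin; first by near=> T.
  rewrite -[X in _ --> X](mulr0 (c1 + c1)); apply: cvgMr => //; exact: lim.
near=> T.
have eqg : equal_groups K T by near: T.
have NT : (K * (N1 + N2 + N3 + N4).+1 <= T)%N by near: T; exact: large.
have d1 : del T < K%:R^-1 by near: T; exact: small.
have d2 : del T < e / (2 * (9 * G + C + 1)) by near: T; exact: small.
have T0 : (0 < T)%N by apply: leq_trans NT; rewrite muln_gt0 K0.
have TE := equal_groups_mul K0 T0 eqg.
rewrite mu_ext_ge0//=.
set m := (T %/ K)%N in TE.
have Nm : (N1 + N2 + N3 + N4 < m)%N by move: NT; rewrite TE leq_pmul2l.
have [N1m N2m N3m N4m] := addn4_lt Nm.
have m0 : (0 < m)%N by apply: leq_ltn_trans Nm.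
have mR : (0 : R) < m%:R by rewrite ltr0n.
have lT0 := l0 T T0.
have /andP[l1 lm] : 1 <= l T <= m%:R.
  by apply: (bandwidth_le K0 m0 lT0); rewrite -TE.
have delT0 : 0 <= del T.
  by rewrite /del addr_ge0 ?divr_ge0 ?exprn_ge0 ?(ltW lT0).
have delT1 : del T <= 1.
  by apply: le_trans (ltW d1) _; rewrite invf_le1 ?ltr0n// ler1n.
have bias : (9 * G + C) * del T <= e / 2.
  move: d2; rewrite ltr_pdivlMr; last first.
    by rewrite mulr_gt0// ltr_pwDr// addr_ge0// mulr_ge0.
  by move: delT0 e0; clear; move: (del T) => x x0 e0; nra.
have mT : (m <= T)%N by rewrite TE leq_pmull.
pose A i := [set w | e <= lag_deviation X gamma T m i (l T) w].
have mA i : measurable (A i) by exact: measurable_lag_deviation.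
have PA i : (i <= 1)%N -> (P (A i) <= (c1 * del T)%:E)%E.
  by move=> i1; exact: (acov_lag_sum_deviation gX sX gamma2 T0 mT i1 l1 lm e0 bias delT1).
(* Off the two measurable deviation events the distance is deterministically small; monotonicity of
   the outer measure then dispenses with measurability of the distance in [w]. *)
have sub : [set w | eps <= `|abs_cdf_dist P (fun u => tstat K (fun i => data T u i - mu))
      (Pstar T w) (fun u => tstat K (fun i => Xstar T w i u)) / (1 / T%:R)|] `<=` A 0%N `|` A 1%N.
  move=> w /= epsw; apply: contrapT => /not_orP[/negP dev0 /negP dev1].
  move: dev0 dev1; rewrite -!ltNge => /ltW dev0 /ltW dev1.
  have e01 : 0 <= e <= 1 by rewrite (ltW e0).
  have sk : 2 * kap <= isum m gamma by exact/ltW/HN1/ltnW.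
  have mV1 : m%:R^-1 <= (1 : R) by rewrite invf_le1// ler1n.
  have close1 : Lam * (e + m%:R^-1) / m%:R <= 1.
    apply: le_trans (HN3 m N3m); rewrite ler_wpM2r ?invr_ge0 ?(ltW mR)// ler_wpM2l//.
    lra.
  have := HL _ _ (Pstar T w) T (Xstar T w) (l T) kap e w T0 eqg lT0 lm (nX T w)
    kap0 ek e01 sk dev0 dev1 (HN2 m N2m) close1.
  move: epsw; set D := abs_cdf_dist _ _ _ _ => epsw /andP[D0 DL].
  have TR : (0 : R) < T%:R by rewrite ltr0n.
  move: epsw; rewrite leNgt => /negP; apply.
  rewrite div1r invrK ger0_norm ?mulr_ge0//.
  (* Since T = K m, multiplication by T cancels the factor 1/m; both remaining terms are at most eps
     / 4. *)
  apply: (@le_lt_trans _ _ (B * e + B / m%:R)); last first.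
    have := HN4 m N4m; move: Be eps0; clear; lra.
  apply: le_trans (ler_wpM2r (ltW TR) DL) _.
  rewrite (_ : T%:R = K%:R * m%:R :> R); last by rewrite -natrM -TE.
  rewrite -/Lam /B le_eqVlt; apply/orP; left; apply/eqP.
  by field; rewrite gt_eqF.
apply: le_trans (le_mu_ext P sub) _.
rewrite (measurable_mu_extE P (measurableU _ _ (mA 0%N) (mA 1%N))).
apply: le_trans (measureU2 P (mA 0%N) (mA 1%N)) _.
by rewrite mulrDl EFinD leeD// PA.
Unshelve. all: by end_near.
Qed.
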